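(* Let $\mathbf p=(p_1\ge\dots\ge p_n)$ be a signature of $\mathrm{GL}(n,\mathbb C)$, and let $\mathrm{Pol}(N_n^+)$ be the space of polynomials in the variables $z_{ij}$, $i<j$. Let $\mu^n_{\mathbf p}$ be the measure on $N_n^+$ given by $$d\mu^n_{\mathbf p}(Z)=\prod_{j=1}^{n-1}\det\bigl([Z]_{jn}([Z]_{jn})^*\bigr)^{-(p_j-p_{j+1})-2}\,d\dot Z .$$ Then: (a) $V^n_{\mathbf p}=L^2(N_n^+,\mu^n_{\mathbf p})\cap\mathrm{Pol}(N_n^+)$. (b) The $L^2(N_n^+,\mu^n_{\mathbf p})$-inner product on $V^n_{\mathbf p}$ is $\mathrm U(n)$-invariant (for the representation $\rho_{\mathbf p}$ restricted to $\mathrm U(n)$).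
   Context: $N_n^+$ is the group of upper triangular complex $n\times n$ matrices $Z=(z_{ij})$ with unit diagonal; $B_n^-$ is the group of invertible lower triangular matrices; $\mathrm U(n)$ the unitary group. $V^n_{\mathbf p}$ is the space of polynomials on $N_n^+$ that are restrictions to $N_n^+$ of functions $f$ on $\mathrm{GL}(n,\mathbb C)$, polynomial in the matrix entries and $\det(g)^{-1}$, with $f(bg)=\prod_j b_{jj}^{p_j}f(g)$ for all $b\in B_n^-$. $\mathrm{GL}(n,\mathbb C)$ acts on it by right shifts; in coordinates $(\rho_{\mathbf p}(g)f)(Z)=f(Z^{[g]})\prod_{j=1}^n b_{jj}(Z,g)^{p_j}$, where $Zg=b(Z,g)Z^{[g]}$, $b(Z,g)\in B_n^-$, $Z^{[g]}\in N_n^+$. $[Z]_{jn}$ is the upper-left $j\times n$ corner of $Z$ (its first $j$ rows), $X^*$ is the conjugate transpose, and $d\dot Z=\prod_{k<l}d\,\mathrm{Re}\,z_{kl}\,d\,\mathrm{Im}\,z_{kl}$. *)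

(* Defs.v *)
From HB Require Import structures.
From mathcomp Require Import all_boot all_order all_algebra.
From mathcomp Require Import all_classical all_reals all_analysis.
From mathcomp Require Import measurable_realfun complex.
From mathcomp Require mpoly.
From mathcomp Require Import spectral.

Set Implicit Arguments.
Unset Strict Implicit.
Unset Printing Implicit Defensive.

Import Order.TTheory GRing.Theory Num.Theory.
Import numFieldNormedType.Exports.

Local Open Scope classical_set_scope.
Local Open Scope sesquilinear_scope.
Local Open Scope ring_scope.

(* The library proves this, but the canonical sigma-finite structure on
   m1 \x m2 is shadowed by the one for subprobabilities. *)
Lemma product_measure1_sigma_finite d1 d2 (T1 : measurableType d1)
    (T2 : measurableType d2) (R : realType)
    (m1 : {sigma_finite_measure set T1 -> \bar R})
    (m2 : {sigma_finite_measure set T2 -> \bar R}) :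
  sigma_finite setT (m1 \x m2)%E.
Proof.
have /sigma_finiteP[F [TF ndF Foo]] := sigma_finiteT m1.
have /sigma_finiteP[G [TG ndG Goo]] := sigma_finiteT m2.
exists (fun n => F n `*` G n).
  rewrite -setXTT TF TG predeqE => -[x y]; split.
    move=> [/= [n _ Fnx] [k _ Gky]]; exists (maxn n k) => //; split.
    - by move: x Fnx; exact/subsetPset/ndF/leq_maxl.
    - by move: y Gky; exact/subsetPset/ndG/leq_maxr.
  by move=> [n _ []/= ? ?]; split; exists n.
move=> k; have [? ?] := Foo k; have [? ?] := Goo k.
split; first exact: measurableX.
by rewrite product_measure1E// lte_mul_pinfty// ge0_fin_numE.
Qed.

Section product_power.
Context d (T : measurableType d) (R : realType).
Variable mu : {sigma_finite_measure set T -> \bar R}.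

Definition tuple_cons m (x : T * m.-tuple T) : m.+1.-tuple T := [tuple of x.1 :: x.2].

Lemma measurable_tuple_cons m : measurable_fun setT (@tuple_cons m).
Proof. exact: measurable_cons. Qed.

Section step.
Variables (m : nat) (nu : {sigma_finite_measure set (m.-tuple T) -> \bar R}).

Definition measure_cons : set (m.+1.-tuple T) -> \bar R :=
  pushforward (mu \x nu)%E (@tuple_cons m).

Let mc0 : measure_cons set0 = 0%E.
Proof. by rewrite /measure_cons /pushforward preimage_set0 measure0. Qed.

Let mc_ge0 A : (0 <= measure_cons A)%E.
Proof. by rewrite /measure_cons /pushforward; exact: measure_ge0. Qed.

Let mc_sigma_additive : semi_sigma_additive measure_cons.
Proof.
have mf := @measurable_tuple_cons m.
move=> F mF tF mUF; rewrite /measure_cons /pushforward preimage_bigcup.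
apply: measure_semi_sigma_additive.
- by move=> n; rewrite -[X in measurable X]setTI; exact: mf.
- apply/trivIsetP => /= i j _ _ ij; rewrite -preimage_setI.
  by move/trivIsetP : tF => /(_ _ _ _ _ ij) ->//; rewrite preimage_set0.
- by rewrite -preimage_bigcup -[X in measurable X]setTI; exact: mf.
Qed.

HB.instance Definition _ := isMeasure.Build _ _ _ measure_cons
  mc0 mc_ge0 mc_sigma_additive.

Let mc_sigma_finite : sigma_finite setT measure_cons.
Proof.
have [F UF Ffin] := product_measure1_sigma_finite mu nu.
pose g (t : m.+1.-tuple T) : T * m.-tuple T := (thead t, [tuple of behead t]).
have gK : cancel (@tuple_cons m) g.
  case=> x t; rewrite /g /tuple_cons /= theadE; congr pair.
  exact/val_inj.
have mg : measurable_fun setT g.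
  apply/measurable_fun_pair; first exact: measurable_tnth.
  exact: measurable_behead.
exists (fun i => g @^-1` F i).
  by rewrite -preimage_bigcup -UF preimage_setT.
move=> i; have [mFi finFi] := Ffin i; split.
  by rewrite -[X in measurable X]setTI; exact: mg.
rewrite /measure_cons /pushforward -comp_preimage.
by rewrite (_ : g \o _ = id)//; apply/funext => x /=; rewrite gK.
Qed.

HB.instance Definition _ := Measure_isSigmaFinite.Build _ _ _ measure_cons
  mc_sigma_finite.

End step.

(* The m-fold product measure mu \x ... \x mu on m-tuples. *)
Fixpoint measure_pow (m : nat) : {sigma_finite_measure set (m.-tuple T) -> \bar R} :=
  match m with
  | 0 => \d_([tuple] : 0.-tuple T)
  | m'.+1 => measure_cons (measure_pow m')
  end.

End product_power.

Section unitriangular.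
Variables (R : realType) (n : nat).
Local Notation C := R[i].

Definition is_unitriangular (Z : 'M[C]_n) : bool :=
  is_trig_mx Z^T && [forall i, Z i i == 1].

(* The group N_n^+; the library's is_trig_mx means lower triangular. *)
Record unitri := Unitri { umx :> 'M[C]_n; _ : is_unitriangular umx }.

HB.instance Definition _ := [isSub for umx].
HB.instance Definition _ := [Choice of unitri by <:].

Lemma unitriangular1 : is_unitriangular 1%:M.
Proof.
rewrite /is_unitriangular trmx1 scalar_mx_is_trig.
by apply/forallP => i; rewrite mxE eqxx.
Qed.

HB.instance Definition _ := isPointed.Build unitri (Unitri unitriangular1).

Definition upair := {ij : 'I_n * 'I_n | (ij.1 < ij.2)%N}.

(* The strictly upper triangular entries z_kl (k < l), linearly enumerated. *)
Definition uentry (Z : 'M[C]_n) (k : 'I_#|{: upair}|) : C :=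
  Z (val (enum_val k)).1 (val (enum_val k)).2.

Definition plane : Type := (measurableTypeR R * measurableTypeR R)%type.
HB.instance Definition _ := Measurable.on plane.

Definition plane_lebesgue : set plane -> \bar R :=
  (lebesgue_measure \x lebesgue_measure)%E.
HB.instance Definition _ := Measure.on plane_lebesgue.
HB.instance Definition _ := Measure_isSigmaFinite.Build _ _ _ plane_lebesgue
  (product_measure1_sigma_finite lebesgue_measure lebesgue_measure).

Definition ucoord (Z : unitri) : #|{: upair}|.-tuple plane :=
  [tuple (complex.Re (uentry Z k), complex.Im (uentry Z k)) | k < #|{: upair}|].

Definition uparam_mx (t : #|{: upair}|.-tuple plane) : 'M[C]_n :=
  \matrix_(i, j)
    if insub (i, j) is Some ij then
      let x := tnth t (enum_rank (ij : upair)) in Complex x.1 x.2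
    else (i == j)%:R.

Lemma uparam_subproof t : is_unitriangular (uparam_mx t).
Proof.
apply/andP; split.
  apply/is_trig_mxP => i j ij; rewrite !mxE.
  rewrite insubF /=; last by rewrite ltnNge ltnW.
  by rewrite -val_eqE /= gtn_eqF.
by apply/forallP => i; rewrite mxE insubF /= ?ltnn// eqxx.
Qed.

Definition uparam t : unitri := Unitri (uparam_subproof t).

Lemma uparamK : cancel uparam ucoord.
Proof.
move=> t; apply: eq_from_tnth => k; rewrite tnth_mktuple /uentry /= mxE.
rewrite -surjective_pairing valK /= enum_valK.
by rewrite -surjective_pairing.
Qed.

Lemma ucoordK : cancel ucoord uparam.
Proof.
move=> Z; apply/val_inj/matrixP => i j; rewrite mxE.
have /andP[/is_trig_mxP Zt /forallP Z1] := valP Z.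
case: insubP => [ij ijlt ijE|].
  rewrite tnth_mktuple /uentry enum_rankK /= ijE /=.
  by case: (_ i j).
rewrite /= -leqNgt leq_eqVlt => /orP[/eqP/val_inj <-|ji].
  by rewrite eqxx (eqP (Z1 j)).
by have := Zt _ _ ji; rewrite mxE /= => ->; rewrite -val_eqE /= gtn_eqF.
Qed.

Definition unitri_display : measure_display. Proof. exact: default_measure_display. Qed.

Definition unitri_measurable : set (set unitri) :=
  preimage_set_system setT ucoord measurable.

Let um0 : unitri_measurable set0.
Proof. by exists set0; rewrite ?preimage_set0 ?setI0. Qed.

Let umC A : unitri_measurable A -> unitri_measurable (~` A).
Proof.
move=> [B mB <-]; exists (~` B); first exact: measurableC.
by rewrite !setTI preimage_setC.
Qed.

Let um_bigcup (F : (set unitri)^nat) :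
  (forall i, unitri_measurable (F i)) -> unitri_measurable (\bigcup_i F i).
Proof.
move=> mF.
have /choice[G GP] i : exists B, measurable B /\ setT `&` ucoord @^-1` B = F i.
  by have [B mB BF] := mF i; exists B.
exists (\bigcup_i G i).
  by apply: bigcup_measurable => i _; case: (GP i).
rewrite setTI preimage_bigcup; apply: eq_bigcupr => i _.
by have [_ <-] := GP i; rewrite setTI.
Qed.

HB.instance Definition _ :=
  @isMeasurable.Build unitri_display unitri unitri_measurable um0 umC um_bigcup.

Lemma measurable_ucoord : measurable_fun setT ucoord.
Proof. by move=> _ A mA; exists A. Qed.

Lemma measurable_uparam : measurable_fun setT uparam.
Proof.
move=> _ A [B mB <-]; rewrite !setTI -comp_preimage.
rewrite (_ : _ \o _ = id)//.
by apply/funext => t /=; rewrite uparamK.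
Qed.

(* The measure \prod_(k < l) d(Re z_kl) d(Im z_kl). *)
Definition unitri_lebesgue : set unitri -> \bar R :=
  pushforward (measure_pow plane_lebesgue #|{: upair}|) uparam.

Let ul0 : unitri_lebesgue set0 = 0%E.
Proof. by rewrite /unitri_lebesgue /pushforward preimage_set0 measure0. Qed.

Let ul_ge0 A : (0 <= unitri_lebesgue A)%E.
Proof. by rewrite /unitri_lebesgue /pushforward; exact: measure_ge0. Qed.

Let ul_sigma_additive : semi_sigma_additive unitri_lebesgue.
Proof.
have mf := measurable_uparam.
move=> F mF tF mUF; rewrite /unitri_lebesgue /pushforward preimage_bigcup.
apply: measure_semi_sigma_additive.
- by move=> i; rewrite -[X in measurable X]setTI; exact: mf.
- apply/trivIsetP => /= i j _ _ ij; rewrite -preimage_setI.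
  by move/trivIsetP : tF => /(_ _ _ _ _ ij) ->//; rewrite preimage_set0.
- by rewrite -preimage_bigcup -[X in measurable X]setTI; exact: mf.
Qed.

HB.instance Definition _ := isMeasure.Build _ _ _ unitri_lebesgue
  ul0 ul_ge0 ul_sigma_additive.

End unitriangular.

Section complex_valued.
Variable R : realType.
Local Notation C := R[i].

Section measurable.
Context d (T : measurableType d).
Implicit Types f g : T -> C.

Definition cmeasurable f :=
  measurable_fun setT (fun x => complex.Re (f x)) /\
  measurable_fun setT (fun x => complex.Im (f x)).

Lemma cmeasurable_cst (c : C) : cmeasurable (fun=> c).
Proof. by split; exact: measurable_cst. Qed.

Lemma cmeasurableD f g :
  cmeasurable f -> cmeasurable g -> cmeasurable (fun x => f x + g x).
Proof.
move=> [f1 f2] [g1 g2]; split.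
  rewrite (_ : (fun x => _) = (fun x => complex.Re (f x) + complex.Re (g x))).
    exact: measurable_funD.
  by apply/funext => x; case: (f x) => ? ?; case: (g x).
rewrite (_ : (fun x => _) = (fun x => complex.Im (f x) + complex.Im (g x))).
  exact: measurable_funD.
by apply/funext => x; case: (f x) => ? ?; case: (g x).
Qed.

Lemma cmeasurableM f g :
  cmeasurable f -> cmeasurable g -> cmeasurable (fun x => f x * g x).
Proof.
move=> [f1 f2] [g1 g2]; split.
  rewrite (_ : (fun x => _) = (fun x =>
      complex.Re (f x) * complex.Re (g x) - complex.Im (f x) * complex.Im (g x))).
    by apply: measurable_funB; exact: measurable_funM.
  by apply/funext => x; case: (f x) => ? ?; case: (g x).
rewrite (_ : (fun x => _) = (fun x =>
    complex.Re (f x) * complex.Im (g x) + complex.Im (f x) * complex.Re (g x))).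
  by apply: measurable_funD; exact: measurable_funM.
by apply/funext => x; case: (f x) => ? ?; case: (g x).
Qed.

Lemma cmeasurable_conj f : cmeasurable f -> cmeasurable (fun x => (f x)^*).
Proof.
move=> [f1 f2]; split.
  rewrite (_ : (fun x => _) = (fun x => complex.Re (f x)))//.
  by apply/funext => x; case: (f x).
rewrite (_ : (fun x => _) = (fun x => - complex.Im (f x))).
  exact: measurableT_comp.
by apply/funext => x; case: (f x).
Qed.

Lemma cmeasurable_sum I (s : seq I) (P : pred I) (h : I -> T -> C) :
  (forall i, cmeasurable (h i)) ->
  cmeasurable (fun x => \sum_(i <- s | P i) h i x).
Proof.
move=> mh; elim: s => [|i s IH].
  by under eq_fun do rewrite big_nil; exact: cmeasurable_cst.
under eq_fun do rewrite big_cons.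
by case: (P i) => //; exact: cmeasurableD.
Qed.

Lemma cmeasurable_prod I (s : seq I) (P : pred I) (h : I -> T -> C) :
  (forall i, cmeasurable (h i)) ->
  cmeasurable (fun x => \prod_(i <- s | P i) h i x).
Proof.
move=> mh; elim: s => [|i s IH].
  by under eq_fun do rewrite big_nil; exact: cmeasurable_cst.
under eq_fun do rewrite big_cons.
by case: (P i) => //; exact: cmeasurableM.
Qed.

Lemma cmeasurable_det m (A : T -> 'M[C]_m) :
  (forall i j, cmeasurable (fun x => A x i j)) ->
  cmeasurable (fun x => \det (A x)).
Proof.
move=> mA; rewrite /determinant; apply: cmeasurable_sum => s.
apply: cmeasurableM; first exact: cmeasurable_cst.
exact: cmeasurable_prod.
Qed.

Variable mu : {measure set T -> \bar R}.

Definition L2 : set (T -> C) :=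
  [set f | cmeasurable f /\ (\int[mu]_x (Normc.normc (f x) ^+ 2)%:E < +oo)%E].

Definition L2_inner f g : C :=
  Complex (\int[mu]_x complex.Re (f x * (g x)^*))
          (\int[mu]_x complex.Im (f x * (g x)^*)).

End measurable.

Lemma gram_det_ge0 m n (A : 'M[C]_(m, n)) : 0 <= \det (A *m A^t*).
Proof.
set G := A *m A^t*.
have G_herm : G^t* = G by rewrite /G trmx_mul map_mxM trmxCK.
have /orthomx_spectralP GE : G \is normalmx by apply/normalmxP; rewrite G_herm.
have Pu := spectral_unitarymx G.
set P := spectralmx G in GE Pu.
set e := spectral_diag G in GE.
have De : diag_mx e = (P *m A) *m (P *m A)^t*.
  rewrite trmx_mul map_mxM mulmxA -(mulmxA P) -/G GE !mulmxA.
  rewrite mulmxV ?spectral_unit// mul1mx -mulmxA.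
  by move/unitarymxP : Pu => ->; rewrite mulmx1.
have e_ge0 i : 0 <= e 0 i.
  have -> : e 0 i = diag_mx e i i by rewrite mxE eqxx.
  rewrite De mxE sumr_ge0// => k _; rewrite [X in _ * X]mxE [X in _ * X^*]mxE.
  by rewrite mul_conjC_ge0.
rewrite GE !det_mulmx mulrAC -det_mulmx mulVmx ?spectral_unit// det1 mul1r.
by rewrite det_diag prodr_ge0.
Qed.

End complex_valued.

Section weight.
Variables (R : realType) (n : nat).
Local Notation C := R[i].
Local Notation N := (unitri R n).
Implicit Types (Z : N) (p : n.-tuple int).

(* With j counted from 0, these are the first j + 1 rows of Z. *)
Definition corner (j : 'I_n) (Z : 'M[C]_n) : 'M[C]_(j.+1, n) :=
  rowsub (widen_ord (ltn_ord j)) Z.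

(* The Gram determinant is a nonnegative real (gram_det_ge0), so nothing is
   lost by taking its real part. *)
Definition corner_det (j : 'I_n) Z : R :=
  complex.Re (\det (corner j Z *m (corner j Z)^t*)).

(* Indices are counted from 0: the factor of index j comes from the corner with
   j + 1 rows, and j + 1 < n leaves out the full matrix. *)
Definition weight p Z : R :=
  \prod_(j < n | (j.+1 < n)%N) corner_det j Z ^ (- (p`_j - p`_j.+1) - 2).

Lemma corner_det_ge0 j Z : 0 <= corner_det j Z.
Proof. by have := gram_det_ge0 (corner j Z); rewrite lecE => /andP[]. Qed.

Lemma weight_ge0 p Z : 0 <= weight p Z.
Proof.
by apply: prodr_ge0 => j _; rewrite exprz_ge0// corner_det_ge0.
Qed.

Lemma cmeasurable_entry i j : cmeasurable (fun Z : N => Z i j).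
Proof.
suff H (t : #|{: upair n}|.-tuple (plane R) -> C) :
    cmeasurable t -> cmeasurable (t \o @ucoord R n).
  rewrite (_ : (fun Z : N => _) = (fun t => uparam t i j) \o @ucoord R n); last first.
    by apply/funext => Z /=; rewrite -{1}(ucoordK Z).
  apply: H; rewrite (_ : (fun t => _) = (fun t : #|{: upair n}|.-tuple (plane R) =>
    if insub (i, j) is Some ij then
      let x := tnth t (enum_rank (ij : upair n)) in Complex x.1 x.2
    else (i == j)%:R)); last by apply/funext => t; rewrite mxE.
  case: insub => [ij|]; last exact: cmeasurable_cst.
  split => /=.
    apply: (@measurableT_comp _ _ _ _ _ _ fst) => //.
    exact: measurable_tnth.
  apply: (@measurableT_comp _ _ _ _ _ _ snd) => //.
  exact: measurable_tnth.
move=> [t1 t2]; split.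
  exact: (measurableT_comp t1 (@measurable_ucoord R n)).
exact: (measurableT_comp t2 (@measurable_ucoord R n)).
Qed.

Lemma measurable_exprz d (T : measurableType d) (f : T -> R) (k : int) :
  (forall x, 0 <= f x) ->
  measurable_fun setT f -> measurable_fun setT (fun x => f x ^ k).
Proof.
move=> f0 mf; case: k => k; first exact: measurable_funX.
rewrite (_ : (fun x => _) = (fun x => (f x `^ (-1)) ^+ k.+1)); last first.
  by apply/funext => x; rewrite powR_inv1// exprVn.
apply: measurable_funX.
exact: (measurableT_comp (measurable_powR _)).
Qed.

Lemma measurable_weight p : measurable_fun setT (weight p).
Proof.
rewrite /weight; under eq_fun do rewrite -big_filter.
apply: measurable_prod => j _; apply: measurable_exprz => [Z|].
  exact: corner_det_ge0.
apply: (proj1 (cmeasurable_det _)) => k l.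
rewrite (_ : (fun Z : N => _) =
    (fun Z : N => \sum_m corner j Z k m * (corner j Z l m)^*)).
  apply: cmeasurable_sum => m; apply: cmeasurableM.
    rewrite (_ : (fun Z : N => _) = (fun Z : N => Z (widen_ord (ltn_ord j) k) m)).
      exact: cmeasurable_entry.
    by apply/funext => Z; rewrite mxE.
  apply: cmeasurable_conj.
  rewrite (_ : (fun Z : N => _) = (fun Z : N => Z (widen_ord (ltn_ord j) l) m)).
    exact: cmeasurable_entry.
  by apply/funext => Z; rewrite mxE.
by apply/funext => Z; rewrite mxE; apply: eq_bigr => m _; rewrite !mxE.
Qed.

Section weighted_measure.
Variable p : n.-tuple int.

Definition mu_p (A : set N) : \bar R :=
  (\int[@unitri_lebesgue R n]_(Z in A) (weight p Z)%:E)%E.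

Let mw0 : mu_p set0 = 0%E.
Proof. by rewrite /mu_p integral_set0. Qed.

Let mw_ge0 A : (0 <= mu_p A)%E.
Proof. by apply: integral_ge0 => Z _; rewrite lee_fin weight_ge0. Qed.

Let mw_sigma_additive : semi_sigma_additive mu_p.
Proof.
move=> F mF tF mUF; rewrite /mu_p ge0_integral_bigcup//=.
- by apply: is_cvg_ereal_nneg_natsum_cond => i _ _; exact: mw_ge0.
- apply: measurable_funTS; apply/measurable_EFinP; exact: measurable_weight.
- by move=> Z _; rewrite lee_fin weight_ge0.
Qed.

HB.instance Definition _ := isMeasure.Build _ _ _ mu_p
  mw0 mw_ge0 mw_sigma_additive.

End weighted_measure.

End weight.

Section representation.
Variables (R : realType) (n : nat).
Local Notation C := R[i].
Local Notation N := (unitri R n).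
Variable p : n.-tuple int.

Definition Pol : set (N -> C) :=
  [set f | exists P : mpoly.mpoly #|{: upair n}| C,
     forall Z : N, f Z = mpoly.meval (uentry Z) P].

(* Polynomials in the entries of g and in det(g)^-1, as functions on GL(n, C):
   the value of F outside unitmx is irrelevant. *)
Definition GL_polynomial (F : 'M[C]_n -> C) : Prop :=
  exists P : mpoly.mpoly (n * n + 1) C, forall g, g \in unitmx ->
    F g = mpoly.meval (fun k => row_mx (mxvec g) ((\det g)^-1)%:M ord0 k) P.

Definition tri_char (b : 'M[C]_n) : C := \prod_(j < n) b j j ^ tnth p j.

Definition GL_equivariant : set ('M[C]_n -> C) :=
  [set F | GL_polynomial F /\
     forall b g, is_trig_mx b -> b \in unitmx -> g \in unitmx ->
       F (b *m g) = tri_char b * F g].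

Definition Vspace : set (N -> C) :=
  [set f | Pol f /\ exists2 F, GL_equivariant F & forall Z : N, F Z = f Z].

(* The equivariant extension of f to GL(n, C). A polynomial on GL(n, C) is
   determined by its values on the Zariski dense set B_n^- N_n^+, so on
   invertible matrices the extension does not depend on the choice. *)
Definition GL_ext (f : N -> C) : 'M[C]_n -> C :=
  if pselect (exists2 F, GL_equivariant F & forall Z : N, F Z = f Z) is left h
  then s2val (cid2 h) else fun=> 0.

(* The action by right shifts; rhoE is its expression in coordinates. *)
Definition rho (g : 'M[C]_n) (f : N -> C) (Z : N) : C := GL_ext f (Z *m g).

Lemma unitri_unitmx (Z : N) : (Z : 'M[C]_n) \in unitmx.
Proof.
have /andP[Zt /forallP Z1] := valP Z.
rewrite unitmxE -det_tr det_trig// big1 ?unitr1// => i _.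
by rewrite mxE (eqP (Z1 i)).
Qed.

Lemma rhoE g f (Z W : N) b : Vspace f -> is_trig_mx b -> b \in unitmx ->
  (Z : 'M[C]_n) *m g = b *m W -> rho g f Z = f W * \prod_(j < n) b j j ^ tnth p j.
Proof.
move=> [_ Vf] bt bu Zg; rewrite /rho /GL_ext; case: pselect => // h.
case: cid2 => F [_ Fb] Ff /=.
by rewrite Zg Fb ?unitri_unitmx// Ff mulrC.
Qed.

End representation.

Arguments mu_p R {n} p A.
Arguments Pol R n f : rename, clear implicits.
Arguments Vspace R {n} p f : rename.

(* Main.v *)
From HB Require Import structures.
Require Import Defs.
From mathcomp Require Import all_boot all_order fingroup perm all_algebra.
From mathcomp Require Import all_classical all_reals all_analysis.
From mathcomp Require Import complex spectral.
From mathcomp Require Import measurable_realfun.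
From mathcomp Require Import ring lra zify.
From mathcomp Require mpoly.

Import Order.TTheory GRing.Theory Num.Theory.
Import numFieldNormedType.Exports.

Local Open Scope classical_set_scope.
Local Open Scope sesquilinear_scope.
Local Open Scope ring_scope.

Set Implicit Arguments.
Unset Strict Implicit.
Unset Printing Implicit Defensive.

(** The space is the space of sections of a line bundle on the flag manifold
    B \ GL(n, C), where B is the group of lower triangular matrices, written in
    the chart of unitriangular matrices; the weight is the unitarily invariant
    Hermitian metric of the bundle times the unitarily invariant volume.

    Unitary invariance. A function of g that is multiplied by the modulus of b
    when g is replaced by b g restricts on the chart to a density on the flag
    manifold, and its integral does not change under right translations
    (preserving_GL): this is checked on generators, where the change of variables
    is affine in suitable coordinates, or is z |-> 1/z together with affine maps
    for adjacent transpositions. For equivariant F1 and F2, the product of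
    F1 F2^* with the Gram determinants of the weight is of this kind
    (modulusE, gram_weightM), and these determinants are invariant under
    unitary matrices; hence L2_inner_unitary.

    An element of the space is square integrable. The flag manifold is compact,
    and this takes the concrete form of partial pivoting: every matrix has a
    column permutation whose leading minors dominate the competing ones
    (exists_pivot), and a unitriangular matrix with this property has entries in
    the unit disc. By invariance, the integral over each of the n! pieces of the
    chart is at most that of the squared modulus of a polynomial over a bounded
    box (Vspace_L2).

    A square integrable polynomial f is in the space. It extends to an equivariant
    function on GL(n, C) with powers of the leading minors as denominators (Fext).
    An adjacent transposition transforms f into a Laurent polynomial in one entry
    z; this is again square integrable, and |z|^-2 is not locally integrable
    (uint_pole_infty), so that it is a polynomial (swap_stable). Hence all column
    permutations act on the square integrable polynomials (Fext_perm), and the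
    denominator may be taken among the powers of the product of the leading
    minors of g s, for every permutation s. By repeated Laplace expansion
    (minor_expand) a power of the determinant lies in the ideal of denominators
    (rad_denominator_minors), and the extension is regular (L2_Vspace). *)

(** * Integration against a weighted image measure *)

Section weighted_pushforward.
Local Open Scope ereal_scope.
Context d1 d2 (X : measurableType d1) (Y : measurableType d2) (R : realType).
Variables (mu : {measure set X -> \bar R}) (phi : X -> Y) (w : X -> R).
Hypothesis mphi : measurable_fun setT phi.
Hypothesis w0 : forall x, (0 <= w x)%R.
Hypothesis mw : measurable_fun setT w.

(** The image under phi of the measure of density w. The hypotheses on phi and w
    are arguments of the term, so that it can carry a measure structure. *)
Definition wpush of measurable_fun setT phi & (forall x, (0 <= w x)%R) &
  measurable_fun setT w := fun A : set Y => \int[mu]_(x in phi @^-1` A) (w x)%:E.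

Local Notation wp := (wpush mphi w0 mw).

Let wp0 : wp set0 = 0.
Proof. by rewrite /wpush preimage_set0 integral_set0. Qed.

Let wp_ge0 A : 0 <= wp A.
Proof. by apply: integral_ge0 => x _; rewrite lee_fin. Qed.

Let wp_sigma_additive : semi_sigma_additive wp.
Proof.
have mpre A : measurable A -> measurable (phi @^-1` A).
  by move=> mA; rewrite -[X in measurable X]setTI; exact: mphi.
move=> F mF tF mUF; rewrite /wpush preimage_bigcup ge0_integral_bigcup//=.
- by apply: is_cvg_ereal_nneg_natsum_cond => i _ _; exact: wp_ge0.
- by move=> i; exact: mpre.
- by apply: measurable_funTS; exact/measurable_EFinP.
- by move=> x _; rewrite lee_fin.
- apply/trivIsetP => /= i j _ _ ij; rewrite -preimage_setI.
  by move/trivIsetP : tF => /(_ _ _ _ _ ij) ->//; rewrite preimage_set0.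
Qed.

HB.instance Definition _ := isMeasure.Build _ _ _ wp wp0 wp_ge0 wp_sigma_additive.

Import HBNNSimple.

(** Every change of variables below is a computation of such an image measure;
    this transfers it from sets to nonnegative functions. *)
Lemma ge0_integral_wpush (f : Y -> \bar R) :
  measurable_fun setT f -> (forall y, 0 <= f y) ->
  \int[wp]_y f y = \int[mu]_x (f (phi x) * (w x)%:E).
Proof.
move=> mf f0.
pose h := nnsfun_approx measurableT mf.
have mpre A : measurable A -> measurable (phi @^-1` A).
  by move=> mA; rewrite -[X in measurable X]setTI; exact: mphi.
have -> : \int[wp]_y f y = lim (\int[wp]_y (EFin \o h n) y @[n --> \oo]).
  have fE x : f x = lim ((EFin \o h n) x @[n --> \oo]).
    by apply/esym/cvg_lim => //; exact: cvg_nnsfun_approx.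
  under eq_integral do rewrite fE.
  apply: monotone_convergence => //.
  - by move=> n; exact/measurable_EFinP.
  - by move=> n x _ /=; rewrite lee_fin.
  - by move=> x _ a b ab; rewrite lee_fin; exact/lefP/nd_nnsfun_approx.
have -> : \int[mu]_x (f (phi x) * (w x)%:E) =
    lim (\int[mu]_x ((EFin \o h n) (phi x) * (w x)%:E) @[n --> \oo]).
  have fg x : f (phi x) * (w x)%:E =
      lim ((EFin \o h n) (phi x) * (w x)%:E @[n --> \oo]).
    apply/esym/cvg_lim => //; apply: cvgeZr => //.
    exact: cvg_nnsfun_approx.
  under eq_integral do rewrite fg.
  apply: monotone_convergence => //.
  - move=> n; apply/emeasurable_funM; last exact/measurable_EFinP.
    by apply/measurable_EFinP; apply: (measurableT_comp _ mphi).
  - by move=> n x _ /=; rewrite mule_ge0 ?lee_fin.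
  - move=> x _ a b ab/=; rewrite lee_wpmul2r ?lee_fin//.
    exact/lefP/nd_nnsfun_approx.
suff suf n : \int[mu]_x ((EFin \o h n) (phi x) * (w x)%:E) =
    \int[wp]_x (EFin \o h n) x.
  by under eq_fun do rewrite -suf.
transitivity (\int[wp]_x
   (\sum_(y \in range (h n)) (y * \1_(h n @^-1` [set y]) x)%:E)); last first.
  by apply: eq_integral => t tE; rewrite /= fimfunE -fsumEFin.
rewrite ge0_integral_fsum//; last 2 first.
- by move=> r; exact/measurable_EFinP/measurable_funM.
- by move=> m y Ey; exact: nnfun_muleindic_ge0.
transitivity (\int[mu]_x (\sum_(y \in range (h n))
    (y * \1_(h n @^-1` [set y]) (phi x))%:E * (w x)%:E)).
  apply: eq_integral => x _.
  rewrite -ge0_mule_fsuml => [|y]; last exact: nnfun_muleindic_ge0.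
  by rewrite fsumEFin // -(fimfunE _ (phi x)).
rewrite ge0_integral_fsum//; last 2 first.
- move=> y; apply: emeasurable_funM => //; last exact/measurable_EFinP.
  apply/measurable_EFinP; apply: measurable_funM => //.
  exact: measurableT_comp.
- by move=> m y Ey; rewrite mule_ge0 ?lee_fin// -lee_fin; exact: nnfun_muleindic_ge0.
apply: eq_fsbigr => r rhn.
under [RHS]eq_integral do rewrite EFinM.
rewrite integralZl_indic_nnsfun => //.
under eq_integral do rewrite EFinM -muleA.
have r0 : (0 <= r)%R by move: rhn; rewrite inE => -[y _ <-].
rewrite ge0_integralZl//.
- rewrite integral_indic// setIT; congr (_ * _).
  rewrite /wpush [RHS]integral_mkcond; apply: eq_integral => x _ /=.
  rewrite patchE indicE; have [e|e] := pselect (h n (phi x) = r).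
    by rewrite !mem_set//= ?mul1e.
  by rewrite !memNset//= ?mul0e.
- apply: emeasurable_funM; last exact/measurable_EFinP.
  apply/measurable_EFinP; exact: measurableT_comp.
- by move=> x _; rewrite mule_ge0 ?lee_fin.
Qed.

End weighted_pushforward.

(** * Affine maps and inversion on the line *)

Section line.
Variable R : realType.
Local Notation mR := (measurableTypeR R).
Local Notation leb := (@lebesgue_measure R).

Lemma measurable_invr d (T : measurableType d) (f : T -> R) :
  measurable_fun setT f -> measurable_fun setT (fun x => (f x)^-1).
Proof.
move=> mf; rewrite (_ : (fun x => _) = (fun x => f x * (f x ^+ 2) ^ (-1))).
  apply: measurable_funM => //; apply: measurable_exprz; last exact: measurable_funX.
  by move=> x; rewrite sqr_ge0.
apply/funext => x; rewrite exprN1; have [->|f0] := eqVneq (f x) 0.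
  by rewrite invr0 mul0r.
by rewrite expr2 invfM mulrA divff// mul1r.
Qed.

Lemma measurable_affine (a b : R) : measurable_fun setT (fun x : mR => a * x + b : mR).
Proof. by apply: measurable_funD => //; exact: measurable_funM. Qed.

Lemma affine_preimage_itvoc (a b l r : R) : a != 0 ->
  leb ((fun x : mR => a * x + b : mR) @^-1` [set` `]l, r]]) =
  (`|a|^-1%:E * leb [set` `]l, r]])%E.
Proof.
move=> a0; have [ap|an] : 0 < a \/ a < 0 by move: a0; rewrite neq_lt => /orP[|]; auto.
- rewrite (_ : _ @^-1` _ = [set` `](l - b) / a, (r - b) / a]]); last first.
    apply/seteqP; split => x /=; rewrite !in_itv/= ltr_pdivrMr// ler_pdivlMr//;
    by rewrite ltrBlDr lerBrDr (mulrC a).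
  rewrite !lebesgue_measure_itv/= !lte_fin ltr_pM2r ?invr_gt0// ltrD2r.
  case: ifPn => lr; last by rewrite mule0.
  rewrite -!EFinD -EFinM gtr0_norm//; congr (_%:E); ring.
- rewrite (_ : _ @^-1` _ = [set` `[(r - b) / a, (l - b) / a[]); last first.
    apply/seteqP; split => x /=; rewrite !in_itv/= ltr_ndivlMr// ler_ndivrMr//;
    by rewrite ltrBlDr lerBrDr (mulrC a) andbC.
  rewrite !lebesgue_measure_itv/= !lte_fin ltr_nM2r ?invr_lt0// ltrD2r.
  case: ifPn => lr; last by rewrite mule0.
  rewrite -!EFinD -EFinM ltr0_norm//; congr (_%:E); field; lra.
Qed.

(** Lebesgue measure is the only measure giving half-open intervals their
    length, so only the preimages of such intervals have to be measured. *)
Lemma ge0_integral_affine (a b : R) (f : mR -> \bar R) : a != 0 ->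
  measurable_fun setT f -> (forall y, (0 <= f y)%E) ->
  (\int[leb]_x (f (a * x + b)%R * `|a|%:E) = \int[leb]_x f x)%E.
Proof.
move=> a0 mf f0.
rewrite -(ge0_integral_wpush leb (measurable_affine a b) (fun=> normr_ge0 a)
  (measurable_cst _))//.
apply: eq_measure_integral => A mA _; apply/esym.
apply: (lebesgue_measure_unique (mu := wpush leb (measurable_affine a b)
   (fun=> normr_ge0 a) (measurable_cst _))) => // _ [[l r] _ <-]/=.
rewrite /wpush integral_cst; last first.
  by rewrite -[X in measurable X]setTI; exact: measurable_affine.
rewrite [X in (_ * X)%E](affine_preimage_itvoc b l r a0) muleA -EFinM.
by rewrite divff ?mul1e// normr_eq0.
Qed.

(** Inversion on the line: the image of x^-2 dx under x |-> 1/x is Lebesgue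
    measure. The fundamental theorem of calculus gives the mass of ]0, b], the
    symmetry x |-> -x that of ]-b, 0], and additivity the other intervals. *)
Let invR (x : mR) : mR := x^-1.
Let wR (x : mR) : R := (x ^+ 2)^-1.

Let minvR : measurable_fun setT invR. Proof. exact: measurable_invr. Qed.
Let wR0 x : 0 <= wR x. Proof. by rewrite invr_ge0 sqr_ge0. Qed.
Let mwR : measurable_fun setT wR.
Proof. by apply: measurable_invr; exact: measurable_funX. Qed.

Local Notation nu := (wpush leb minvR wR0 mwR).

Let wR_tail (b : R) : 0 < b -> (\int[leb]_(x in `[(b^-1)%R, +oo[) (wR x)%:E)%E = b%:E.
Proof.
move=> b0.
have px x : b^-1 <= x -> x != 0.
  by move=> /(lt_le_trans _) bx; rewrite gt_eqF// bx// invr_gt0.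
have dI x : b^-1 <= x -> is_derive x 1 (fun x : R => - x^-1) (wR x).
  move=> /px x0; have := is_deriveV x0 (is_derive_id x 1).
  move=> /is_deriveN; rewrite /wR.
  by rewrite -scaleNr opprK /GRing.scale/= mulr1.
rewrite (@ge0_continuous_FTC2y _ wR (fun x => - x^-1) _ 0).
- by rewrite invrK -EFinB sub0r opprK.
- by move=> x _; exact: wR0.
- apply: continuous_in_subspaceT => x; rewrite inE/= in_itv/= andbT => /px x0.
  apply: (@continuousV R R (fun x => x ^+ 2)); first by rewrite expf_neq0.
  exact: exprn_continuous.
- rewrite -[X in _ --> X]oppr0; apply: cvgN; apply/(@gtr0_cvgV0 R R +oo _ id) => //.
  by near=> x; near: x; exact: nbhs_pinfty_gt.
- by move=> x /ltW /dI[].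
- apply: cvg_at_right_filter; apply: cvgN; apply: inv_continuous.
  by rewrite invr_neq0// gt_eqF.
- by move=> x; rewrite in_itv/= andbT => /ltW /dI dx; rewrite derive1E derive_val.
Unshelve. all: by end_near. Qed.

Let nuE (A : set mR) : nu A = (\int[leb]_(x in invR @^-1` A) (wR x)%:E)%E.
Proof. by []. Qed.

Let nu_pos (b : R) : 0 <= b -> nu [set` `]0, b]] = b%:E.
Proof.
rewrite le_eqVlt => /predU1P[<-|b0].
  by rewrite set_interval.set_itvoc0 measure0.
rewrite nuE -(wR_tail b0); congr (integral _ _ _).
apply/seteqP; split => x /=; rewrite !in_itv/= andbT invr_gt0.
  by move=> /andP[x0 xb]; rewrite -(invrK x) lef_pV2// posrE invr_gt0.
move=> bx; have x0 : 0 < x by rewrite (lt_le_trans _ bx)// invr_gt0.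
by rewrite x0/= -(invrK b) lef_pV2// posrE invr_gt0.
Qed.

Let nu_neg (b : R) : 0 <= b -> nu [set` `](- b), 0]] = b%:E.
Proof.
move=> b_ge0; rewrite nuE; move: b_ge0; rewrite le_eqVlt => /predU1P[<-|b0].
  by rewrite oppr0 set_interval.set_itvoc0 preimage_set0 integral_set0.
have mE D : measurable_fun D (fun x => (wR x)%:E).
  by apply: measurable_funTS; exact/measurable_EFinP.
(* As 0^-1 = 0, the origin belongs to the preimage; it is a null set. *)
have DE : (invR @^-1` [set` `](- b), 0]]) `\ 0 = [set` `]-oo, (- b^-1)[].
  apply/seteqP; split => x /=; rewrite !in_itv/=.
    move=> [/andP[bx]]; rewrite invr_le0 le_eqVlt => /orP[/eqP//|x0] _.
    by rewrite -(invrK x) -invrN ltf_nV2// negrE ?oppr_lt0// invr_lt0.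
  move=> xb; have x0 : x < 0 by rewrite (lt_trans xb)// oppr_lt0 invr_gt0.
  split; last by apply/eqP; rewrite lt_eqF.
  rewrite invr_le0 (ltW x0) andbT -(invrK b) -invrN.
  by rewrite ltf_nV2// negrE oppr_lt0 invr_gt0.
rewrite -(@integral_setD1 _ _ 0) ?DE//; last exact: mE.
rewrite integral_mkcond/= -(@ge0_integral_affine (-1) 0); last 3 first.
- by rewrite oppr_eq0 oner_eq0.
- exact: (iffLR (measurable_restrictT _ (measurable_itv _)) (mE _)).
- by move=> y; rewrite erestrict_ge0// => x _; rewrite lee_fin.
rewrite -(wR_tail b0) -[RHS]integral_itv_obnd_cbnd; last exact: mE.
rewrite [RHS]integral_mkcond; apply: eq_integral => x _.
rewrite normrN1 mule1 addr0 mulN1r !patchE.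
rewrite (_ : (- x \in _) = (x \in [set` `]b^-1, +oo[])); last first.
  by apply/idP/idP; rewrite !inE/= !in_itv/= andbT ltrN2.
by case: ifP => // _; rewrite /wR sqrrN.
Qed.

Let nuU (a b c : R) : a <= b <= c ->
  nu [set` `]a, c]] = (nu [set` `]a, b]] + nu [set` `]b, c]])%E.
Proof.
move=> /andP[ab bc]; rewrite -measureU//.
  by rewrite -itv_bndbnd_setU// ?bnd_simp.
apply/seteqP; split => // x [] /=; rewrite !in_itv/= => /andP[_ xb] /andP[bx _].
by move: bx; rewrite ltNge xb.
Qed.

Let nu_itv (a b : R) : a <= b -> nu [set` `]a, b]] = (b - a)%:E.
Proof.
have [a0|a0] := leP 0 a; have [b0|b0] := leP 0 b => ab.
- have := @nuU 0 a b; rewrite a0 ab => /(_ isT); rewrite !nu_pos//.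
  by case: (nu _) => [r [br]|//|//]; congr EFin; lra.
- by have := le_lt_trans (le_trans a0 ab) b0; rewrite ltxx.
- rewrite (@nuU a 0 b) ?(ltW a0)// -(opprK a) nu_neg ?nu_pos ?oppr_ge0 ?(ltW a0)//.
  by rewrite -EFinD opprK addrC.
- have := @nuU a b 0; rewrite ab (ltW b0) => /(_ isT).
  rewrite -{1}(opprK a) -{2}(opprK b) !nu_neg ?oppr_ge0 ?ltW//.
  by case: (nu _) => [r [abr]|//|//]; congr EFin; lra.
Qed.

Lemma ge0_integral_inv (f : mR -> \bar R) :
  measurable_fun setT f -> (forall y, (0 <= f y)%E) ->
  (\int[leb]_x (f (x^-1)%R * ((x ^+ 2)^-1)%:E) = \int[leb]_x f x)%E.
Proof.
move=> mf f0; rewrite -(ge0_integral_wpush leb minvR wR0 mwR)//.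
apply: eq_measure_integral => A mA _; apply/esym.
apply: (lebesgue_measure_unique (mu := nu)) => // _ [[l r] _ <-] /=.
rewrite lebesgue_measure_itv/= lte_fin; case: ltP => lr.
  by rewrite nu_itv ?(ltW lr)// EFinB.
by rewrite set_itv_ge ?measure0// -leNgt bnd_simp.
Qed.

End line.

(** * Affine maps and inversion on the complex plane *)

Section plane.
Variable R : realType.
Local Notation C := R[i].
Local Notation mR := (measurableTypeR R).
Local Notation leb := (@lebesgue_measure R).

Definition abs2 (c : C) : R := complex.Re c ^+ 2 + complex.Im c ^+ 2.

Lemma abs2_ge0 c : 0 <= abs2 c.
Proof. by rewrite addr_ge0 ?sqr_ge0. Qed.

Lemma abs2M c d : abs2 (c * d) = abs2 c * abs2 d.
Proof. by case: c d => [a b] [e f]; rewrite /abs2/=; ring. Qed.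

Lemma abs2_eq0 c : (abs2 c == 0) = (c == 0).
Proof.
case: c => a b; rewrite /abs2/= paddr_eq0 ?sqr_ge0// !sqrf_eq0.
by rewrite eq_complex.
Qed.

Lemma abs21 : abs2 1 = 1.
Proof. by rewrite /abs2/= expr1n expr0n addr0. Qed.

Lemma abs20 : abs2 0 = 0.
Proof. by rewrite /abs2/= expr0n addr0. Qed.

Lemma abs2V c : abs2 c^-1 = (abs2 c)^-1.
Proof.
have [->|c0] := eqVneq c 0; first by rewrite invr0 abs20 invr0.
apply: (mulfI (x := abs2 c)); first by rewrite abs2_eq0.
by rewrite -abs2M !divff ?abs21// abs2_eq0.
Qed.

Lemma abs2N c : abs2 (- c) = abs2 c.
Proof. by case: c => a b; rewrite /abs2/= !sqrrN. Qed.

Lemma abs2X c k : abs2 (c ^+ k) = abs2 c ^+ k.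
Proof. by elim: k => [|k IH]; rewrite ?expr0 ?abs21// !exprS abs2M IH. Qed.

Lemma abs2Xz c (k : int) : abs2 (c ^ k) = abs2 c ^ k.
Proof. by case: k => k; rewrite /exprz ?abs2V abs2X. Qed.

Lemma abs2_prod I (r : seq I) (P : pred I) (F : I -> C) :
  abs2 (\prod_(i <- r | P i) F i) = \prod_(i <- r | P i) abs2 (F i).
Proof. exact: (big_morph abs2 abs2M abs21). Qed.

Lemma mul_conjCE (c : C) : c * c^* = (abs2 c)%:C%C.
Proof. by case: c => a b; simpc; congr (_ +i* _)%C; rewrite /abs2/=; ring. Qed.

Definition cplx (x : plane R) : C := Complex x.1 x.2.
Definition pln (c : C) : plane R := (complex.Re c, complex.Im c).

Lemma plnK : cancel pln cplx. Proof. by case. Qed.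

Lemma eq_integral_neq0 (f g : mR -> \bar R) :
  measurable_fun setT f -> measurable_fun setT g ->
  (forall x, x != 0 -> f x = g x) -> (\int[leb]_x f x = \int[leb]_x g x)%E.
Proof.
move=> mf mg fg.
have m1 : measurable ([set: mR] `\ (0 : R)).
  by apply: measurableD => //; exact: measurable_set1.
rewrite -(@integral_setD1 _ f 0 setT m1); last exact: measurable_funS mf.
rewrite -(@integral_setD1 _ g 0 setT m1); last exact: measurable_funS mg.
by apply: eq_integral => x; rewrite inE => -[_ /eqP x0]; exact: fg.
Qed.

Ltac mfun := repeat (match goal with
  | |- measurable_fun _ (fun x => _ + _) => apply: measurable_funD
  | |- measurable_fun _ (fun x => _ * _) => apply: measurable_funM
  | |- measurable_fun _ (fun x => _ ^+ _) => apply: measurable_funX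
  | |- measurable_fun _ (fun x => - _) => apply: measurableT_comp
  | |- measurable_fun _ (fun x => `|_|) => apply: measurableT_comp
  | |- measurable_fun _ (fun x => _^-1) => apply: measurable_invr
  | |- measurable_fun _ (fun x => (_ * _)%E) => apply: emeasurable_funM
  | |- measurable_fun _ (fun x => _%:E) => apply/measurable_EFinP
  end; try (solve [exact: measurable_cst | exact: measurable_id
      | exact: measurable_fst | exact: measurable_snd])).

Lemma measurable_comp_plane d (T : measurableType d) (f : mR * mR -> \bar R)
    (p q : T -> R) :
  measurable_fun setT f -> measurable_fun setT p -> measurable_fun setT q ->
  measurable_fun setT (fun z => f (p z, q z)).
Proof.
move=> mf mp mq; apply: (measurableT_comp mf).
exact: (measurable_fun_pair mp mq).
Qed.

(** For c = a + ib with a != 0, the rotation-dilation z |-> c z + d is a product of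
    two shears, each an affine map in a single real coordinate, with Jacobians a
    and |c|^2 / a; for a = 0 it is an exchange of the coordinates followed by
    affine maps along them. *)
Lemma integral_plane_affine (c d : C) (f : plane R -> \bar R) : c != 0 ->
  measurable_fun setT f -> (forall x, (0 <= f x)%E) ->
  (\int[@plane_lebesgue R]_x (f (pln (c * cplx x + d)%R) * (abs2 c)%:E) =
   \int[@plane_lebesgue R]_x f x)%E.
Proof.
case: c d => a b [e g] c0 mf f0; set k := abs2 _.
have k0 : 0 <= k by exact: abs2_ge0.
pose f' : mR * mR -> \bar R := f.
have -> : (\int[@plane_lebesgue R]_x f x = \int[leb]_x \int[leb]_y f' (x, y))%E.
  by rewrite -(fubini_tonelli1 f' mf f0).
under eq_integral do rewrite /pln/=.
pose h : mR * mR -> \bar R := fun x =>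
  (f' ((a * x.1 - b * x.2 + e)%R, (a * x.2 + b * x.1 + g)%R) * k%:E)%E.
have mh : measurable_fun setT h.
  apply: emeasurable_funM; last exact: measurable_cst.
  by apply: measurable_comp_plane; [exact: mf|mfun|mfun].
have h0 x : (0 <= h x)%E by rewrite mule_ge0 ?lee_fin ?f0.
transitivity (\int[leb \x leb]_x h x)%E.
  by apply: eq_integral => -[x y] _.
have [a0|a0] := eqVneq a 0.
  have b0 : b != 0.
    by move: c0; rewrite a0 eq_complex/= eqxx.
  have kE : k = `|b| * `|b| by rewrite /k /abs2/= a0 -normrM -expr2 expr0n add0r ger0_norm ?sqr_ge0.
  pose h1 : mR * mR -> \bar R := fun x => (f' (x.1, (b * x.2 + g)%R) * `|b|%:E)%E.
  have mh1 : measurable_fun setT h1.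
    apply: emeasurable_funM; last exact: measurable_cst.
    by apply: measurable_comp_plane; [exact: mf|mfun|mfun].
  have h10 x : (0 <= h1 x)%E by rewrite mule_ge0 ?lee_fin ?f0.
  rewrite (fubini_tonelli1 h mh h0).
  transitivity (\int[leb]_x \int[leb]_y h1 (y, x))%E.
    apply: eq_integral => x _.
    rewrite -(@ge0_integral_affine _ (- b) e)//; last 2 first.
    - by rewrite oppr_eq0.
    - by apply: (measurableT_comp mh1); exact: measurable_pair2.
    apply: eq_integral => y _; rewrite /h /h1/= normrN -muleA -EFinM -kE a0.
    by congr (f' (_, _) * _)%E; ring.
  rewrite -(fubini_tonelli h1 mh1 h10); apply: eq_integral => x _.
  rewrite -(@ge0_integral_affine _ b g)//.
  by apply: (measurableT_comp mf); exact: measurable_pair1.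
have kE : k = a ^+ 2 + b ^+ 2 by [].
have kn0 : k != 0 by rewrite abs2_eq0.
pose h1 : mR * mR -> \bar R := fun x =>
   (f' (x.1, ((k / a) * x.2 + (b / a * (x.1 - e) + g))%R) * `|k / a|%:E)%E.
have mh1 : measurable_fun setT h1.
  apply: emeasurable_funM; last exact: measurable_cst.
  by apply: measurable_comp_plane; [exact: mf|mfun|mfun].
have h10 x : (0 <= h1 x)%E by rewrite mule_ge0 ?lee_fin ?f0.
rewrite (fubini_tonelli2 h mh h0).
transitivity (\int[leb]_y \int[leb]_x h1 (x, y))%E.
  apply: eq_integral => y _; rewrite /fubini_G.
  rewrite -(@ge0_integral_affine _ a (- b * y + e) (fun x => h1 (x, y)))//; last first.
    by apply: (measurableT_comp mh1); exact: measurable_pair2.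
  apply: eq_integral => x _; rewrite /h /h1/= -muleA -EFinM.
  rewrite normrM normfV (ger0_norm k0) divfK ?normr_eq0//.
  congr (f' (_, _) * _)%E; first ring.
  by rewrite kE; field.
rewrite -(fubini_tonelli h1 mh1 h10); apply: eq_integral => x _.
rewrite -(@ge0_integral_affine _ (k / a) (b / a * (x - e) + g))//.
  by rewrite mulf_neq0// invr_eq0.
by apply: (measurableT_comp mf); exact: measurable_pair1.
Qed.

(** The Jacobian of z |-> 1/z is |z|^-4. In the coordinates x and t = y / x, the
    inverse of x (1 + i t) is x^-1 (1 + t^2)^-1 (1 - i t), so that only the real
    inversion x |-> 1/x and scalings along each coordinate are involved. *)
Lemma integral_plane_inv (f : plane R -> \bar R) :
  measurable_fun setT f -> (forall x, (0 <= f x)%E) ->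
  (\int[@plane_lebesgue R]_x (f (pln (cplx x)^-1%R) * (abs2 (cplx x) ^- 2)%:E) =
   \int[@plane_lebesgue R]_x f x)%E.
Proof.
move=> mf f0.
pose f' : mR * mR -> \bar R := f.
have f'0 x : (0 <= f' x)%E by exact: f0.
have -> : (\int[@plane_lebesgue R]_x f x = \int[leb]_x \int[leb]_y f' (x, y))%E.
  by rewrite -(fubini_tonelli1 f' mf f0).
pose n (x y : R) := x ^+ 2 + y ^+ 2.
pose h : mR * mR -> \bar R := fun x =>
  (f' ((x.1 / n x.1 x.2)%R, (- x.2 / n x.1 x.2)%R) * (n x.1 x.2 ^- 2)%:E)%E.
have mh : measurable_fun setT h.
  apply: emeasurable_funM; last by rewrite ?/n ?/s; mfun.
  by apply: measurable_comp_plane; [exact: mf|rewrite ?/n ?/s; mfun|rewrite ?/n ?/s; mfun].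
have h0 x : (0 <= h x)%E by apply: mule_ge0; [exact: f'0 | rewrite lee_fin invr_ge0 exprn_even_ge0].
transitivity (\int[leb \x leb]_x h x)%E.
  by apply: eq_integral => -[x y] _; rewrite /h/= mulNr.
pose s (t : R) := (1 + t ^+ 2)^-1.
have sp (t : R) : 0 < 1 + t ^+ 2 by have := sqr_ge0 t; lra.
have s0 t : 0 < s t by rewrite invr_gt0.
(* h1, h2, h3: the integrand after y := x t, then x := 1 / x, then
   x := x / s t. *)
pose h1 : mR * mR -> \bar R := fun x =>
  (f' ((x.1^-1 * s x.2)%R, (- x.2 * (x.1^-1 * s x.2))%R) *
    (`|x.1| / x.1 ^+ 4 * s x.2 ^+ 2)%:E)%E.
have mh1 : measurable_fun setT h1.
  apply: emeasurable_funM; last by rewrite ?/n ?/s; mfun.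
  by apply: measurable_comp_plane; [exact: mf|rewrite ?/n ?/s; mfun|rewrite ?/n ?/s; mfun].
have h10 x : (0 <= h1 x)%E.
  apply: mule_ge0; first exact: f'0.
  rewrite lee_fin; apply: mulr_ge0; last exact: exprn_even_ge0.
  by apply: divr_ge0; [exact: normr_ge0|exact: exprn_even_ge0].
rewrite (fubini_tonelli1 h mh h0).
transitivity (\int[leb]_x \int[leb]_t h1 (x, t))%E.
  apply: eq_integral_neq0.
  - exact: measurable_fun_fubini_tonelli_F.
  - exact: measurable_fun_fubini_tonelli_F.
  move=> x x0; rewrite /fubini_F -(@ge0_integral_affine _ x 0 (fun y => h (x, y)))//; last first.
    by apply: (measurableT_comp mh); exact: measurable_pair1.
  apply: eq_integral => t _; rewrite /h /h1/= -muleA -EFinM.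
  have nE : n x (x * t + 0) = x ^+ 2 / s t by rewrite /n /s invrK; ring.
  have st0 : s t != 0 by rewrite gt_eqF.
  rewrite nE; congr (f' (_, _) * _%:E)%E; by field; rewrite ?x0 ?st0.
rewrite (fubini_tonelli h1 mh1 h10).
pose h2 : mR * mR -> \bar R := fun x =>
  (f' ((s x.2 * x.1)%R, (- x.2 * (s x.2 * x.1))%R) * (`|x.1| * s x.2 ^+ 2)%:E)%E.
have mh2 : measurable_fun setT h2.
  apply: emeasurable_funM; last by rewrite ?/n ?/s; mfun.
  by apply: measurable_comp_plane; [exact: mf|rewrite ?/n ?/s; mfun|rewrite ?/n ?/s; mfun].
have h20 x : (0 <= h2 x)%E.
  apply: mule_ge0; first exact: f'0.
  by rewrite lee_fin; apply: mulr_ge0; [exact: normr_ge0|exact: exprn_even_ge0].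
transitivity (\int[leb]_t \int[leb]_x h2 (x, t))%E.
  apply: eq_integral => t _.
  rewrite -(@ge0_integral_inv _ (fun x => h2 (x, t)))//; last first.
    by apply: (measurableT_comp mh2); exact: measurable_pair2.
  apply: eq_integral => x _; rewrite /h2 /h1/= -muleA -EFinM (mulrC (s t)).
  congr (_ * _%:E)%E; rewrite normfV.
  have [->|x0] := eqVneq x 0; first by rewrite normr0 invr0 !mul0r.
  have -> : x ^+ 4 = `|x| ^+ 2 * x ^+ 2 by rewrite real_normK ?num_real//; ring.
  by field; rewrite x0 normr_eq0.
pose h3 : mR * mR -> \bar R := fun x => (f' (x.1, - x.2 * x.1)%R * `|x.1|%:E)%E.
have mh3 : measurable_fun setT h3.
  apply: emeasurable_funM; last by rewrite ?/n ?/s; mfun.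
  by apply: measurable_comp_plane; [exact: mf|rewrite ?/n ?/s; mfun|rewrite ?/n ?/s; mfun].
have h30 x : (0 <= h3 x)%E by apply: mule_ge0; [exact: f'0|rewrite lee_fin normr_ge0].
transitivity (\int[leb]_t \int[leb]_x h3 (x, t))%E.
  apply: eq_integral => t _.
  rewrite -(@ge0_integral_affine _ (s t) 0 (fun x => h3 (x, t)))//; last 2 first.
  - by rewrite gt_eqF.
  - by apply: (measurableT_comp mh3); exact: measurable_pair2.
  apply: eq_integral => x _; rewrite /h2 /h3/= -muleA -EFinM !addr0.
  congr (_ * _%:E)%E; rewrite normrM (gtr0_norm (s0 t)); ring.
rewrite -(fubini_tonelli h3 mh3 h30); apply: eq_integral_neq0.
- exact: measurable_fun_fubini_tonelli_F.
- exact: measurable_fun_fubini_tonelli_F.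
move=> x x0; rewrite -(@ge0_integral_affine _ (- x) 0 (fun y => f' (x, y)))//; last 2 first.
- by rewrite oppr_eq0.
- by apply: (measurableT_comp mf); exact: measurable_pair1.
by apply: eq_integral => t _; rewrite /h3/= normrN addr0 mulrC mulrN mulNr.
Qed.

Lemma eq_integral_plane_neq0 (f g : plane R -> \bar R) :
  measurable_fun setT f -> measurable_fun setT g ->
  (forall x, (0 <= f x)%E) -> (forall x, (0 <= g x)%E) ->
  (forall x, cplx x != 0 -> f x = g x) ->
  (\int[@plane_lebesgue R]_x f x = \int[@plane_lebesgue R]_x g x)%E.
Proof.
move=> mf mg f0 g0 fg; pose f' : mR * mR -> \bar R := f; pose g' : mR * mR -> \bar R := g.
transitivity (\int[leb \x leb]_x f' x)%E => //.
transitivity (\int[leb \x leb]_x g' x)%E => //.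
rewrite (fubini_tonelli1 f' mf f0) (fubini_tonelli1 g' mg g0); apply: eq_integral_neq0.
- exact: measurable_fun_fubini_tonelli_F.
- exact: measurable_fun_fubini_tonelli_F.
move=> x x0; apply: eq_integral => y _; apply: fg.
by rewrite eq_complex/= negb_and x0.
Qed.

End plane.

(** * Powers of a measure *)

Section product_power_integral.
Local Open Scope ereal_scope.
Context d (T : measurableType d) (R : realType).
Variable mu : {sigma_finite_measure set T -> \bar R}.

Definition tupd m (t : m.-tuple T) (k : 'I_m) (x : T) : m.-tuple T :=
  [tuple if i == k then x else tnth t i | i < m].

Lemma integral_measure_powS m (f : m.+1.-tuple T -> \bar R) :
  measurable_fun setT f -> (forall t, 0 <= f t) ->
  \int[measure_pow mu m.+1]_t f t =
  \int[mu \x measure_pow mu m]_z f (tuple_cons z).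
Proof.
move=> mf f0.
transitivity (\int[pushforward (mu \x measure_pow mu m) (@tuple_cons _ T m)]_t f t) => //.
by rewrite ge0_integral_pushforward//; exact: measurable_tuple_cons.
Qed.

Lemma tupd_cons0 m (x y : T) (t : m.-tuple T) :
  tupd (tuple_cons (x, t)) ord0 y = tuple_cons (y, t).
Proof.
apply: eq_from_tnth => i; rewrite tnth_mktuple.
by case: (unliftP ord0 i) => [j|] -> /=; rewrite ?tnthS ?tnth0.
Qed.

Lemma tupd_consS m (x y : T) (t : m.-tuple T) (k : 'I_m) :
  tupd (tuple_cons (x, t)) (lift ord0 k) y = tuple_cons (x, tupd t k y).
Proof.
apply: eq_from_tnth => i; rewrite tnth_mktuple.
case: (unliftP ord0 i) => [j|] -> /=; last by rewrite !tnth0.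
by rewrite !tnthS tnth_mktuple (inj_eq (@lift_inj _ _)).
Qed.

(** Tonelli's theorem in the form used for changes of variables: it suffices
    to compare two integrands along one coordinate, the others being frozen. *)
Lemma integral_one_coord m (k : 'I_m) (f g : m.-tuple T -> \bar R) :
  measurable_fun setT f -> measurable_fun setT g ->
  (forall t, 0 <= f t) -> (forall t, 0 <= g t) ->
  (forall t, \int[mu]_x f (tupd t k x) = \int[mu]_x g (tupd t k x)) ->
  \int[measure_pow mu m]_t f t = \int[measure_pow mu m]_t g t.
Proof.
elim: m k f g => [|m IH] k f g mf mg f0 g0 fg; first by case: k fg.
rewrite !integral_measure_powS//.
have mc (h : m.+1.-tuple T -> \bar R) : measurable_fun setT h ->
    measurable_fun setT (fun z => h (@tuple_cons _ T m z)).
  by move=> mh; apply: (measurableT_comp mh); exact: measurable_tuple_cons.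
case: (unliftP ord0 k) fg => [j|] -> fg.
  rewrite (fubini_tonelli1 _ (mc _ mf))// (fubini_tonelli1 _ (mc _ mg))//.
  apply: eq_integral => x _; rewrite /fubini_F; apply: (IH j) => //.
  - by apply: (measurableT_comp (mc _ mf)); exact: measurable_pair1.
  - by apply: (measurableT_comp (mc _ mg)); exact: measurable_pair1.
  move=> t; transitivity (\int[mu]_y f (tupd (tuple_cons (x, t)) (lift ord0 j) y)).
    by apply: eq_integral => y _; rewrite tupd_consS.
  by rewrite fg; apply: eq_integral => y _; rewrite tupd_consS.
rewrite (fubini_tonelli2 _ (mc _ mf))// (fubini_tonelli2 _ (mc _ mg))//.
apply: eq_integral => t _; rewrite /fubini_G.
transitivity (\int[mu]_x f (tupd (tuple_cons (point, t)) ord0 x)).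
  by apply: eq_integral => x _; rewrite tupd_cons0.
by rewrite fg; apply: eq_integral => x _; rewrite tupd_cons0.
Qed.

Definition tbox m (A : 'I_m -> set T) := [set t : m.-tuple T | forall i, A i (tnth t i)].

Lemma measurable_tbox m (A : 'I_m -> set T) :
  (forall i, measurable (A i)) -> measurable (tbox A).
Proof.
move=> mA.
rewrite (_ : tbox A = \bigcap_(i in [set: 'I_m]) ((fun t => tnth t i) @^-1` A i)).
  apply: fin_bigcap_measurable; first exact: finite_finset.
  move=> i _; rewrite -[X in measurable X]setTI.
  exact: (measurable_tnth i measurableT).
by apply/seteqP; split => t /= At i => [_|]; apply: At.
Qed.

Lemma measure_pow_tbox0 (A : 'I_0 -> set T) : measure_pow mu 0 (tbox A) = 1.
Proof. by rewrite /= diracE mem_set// => -[]. Qed.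

Lemma measure_pow_tboxS m (A : 'I_m.+1 -> set T) : (forall i, measurable (A i)) ->
  measure_pow mu m.+1 (tbox A) =
  mu (A ord0) * measure_pow mu m (tbox (fun i => A (lift ord0 i))).
Proof.
move=> mA; rewrite /= /measure_cons /pushforward.
rewrite (_ : _ @^-1` _ = A ord0 `*` tbox (fun i => A (lift ord0 i))).
  by rewrite product_measure1E//; apply: measurable_tbox.
apply/seteqP; split=> [[x t]/= At|[x t]/= [Ax At] i].
  split; first by have := At ord0; rewrite tnth0.
  by move=> i; have := At (lift ord0 i); rewrite tnthS.
by case: (unliftP ord0 i) => [j|] ->; rewrite ?tnthS ?tnth0.
Qed.

Lemma measure_pow_tbox_gt0 m (A : 'I_m -> set T) : (forall i, measurable (A i)) ->
  (forall i, 0 < mu (A i)) -> 0 < measure_pow mu m (tbox A).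
Proof.
elim: m A => [|m IH] A mA A0; first by rewrite measure_pow_tbox0.
by rewrite measure_pow_tboxS//; apply: mule_gt0 => //; exact: IH.
Qed.

Lemma measure_pow_tbox_lty m (A : 'I_m -> set T) : (forall i, measurable (A i)) ->
  (forall i, mu (A i) < +oo) -> measure_pow mu m (tbox A) < +oo.
Proof.
elim: m A => [|m IH] A mA Aoo; first by rewrite measure_pow_tbox0 ltry.
rewrite measure_pow_tboxS//; apply: lte_mul_pinfty => //.
  by rewrite ge0_fin_numE.
exact: IH.
Qed.

End product_power_integral.

(** * Integration over the unitriangular group *)

Section unitriangular_integral.
Variables (R : realType) (n : nat).
Local Notation C := R[i].
Local Notation N := (unitri R n).
Implicit Types (i j a b : 'I_n) (Z W : N) (h : N -> R) (s : seq ('I_n * 'I_n)).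

Definition mkU (A : 'I_n -> 'I_n -> C) : N :=
  uparam [tuple pln (A (val (enum_val k)).1 (val (enum_val k)).2) | k < #|{: upair n}|].

Lemma mkUE A i j : mkU A i j = if (i < j)%N then A i j else (i == j)%:R.
Proof.
rewrite mxE; case: insubP => [ij /= -> ijE|/= /negbTE-> //].
rewrite tnth_mktuple enum_rankK.
by rewrite ijE /=; case: (A i j).
Qed.

Lemma unitriE Z i j : (j <= i)%N -> Z i j = (i == j)%:R.
Proof.
have /andP[/is_trig_mxP Zt /forallP Z1] := valP Z.
rewrite leq_eqVlt => /predU1P[/val_inj <-|ji]; first by rewrite eqxx (eqP (Z1 _)).
by have := Zt _ _ ji; rewrite mxE => ->; rewrite -val_eqE gtn_eqF.
Qed.

Lemma unitriP Z W : (forall i j, (i < j)%N -> Z i j = W i j) -> Z = W.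
Proof.
move=> ZW; apply/val_inj/matrixP => i j; have [|ji] := ltnP i j; first exact: ZW.
by rewrite !unitriE.
Qed.

Lemma measurable_mkU d (T : measurableType d) (A : T -> 'I_n -> 'I_n -> C) :
  (forall i j, (i < j)%N -> cmeasurable (fun x => A x i j)) ->
  measurable_fun setT (fun x => mkU (A x)).
Proof.
move=> mA; apply: (measurableT_comp (@measurable_uparam R n)).
apply/measurable_fun_tnthP => k /=.
rewrite [X in measurable_fun _ X](_ : _ =
    fun x => pln (A x (val (enum_val k)).1 (val (enum_val k)).2)); last first.
  by apply/funext => x /=; rewrite tnth_mktuple.
have [mR mI] := mA _ _ (valP (enum_val k)).
exact: (measurable_fun_pair mR mI).
Qed.

Lemma measurable_abs2 d (T : measurableType d) (f : T -> C) :
  cmeasurable f -> measurable_fun setT (fun x => abs2 (f x)).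
Proof.
by move=> [f1 f2]; apply: measurable_funD; exact: measurable_funX.
Qed.

Lemma cmeasurable_cplx : cmeasurable (@cplx R).
Proof. by split; [exact: measurable_fst|exact: measurable_snd]. Qed.

Lemma cmeasurable_inv d (T : measurableType d) (f : T -> C) :
  cmeasurable f -> cmeasurable (fun x => (f x)^-1).
Proof.
move=> mf; rewrite (_ : (fun x => _) = fun x => ((abs2 (f x))^-1)%:C%C * (f x)^*).
  apply: cmeasurableM; last exact: cmeasurable_conj.
  split => /=; last exact: measurable_cst.
  by apply: measurable_invr; exact: measurable_abs2.
apply/funext => x; have [->|f0] := eqVneq (f x) 0; first by rewrite rmorph0 invr0 mulr0.
apply: (mulfI f0); rewrite divff// mulrCA mul_conjCE -rmorphM mulVf ?rmorph1//.
by rewrite abs2_eq0.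
Qed.

Definition density h := measurable_fun setT h /\ forall Z, 0 <= h Z.

Definition uint h : \bar R := (\int[@unitri_lebesgue R n]_Z (h Z)%:E)%E.

Lemma uintE h : density h ->
  uint h = (\int[measure_pow (@plane_lebesgue R) #|{: upair n}|]_t (h (uparam t))%:E)%E.
Proof.
move=> [mh h0]; rewrite /uint ge0_integral_pushforward//.
- exact: measurable_uparam.
- exact/measurable_EFinP.
- by move=> Z _; rewrite lee_fin.
Qed.

Lemma eq_uint h1 h2 : h1 =1 h2 -> uint h1 = uint h2.
Proof. by move=> e; apply: eq_integral => Z _; rewrite e. Qed.

Lemma density_comp h (S : N -> N) : density h -> measurable_fun setT S ->
  density (h \o S).
Proof. by move=> [mh h0] mS; split => [|Z /=]//; exact: measurableT_comp. Qed.

Lemma densityM h1 h2 : density h1 -> density h2 -> density (fun Z => h1 Z * h2 Z).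
Proof.
by move=> [m1 p1] [m2 p2]; split => [|Z]; [exact: measurable_funM|rewrite mulr_ge0].
Qed.

Lemma density_abs2 (c : N -> C) : cmeasurable c -> density (fun Z => abs2 (c Z)).
Proof. by move=> mc; split => [|Z]; [exact: measurable_abs2|exact: abs2_ge0]. Qed.

Lemma density_prod I (r : seq I) (F : I -> N -> R) :
  (forall k, density (F k)) -> density (fun Z => \prod_(k <- r) F k Z).
Proof.
move=> dF; elim: r => [|k r IH].
  by under eq_fun do rewrite big_nil; split => [|Z].
by under eq_fun do rewrite big_cons; exact: densityM.
Qed.

Lemma density_inv h : density h -> density (fun Z => (h Z)^-1).
Proof. by move=> [mh h0]; split => [|Z]; rewrite ?invr_ge0//; exact: measurable_invr. Qed.

Lemma densityX h k : density h -> density (fun Z => h Z ^+ k).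
Proof. by move=> [mh h0]; split => [|Z]; rewrite ?exprn_ge0//; exact: measurable_funX. Qed.

Definition uupd Z (ij : 'I_n * 'I_n) (x : C) : N :=
  mkU (fun a b => if (a, b) == ij then x else Z a b).

Lemma measurable_uupd ij (c : N -> C) : cmeasurable c ->
  measurable_fun setT (fun Z => uupd Z ij (c Z)).
Proof.
move=> mc; apply: measurable_mkU => a b _; case: eqP => _ //.
exact: cmeasurable_entry.
Qed.

Lemma measurable_uupd_plane Z ij : measurable_fun setT (fun x => uupd Z ij (cplx x)).
Proof.
apply: measurable_mkU => a b _; case: eqP => _; first exact: cmeasurable_cplx.
exact: cmeasurable_cst.
Qed.

Lemma uupd_uupd Z ij x y : uupd (uupd Z ij x) ij y = uupd Z ij y.
Proof. by apply: unitriP => a b ab; rewrite !mkUE ab; case: eqP. Qed.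

Lemma uupdE Z i j x : (i < j)%N -> uupd Z (i, j) x i j = x.
Proof. by move=> ij; rewrite mkUE ij eqxx. Qed.

Lemma uint_one_coord (ij : 'I_n * 'I_n) h1 h2 : (ij.1 < ij.2)%N ->
  density h1 -> density h2 ->
  (forall Z, (\int[@plane_lebesgue R]_x (h1 (uupd Z ij (cplx x)))%:E =
              \int[@plane_lebesgue R]_x (h2 (uupd Z ij (cplx x)))%:E)%E) ->
  uint h1 = uint h2.
Proof.
move=> ltij dh1 dh2 eqh; rewrite !uintE//.
pose k := enum_rank (Sub ij ltij : upair n).
have upE t x : uparam (tupd t k x) = uupd (uparam t) ij (cplx x).
  apply: unitriP => a b ab; rewrite mkUE ab !mxE.
  case: insubP => [u _ uE|/=]; last by rewrite ab.
  rewrite /= tnth_mktuple (can_eq enum_rankK) -val_eqE /= uE.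
  by case: eqP => // _; rewrite /cplx.
have md h : density h -> measurable_fun setT (fun t => (h (uparam t))%:E).
  move=> [mh h0]; apply/measurable_EFinP; apply: (measurableT_comp mh).
  exact: measurable_uparam.
apply: (integral_one_coord (k := k)); try exact: md.
- by move=> t; rewrite lee_fin; apply: dh1.2.
- by move=> t; rewrite lee_fin; apply: dh2.2.
move=> t; transitivity (\int[@plane_lebesgue R]_x (h1 (uupd (uparam t) ij (cplx x)))%:E)%E.
  by apply: eq_integral => x _; rewrite upE.
by rewrite eqh; apply: eq_integral => x _; rewrite upE.
Qed.

Lemma uint_neq0 i j h1 h2 : (i < j)%N -> density h1 -> density h2 ->
  (forall Z, Z i j != 0 -> h1 Z = h2 Z) -> uint h1 = uint h2.
Proof.
move=> ij dh1 dh2 eqh; apply: (uint_one_coord (ij := (i, j))) => // Z.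
apply: eq_integral_plane_neq0.
- by apply/measurable_EFinP/(measurableT_comp dh1.1); exact: measurable_uupd_plane.
- by apply/measurable_EFinP/(measurableT_comp dh2.1); exact: measurable_uupd_plane.
- by move=> x; rewrite lee_fin dh1.2.
- by move=> x; rewrite lee_fin dh2.2.
by move=> x x0; rewrite eqh// uupdE.
Qed.

Lemma uint_inv i j h : (i < j)%N -> density h ->
  uint (fun Z => h (uupd Z (i, j) (Z i j)^-1) * abs2 (Z i j) ^- 2) = uint h.
Proof.
move=> ij dh; apply: (uint_one_coord (ij := (i, j))) => //.
  apply: densityM.
    by apply: (density_comp dh); apply/measurable_uupd/cmeasurable_inv/cmeasurable_entry.
  by apply/density_inv/densityX/density_abs2/cmeasurable_entry.
move=> Z; rewrite -[RHS]integral_plane_inv; last 2 first.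
- by apply/measurable_EFinP/(measurableT_comp dh.1); exact: measurable_uupd_plane.
- by move=> x; rewrite lee_fin dh.2.
by apply: eq_integral => x _; rewrite uupd_uupd uupdE// plnK EFinM.
Qed.

Lemma uint_affine1 (ij : 'I_n * 'I_n) (c d : N -> C) h : (ij.1 < ij.2)%N ->
  cmeasurable c -> cmeasurable d -> (forall Z, c Z != 0) ->
  (forall Z x, c (uupd Z ij x) = c Z) -> (forall Z x, d (uupd Z ij x) = d Z) ->
  density h ->
  uint (fun Z => h (uupd Z ij (c Z * Z ij.1 ij.2 + d Z)) * abs2 (c Z)) = uint h.
Proof.
move=> ltij mc md c0 cE dE dh; apply: (uint_one_coord (ij := ij)) => //.
  apply: densityM; last exact: density_abs2.
  apply: (density_comp dh); apply: measurable_uupd.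
  apply: cmeasurableD => //; apply: cmeasurableM => //; exact: cmeasurable_entry.
move=> Z; rewrite -[RHS](@integral_plane_affine _ (c Z) (d Z))//; last 2 first.
- by apply/measurable_EFinP/(measurableT_comp dh.1); exact: measurable_uupd_plane.
- by move=> x; rewrite lee_fin dh.2.
apply: eq_integral => x _; rewrite uupd_uupd cE dE plnK.
by rewrite mkUE ltij -surjective_pairing eqxx EFinM.
Qed.

Definition upd_affine s (c d : 'I_n * 'I_n -> N -> C) Z : N :=
  mkU (fun a b => if (a, b) \in s then c (a, b) Z * Z a b + d (a, b) Z else Z a b).

Definition indep s (phi : N -> C) := forall Z W,
  (forall a b, (a < b)%N -> (a, b) \notin s -> Z a b = W a b) -> phi Z = phi W.

Lemma measurable_upd_affine s c d :
  (forall ij, cmeasurable (c ij)) -> (forall ij, cmeasurable (d ij)) ->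
  measurable_fun setT (upd_affine s c d).
Proof.
move=> mc md; apply: measurable_mkU => a b _; case: ((a, b) \in s); last exact: cmeasurable_entry.
apply: cmeasurableD => //; apply: cmeasurableM => //; exact: cmeasurable_entry.
Qed.

(** Coordinates outside s are frozen, and the others undergo affine maps whose
    coefficients only involve the frozen ones; the Jacobian matrix is then
    diagonal. *)
Lemma uint_affine s (c d : 'I_n * 'I_n -> N -> C) h :
  uniq s -> (forall ij, ij \in s -> (ij.1 < ij.2)%N) ->
  (forall ij, cmeasurable (c ij)) -> (forall ij, cmeasurable (d ij)) ->
  (forall ij Z, c ij Z != 0) ->
  (forall ij, indep s (c ij)) -> (forall ij, indep s (d ij)) ->
  density h ->
  uint (fun Z => h (upd_affine s c d Z) * \prod_(ij <- s) abs2 (c ij Z)) = uint h.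
Proof.
elim: s h => [|k s IH] h us lts mc md c0 ic id dh.
  apply: eq_uint => Z; rewrite big_nil mulr1; congr h.
  by apply: unitriP => a b ab; rewrite mkUE ab.
have [ks us'] : k \notin s /\ uniq s by move: us => /= /andP[].
have ind (phi : N -> C) : indep (k :: s) phi -> forall Z x, phi (uupd Z k x) = phi Z.
  move=> iphi Z x; apply: iphi => a b ab; rewrite inE negb_or => /andP[ak _].
  by rewrite mkUE ab (negbTE ak).
have ind' (phi : N -> C) : indep (k :: s) phi -> forall Z, phi (upd_affine s c d Z) = phi Z.
  move=> iphi Z; apply: iphi => a b ab; rewrite inE negb_or => /andP[_ abs].
  by rewrite mkUE ab (negbTE abs).
pose h1 Z := h (uupd Z k (c k Z * Z k.1 k.2 + d k Z)) * abs2 (c k Z).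
have ltk : (k.1 < k.2)%N by apply: lts; rewrite mem_head.
have dh1 : density h1.
  apply: densityM; last exact: density_abs2.
  apply: (density_comp dh); apply: measurable_uupd.
  apply: cmeasurableD => //; apply: cmeasurableM => //; exact: cmeasurable_entry.
transitivity (uint h1); last by apply: uint_affine1 => //; exact: ind.
rewrite -(IH h1)//; last 3 first.
- by move=> ij ijs; apply: lts; rewrite inE ijs orbT.
- move=> ij Z W ZW; apply: ic => a b ab; rewrite inE negb_or => /andP[_].
  exact: ZW.
- move=> ij Z W ZW; apply: id => a b ab; rewrite inE negb_or => /andP[_].
  exact: ZW.
apply: eq_uint => Z; rewrite big_cons /h1 !ind'// mulrA; congr (h _ * _ * _).
apply: unitriP => a b ab; rewrite !mkUE ab ltk -surjective_pairing (negbTE ks).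
by rewrite inE; case: eqP => [<-|].
Qed.

End unitriangular_integral.

(** * The action of an adjacent transposition on coordinates *)

Section adjacent_swap.
Variables (R : realType) (n : nat) (k k1 : 'I_n).
Hypothesis k1E : k1 = k.+1 :> nat.
Local Notation C := R[i].
Local Notation N := (unitri R n).
Implicit Types (i j a b : 'I_n) (Z W : N) (h : N -> R).

Let kk1 : (k < k1)%N. Proof. by rewrite k1E. Qed.

(** The unitriangular factor of Z after the exchange of its columns k and k + 1,
    where the entry z = Z k k1 does not vanish. *)
Definition swapT Z : N := mkU (fun i j =>
  if i == k then (if j == k1 then (Z k k1)^-1 else Z k j / Z k k1)
  else if i == k1 then Z k j - Z k k1 * Z k1 j
  else if j == k then Z i k1
  else if j == k1 then Z i k else Z i j).

(** The coefficients of an affine change of variables must vanish nowhere; this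
    modification of z on a null set makes its inverse admissible. *)
Let nz (z : C) : C := if z == 0 then 1 else z.

Let nz_neq0 z : nz z != 0.
Proof. by rewrite /nz; case: (eqVneq z 0) => // _; rewrite oner_eq0. Qed.

Let cmeasurable_nz : cmeasurable (fun Z => nz (Z k k1)).
Proof.
have mz : measurable_fun setT (fun Z : N => abs2 (Z k k1) == 0).
  apply: measurable_fun_eqr; last exact: measurable_cst.
  exact/measurable_abs2/cmeasurable_entry.
have [m1 m2] := @cmeasurable_entry R n k k1.
split.
  rewrite (_ : (fun Z : N => _) =
      fun Z : N => if abs2 (Z k k1) == 0 then 1 else complex.Re (Z k k1)).
    by apply: measurable_fun_ifT.
  by apply/funext => Z; rewrite /nz abs2_eq0; case: eqP.
rewrite (_ : (fun Z : N => _) =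
    fun Z : N => if abs2 (Z k k1) == 0 then 0 else complex.Im (Z k k1)).
  by apply: measurable_fun_ifT.
by apply/funext => Z; rewrite /nz abs2_eq0; case: eqP.
Qed.

Let r1 := [seq i : 'I_n <- enum 'I_n | (i < k)%N].
Let r2 := [seq j : 'I_n <- enum 'I_n | (k1 < j)%N].
Let sA := [seq (i, k) | i <- r1] ++ [seq (k1, j) | j <- r2].
Let sB := [seq (i, k1) | i <- r1] ++ [seq (k, j) | j <- r2].
Let sC := [seq (i, k) | i <- r1].

Let mem_row (u : 'I_n) a b : ((a, b) \in [seq (u, j) | j <- r2]) = (a == u) && (k1 < b)%N.
Proof.
apply/mapP/andP => [[j]|[/eqP -> b1]].
  by rewrite mem_filter => /andP[k1j _] [-> ->].
by exists b => //; rewrite mem_filter b1 mem_enum.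
Qed.

Let mem_col (u : 'I_n) a b : ((a, b) \in [seq (i, u) | i <- r1]) = (b == u) && (a < k)%N.
Proof.
apply/mapP/andP => [[j]|[/eqP -> b1]].
  by rewrite mem_filter => /andP[k1j _] [-> ->].
by exists a => //; rewrite mem_filter b1 mem_enum.
Qed.

Let uniq_row (u : 'I_n) : uniq [seq (u, j) | j <- r2].
Proof. by rewrite map_inj_uniq ?filter_uniq -?enumT ?enum_uniq// => x y []. Qed.

Let uniq_col (u : 'I_n) : uniq [seq (j, u) | j <- r1].
Proof. by rewrite map_inj_uniq ?filter_uniq -?enumT ?enum_uniq// => x y []. Qed.

Let neqk : (k == k1) = false. Proof. by rewrite -val_eqE/= k1E; lia. Qed.
Let neqk' : (k1 == k) = false. Proof. by rewrite eq_sym. Qed.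

Let mem_sA a b : ((a, b) \in sA) = (b == k) && (a < k)%N || (a == k1) && (k1 < b)%N.
Proof. by rewrite mem_cat mem_row mem_col. Qed.

Let mem_sB a b : ((a, b) \in sB) = (b == k1) && (a < k)%N || (a == k) && (k1 < b)%N.
Proof. by rewrite mem_cat mem_row mem_col. Qed.

Let uniq_sA : uniq sA.
Proof.
rewrite cat_uniq uniq_row uniq_col andbT/=; apply/hasPn => -[a b].
rewrite mem_row mem_col => /andP[/eqP -> k1b]; apply/negP => /andP[/eqP bk _].
by move: k1b; rewrite bk k1E; lia.
Qed.

Let uniq_sB : uniq sB.
Proof.
rewrite cat_uniq uniq_row uniq_col andbT/=; apply/hasPn => -[a b].
rewrite mem_row mem_col => /andP[/eqP -> k1b]; apply/negP => /andP[/eqP bk _].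
by move: k1b; rewrite bk; lia.
Qed.

Let cA (ij : 'I_n * 'I_n) Z : C := if ij.2 == k then 1 else - nz (Z k k1).
Let dA (ij : 'I_n * 'I_n) Z : C := if ij.2 == k then Z ij.1 k1 else Z k ij.2.
Let cB (ij : 'I_n * 'I_n) Z : C := if ij.2 == k1 then -1 else (nz (Z k k1))^-1.
Let dB (ij : 'I_n * 'I_n) Z : C := if ij.2 == k1 then Z ij.1 k else 0.
Let cC (ij : 'I_n * 'I_n) Z : C := 1.
Let dC (ij : 'I_n * 'I_n) Z : C := - Z ij.1 k1.

Let indep_entry s a b : (a, b) \notin s -> indep s (fun Z => Z a b).
Proof.
move=> abs Z W ZW; have [ab|ba] := ltnP a b; first exact: ZW.
by rewrite !unitriE.
Qed.

Lemma measurable_swapT : measurable_fun setT swapT.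
Proof.
have mE := @cmeasurable_entry R n.
have mN (f : N -> C) : cmeasurable f -> cmeasurable (fun Z => - f Z).
  move=> mf; under eq_fun do rewrite -mulN1r.
  by apply: cmeasurableM => //; exact: cmeasurable_cst.
apply: measurable_mkU => i j _.
case: (i == k).
  case: (j == k1); first exact: cmeasurable_inv.
  by apply: cmeasurableM => //; exact: cmeasurable_inv.
case: (i == k1); first by apply: cmeasurableD => //; apply: mN; exact: cmeasurableM.
by case: (j == k); case: (j == k1).
Qed.

(** The map is the composition of z |-> 1/z and of three affine maps whose
    coefficients depend on z and on frozen entries. The factors |z|^2 of the
    entries in row k1 cancel the factors |z|^-2 of those in row k, and the
    Jacobian |z|^-4 of the inversion remains. *)
Lemma uint_swap h : density h ->
  uint (fun Z => h (swapT Z) * abs2 (Z k k1) ^- 2) = uint h.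
Proof.
move=> dh.
have mC : forall ij, cmeasurable (cC ij) by move=> ij; exact: cmeasurable_cst.
have mN (f : N -> C) : cmeasurable f -> cmeasurable (fun Z => - f Z).
  move=> mf; under eq_fun do rewrite -mulN1r.
  by apply: cmeasurableM => //; exact: cmeasurable_cst.
have mdC : forall ij, cmeasurable (dC ij) by move=> ij; apply: mN; exact: cmeasurable_entry.
have mcA : forall ij, cmeasurable (cA ij).
  by move=> ij; rewrite /cA; case: eqP => _; [exact: cmeasurable_cst|exact: mN].
have mdA : forall ij, cmeasurable (dA ij).
  by move=> ij; rewrite /dA; case: eqP => _; exact: cmeasurable_entry.
have mcB : forall ij, cmeasurable (cB ij).
  by move=> ij; rewrite /cB; case: eqP => _; [exact: cmeasurable_cst|exact: cmeasurable_inv].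
have mdB : forall ij, cmeasurable (dB ij).
  by move=> ij; rewrite /dB; case: eqP => _; [exact: cmeasurable_entry|exact: cmeasurable_cst].
pose hI W := h (uupd W (k, k1) (W k k1)^-1) * abs2 (W k k1) ^- 2.
have dhI : density hI.
  apply: densityM.
    by apply: (density_comp dh); apply/measurable_uupd/cmeasurable_inv/cmeasurable_entry.
  by apply/density_inv/densityX/density_abs2/cmeasurable_entry.
pose step h s c d Z := h (upd_affine s c d Z) * \prod_(ij <- s) abs2 (c ij Z).
have dstep h0 s c d : density h0 -> (forall ij, cmeasurable (c ij)) ->
    (forall ij, cmeasurable (d ij)) -> density (step h0 s c d).
  move=> dh0 mc md; apply: densityM; first exact: (density_comp dh0 (measurable_upd_affine _ mc md)).
  by apply: density_prod => ij; exact: density_abs2.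
have EC : uint (step hI sC cC dC) = uint hI.
  apply: uint_affine => //; first exact: uniq_col.
  - by move=> [a b]; rewrite mem_col => /andP[/eqP ->].
  - by move=> ij Z; rewrite oner_eq0.
  move=> ij Z W ZW; congr (- _); apply: (indep_entry _ ZW).
  by rewrite mem_col neqk'.
have EB : uint (step (step hI sC cC dC) sB cB dB) = uint (step hI sC cC dC).
  apply: uint_affine => //; last exact: dstep.
  - move=> [a b]; rewrite mem_sB /= => /orP[] /andP[/eqP ->]; rewrite k1E; lia.
  - by move=> ij Z; rewrite /cB; case: (ij.2 == k1); rewrite ?invr_eq0// oppr_eq0 oner_eq0.
  - move=> ij Z W ZW; rewrite /cB; case: eqP => _ //; congr (nz _)^-1.
    by apply: (indep_entry _ ZW); rewrite mem_sB !ltnn !andbF.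
  - move=> ij Z W ZW; rewrite /dB; case: eqP => _ //.
    by apply: (indep_entry _ ZW); rewrite mem_sB neqk k1E/= ltnNge ltnW// andbF.
have EA : uint (step (step (step hI sC cC dC) sB cB dB) sA cA dA) =
    uint (step (step hI sC cC dC) sB cB dB).
  apply: uint_affine => //; last by apply: (dstep _ _ _ _) => //; exact: dstep.
  - move=> [a b]; rewrite mem_sA /= => /orP[] /andP[/eqP ->] //.
  - by move=> ij Z; rewrite /cA; case: (ij.2 == k); rewrite ?oppr_eq0 ?oner_eq0.
  - move=> ij Z W ZW; rewrite /cA; case: eqP => _ //; congr (- nz _).
    by apply: (indep_entry _ ZW); rewrite mem_sA neqk neqk'.
  - move=> ij Z W ZW; rewrite /dA; case: eqP => _; apply: (indep_entry _ ZW).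
      by rewrite mem_sA neqk' ltnn andbF.
    by rewrite mem_sA neqk ltnn andbF.
rewrite -(uint_inv kk1 dh) -/hI -EC -EB -EA.
apply: (uint_neq0 kk1).
- apply: densityM; last by apply/density_inv/densityX/density_abs2/cmeasurable_entry.
  apply: (density_comp dh); exact: measurable_swapT.
- by apply: (dstep _ _ _ _) => //; apply: (dstep _ _ _ _) => //; exact: dstep.
move=> Z z0; rewrite /step /hI.
set ZA := upd_affine sA cA dA Z; set ZB := upd_affine sB cB dB ZA.
set ZC := upd_affine sC cC dC ZB.
have nzE : nz (Z k k1) = Z k k1 by rewrite /nz (negbTE z0).
have eA a b : (a < b)%N -> ZA a b =
   if (b == k) && (a < k)%N then Z a b + Z a k1
   else if (a == k1) && (k1 < b)%N then - Z k k1 * Z k1 b + Z k b else Z a b.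
  move=> ab; rewrite mkUE ab mem_sA /cA /dA /= nzE.
  case: (eqVneq b k) ab => [-> ab|bk _] /=; first by rewrite ab mul1r.
  by case: (eqVneq a k1) => [->|].
have zA : ZA k k1 = Z k k1 by rewrite eA// !ltnn !andbF.
have eB a b : (a < b)%N -> ZB a b =
   if (b == k1) && (a < k)%N then - ZA a b + ZA a k
   else if (a == k) && (k1 < b)%N then (Z k k1)^-1 * ZA a b else ZA a b.
  move=> ab; rewrite mkUE ab mem_sB /cB /dB /= zA nzE.
  case: (eqVneq b k1) ab => [-> ab|bk _] /=; first by rewrite ltnn andbF orbF mulN1r.
  by rewrite addr0.
have zB : ZB k k1 = Z k k1 by rewrite eB// !ltnn zA !andbF.
have eC a b : (a < b)%N -> ZC a b =
   if (b == k) && (a < k)%N then ZB a b - ZB a k1 else ZB a b.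
  by move=> ab; rewrite mkUE ab mem_col /cC /dC /= mul1r.
have zC : ZC k k1 = Z k k1 by rewrite eC// ltnn andbF.
rewrite zC.
have -> : uupd ZC (k, k1) (Z k k1)^-1 = swapT Z.
  apply: unitriP => a b ab; rewrite [LHS]mkUE [RHS]mkUE ab xpair_eqE eC//.
  have [ak|ak] := eqVneq a k.
    subst a; have [//|bk1] := eqVneq b k1; rewrite /= ltnn andbF eB//.
    have k1b : (k1 < b)%N by move: bk1 ab; rewrite -val_eqE/= k1E; lia.
    by rewrite ltnn andbF eqxx k1b eA// ltnn andbF neqk/= mulrC.
  have [ak1|ak1] := eqVneq a k1.
    subst a; rewrite /= k1E ltnNge leqnSn/= andbF eB// k1E ltnNge leqnSn/= andbF.
    rewrite neqk'/= eA// k1E ltnNge leqnSn/= andbF eqxx -k1E ab/=.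
    by rewrite addrC mulNr.
  have [bk|bk] := eqVneq b k.
    subst b; rewrite ab/= !eB//; last by rewrite k1E ltnS ltnW.
    rewrite neqk eqxx ab (negbTE ak)/= !eA//; last by rewrite k1E ltnS ltnW.
    by rewrite eqxx ab neqk' (negbTE ak1)/=; ring.
  have [bk1|bk1] := eqVneq b k1.
    subst b; rewrite eB// eqxx.
    have ak' : (a < k)%N by move: ak ab; rewrite -val_eqE/= k1E; lia.
    by rewrite ak'/= !eA// eqxx ak' neqk' (negbTE ak1)/=; ring.
  by rewrite eB// (negbTE bk1) (negbTE ak)/= eA// (negbTE bk) (negbTE ak1).
rewrite [X in _ = _ * X * _ * _]big1 ?mulr1; last by move=> ij _; rewrite abs21.
rewrite -!mulrA; congr (_ * _); rewrite -[LHS]mulr1; congr (_ * _).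
rewrite !big_cat !big_map /cA /cB /= !eqxx.
rewrite [X in X * _ * _]big1 ?mul1r; last by move=> a _; rewrite abs2N abs21.
rewrite [X in _ * (X * _)]big1 ?mul1r; last by move=> a _; rewrite abs21.
rewrite -big_split big_seq big1// => b; rewrite mem_filter => /andP[k1b _].
rewrite zA nzE -!val_eqE /= (gtn_eqF k1b) (gtn_eqF (ltn_trans kk1 k1b)).
by rewrite abs2N abs2V mulVf// abs2_eq0.
Qed.

End adjacent_swap.

(** * Leading minors and the Gauss decomposition *)

(** Adjacent transpositions generate the symmetric group: the transposition of i
    and j is conjugate to that of i and j - 1 by that of j - 1 and j. *)
Lemma perm_adjacent_ind (n : nat) (P : {perm 'I_n} -> Prop) :
  P 1%g -> (forall s1 s2, P s1 -> P s2 -> P (s1 * s2)%g) ->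
  (forall k k1 : 'I_n, k1 = k.+1 :> nat -> P (tperm k k1)) -> forall s, P s.
Proof.
move=> P1 PM Padj.
have adj (m : nat) (i j : 'I_n) : (j = i + m.+1 :> nat)%N -> P (tperm i j).
  elim: m i j => [|m IH] i j ijm; first by apply: Padj; rewrite ijm addn1.
  have kn : (i + m.+1 < n)%N by have := ltn_ord j; rewrite ijm; lia.
  pose k := Ordinal kn.
  have -> : tperm i j = (tperm k j * tperm i k * tperm k j)%g.
    rewrite -{1}[tperm k j]tpermV -mulgA -/(conjg _ _) tpermJ tpermL tpermD//.
      by rewrite -val_eqE/= gtn_eqF// addnS ltnS leq_addr.
    by rewrite -val_eqE/= ijm gtn_eqF// addnS ltnS leq_addr.
  apply: (PM _ _ _ _); last by apply: Padj; rewrite ijm addnS.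
  by apply: (PM _ _ _ _); [apply: Padj; rewrite ijm addnS|exact: IH].
move=> s; have [ts -> _] := prod_tpermP s.
elim: ts => [|[i j] ts IH]; first by rewrite big_nil.
rewrite big_cons; apply: (PM _ _ _ _); last exact: IH.
rewrite /=; case: (ltngtP i j) => [ij|ji|/val_inj ->].
- by apply: (adj (j - i.+1)%N); lia.
- by rewrite tpermC; apply: (adj (i - j.+1)%N); lia.
- by rewrite tperm1.
Qed.

Section minors.
Variables (F : fieldType) (n : nat).
Implicit Types (g b : 'M[F]_n) (i j : 'I_n) (s : {perm 'I_n}).

Definition lead_mx j g : 'M[F]_(j.+1) :=
  mxsub (widen_ord (ltn_ord j)) (widen_ord (ltn_ord j)) g.

Definition minor j g := \det (lead_mx j g).

Lemma trig_rowsubM j m b (g : 'M[F]_(n, m)) : is_trig_mx b ->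
  rowsub (widen_ord (ltn_ord j)) (b *m g) =
  lead_mx j b *m rowsub (widen_ord (ltn_ord j)) g.
Proof.
move=> /is_trig_mxP bt; apply/matrixP => i k; rewrite !mxE.
rewrite (bigID (fun l : 'I_n => (l < j.+1)%N)) /= [X in _ + X]big1 ?addr0; last first.
  move=> l; rewrite -leqNgt => jl; rewrite bt ?mul0r//=.
  by rewrite (leq_trans (ltn_ord i)).
rewrite (big_ord_narrow (ltn_ord j)).
by apply: eq_bigr => l _; rewrite !mxE.
Qed.

Lemma lead_mxM j b g : is_trig_mx b -> lead_mx j (b *m g) = lead_mx j b *m lead_mx j g.
Proof.
move=> bt; have := trig_rowsubM j g bt => /matrixP e; apply/matrixP => i k.
have := e i (widen_ord (ltn_ord j) k); rewrite !mxE => ->.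
by apply: eq_bigr => l _; rewrite !mxE.
Qed.

Lemma minor_trig j b : is_trig_mx b -> minor j b = \prod_(i < n | (i <= j)%N) b i i.
Proof.
move=> /is_trig_mxP bt; rewrite /minor det_trig.
  by rewrite (big_ord_narrow (ltn_ord j)); apply: eq_bigr => i _; rewrite !mxE.
by apply/is_trig_mxP => i k ik; rewrite !mxE bt.
Qed.

(** Multiplication by a lower triangular matrix rescales all minors on the first
    rows; this is the source of every equivariance below. *)
Lemma minorM j b g : is_trig_mx b ->
  minor j (b *m g) = (\prod_(i < n | (i <= j)%N) b i i) * minor j g.
Proof. by move=> bt; rewrite -minor_trig// /minor lead_mxM// det_mulmx. Qed.

Lemma col_permM_mul s b g : col_perm s (b *m g) = b *m col_perm s g.
Proof. by rewrite !col_permE mulmxA. Qed.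

Lemma col_perm_unit s g : (col_perm s g \in unitmx) = (g \in unitmx).
Proof. by rewrite col_permE unitmx_mul unitmx_perm andbT. Qed.

Lemma trig_unitmx b : is_trig_mx b ->
  (b \in unitmx) = [forall i, b i i != 0].
Proof.
move=> bt; rewrite unitmxE det_trig// unitfE.
apply/idP/forallP => [/prodf_neq0 H i|H]; first exact: H.
by apply/prodf_neq0 => i _; exact: H.
Qed.

Lemma trig_unit_neq0 b i : is_trig_mx b -> b \in unitmx -> b i i != 0.
Proof. by move=> bt; rewrite trig_unitmx// => /forallP. Qed.

Lemma trigM b1 b2 : is_trig_mx b1 -> is_trig_mx b2 -> is_trig_mx (b1 *m b2).
Proof.
move=> /is_trig_mxP t1 /is_trig_mxP t2; apply/is_trig_mxP => i j ij.
rewrite mxE big1// => k _; have [ik|ki] := ltnP i k; first by rewrite t1 ?mul0r.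
by rewrite [b2 k j]t2 ?mulr0// (leq_ltn_trans ki).
Qed.

Lemma trigM_diag b1 b2 i : is_trig_mx b1 -> is_trig_mx b2 ->
  (b1 *m b2) i i = b1 i i * b2 i i.
Proof.
move=> /is_trig_mxP t1 /is_trig_mxP t2; rewrite mxE (bigD1 i)//= big1 ?addr0// => k.
rewrite neq_ltn => /orP[ki|ik]; first by rewrite [b2 k i]t2 ?mulr0.
by rewrite t1 ?mul0r.
Qed.

(** Abel summation on exponents; the value 0 of the default entry of q closes
    the telescoping sum at n. *)
Lemma prod_prefix_pow (x : 'I_n -> F) (q : seq int) : (size q <= n)%N ->
  (forall i, x i != 0) ->
  \prod_(j < n) (\prod_(i < n | (i <= j)%N) x i) ^ (q`_j - q`_j.+1) =
  \prod_(i < n) x i ^ q`_i.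
Proof.
move=> sq x0.
have expz (y : F) (I : Type) (r : seq I) (P : pred I) (e : I -> int) : y != 0 ->
    \prod_(k <- r | P k) y ^ e k = y ^ (\sum_(k <- r | P k) e k).
  by move=> y0; rewrite (big_morph (exprz y) (fun u v => expfzDr u v y0) (expr0z y)).
transitivity (\prod_(j < n) \prod_(i < n | (i <= j)%N) x i ^ (q`_j - q`_j.+1)).
  apply: eq_bigr => j _; apply: (big_morph (fun y => y ^ _)) => [y z|].
    by rewrite expfzMl.
  by rewrite exp1rz.
rewrite (exchange_big_dep predT)//=; apply: eq_bigr => i _.
rewrite expz//; congr (_ ^ _).
have T m : \sum_(j < m | (i <= j)%N) (q`_j - q`_j.+1) = (if (i <= m)%N then q`_i - q`_m else 0).
  elim: m => [|m IH]; first by rewrite big_ord0; case: ifP => //; rewrite leqn0 => /eqP ->; rewrite subrr.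
  rewrite big_mkcond big_ord_recr -big_mkcond/= IH [(i <= m.+1)%N]leq_eqVlt ltnS.
  case: (eqVneq (i : nat) m.+1) => [e|_] /=; last by case: ifP => _; rewrite ?addr0//; ring.
  by rewrite e ltnn /= !subrr.
by rewrite T (ltnW (ltn_ord i)) [q`_n]nth_default// subr0.
Qed.

(** A Gauss decomposition written with the lower triangular factor on the other
    side: row i of b is read off from the inverse of the leading block of
    size i + 1. *)
Lemma gauss_decomposition g : (forall j, minor j g != 0) ->
  exists2 b, is_trig_mx b /\ b \in unitmx &
    is_trig_mx (b *m g)^T /\ forall i, (b *m g) i i = 1.
Proof.
move=> g0.
pose b := \matrix_(i < n, k < n)
  if insub (k : nat) is Some k' then invmx (lead_mx i g) ord_max k' else 0 : F.
have bt : is_trig_mx b.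
  by apply/is_trig_mxP => i j ij; rewrite mxE insubF// ltnS leqNgt ij.
have bg i j : (j <= i)%N -> (b *m g) i j = (i == j)%:R.
  move=> ji.
  have gu : lead_mx i g \in unitmx by rewrite unitmxE unitfE; exact: g0.
  have := mulVmx gu => /matrixP /(_ ord_max (Ordinal (ji : j < i.+1)%N)).
  have -> : (i == j) = (ord_max == Ordinal (ji : j < i.+1)%N) by rewrite -!val_eqE.
  rewrite [in RHS]mxE => <-; rewrite !mxE.
  rewrite (bigID (fun l : 'I_n => (l < i.+1)%N)) /= [X in _ + X]big1 ?addr0; last first.
    by move=> l; rewrite -leqNgt => jl; rewrite mxE insubF ?mul0r// ltnNge jl.
  rewrite (big_ord_narrow (ltn_ord i)); apply: eq_bigr => l _; rewrite !mxE.
  rewrite /= insubT//= => ll; congr (invmx _ _ _ * g _ _); exact/val_inj.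
have b1 : \det b * \det g = 1.
  rewrite -det_mulmx -det_tr det_trig; first by apply: big1 => i _; rewrite mxE bg// eqxx.
  by apply/is_trig_mxP => i j ij; rewrite mxE bg ?(ltnW ij)// -val_eqE gtn_eqF.
exists b; split => //.
- rewrite unitmxE unitfE; apply/eqP => d0; move: b1; rewrite d0 mul0r => /eqP.
  by rewrite eq_sym oner_eq0.
- by apply/is_trig_mxP => i j ij; rewrite mxE bg ?(ltnW ij)// -val_eqE gtn_eqF.
- by move=> i; rewrite bg// eqxx.
Qed.

End minors.

(** * Functions equivariant under lower triangular matrices *)

Section equivariant_functions.
Variables (R : realType) (n : nat).
Local Notation C := R[i].
Local Notation N := (unitri R n).
Implicit Types (g b u : 'M[C]_n) (i j : 'I_n) (s : {perm 'I_n}) (Z : N).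
Implicit Types (p q : n.-tuple int).

Local Notation lower b := (is_trig_mx b /\ b \in unitmx).

Lemma unitri_trig_tr Z : is_trig_mx (Z : 'M[C]_n)^T.
Proof. by have /andP[] := valP Z. Qed.

Let minorMC j b g : is_trig_mx b ->
  minor j (b *m g) = (\prod_(i < n | (i <= j)%N) b i i) * minor j g.
Proof. exact: minorM. Qed.

Let minor_trigC j b : is_trig_mx b -> minor j b = \prod_(i < n | (i <= j)%N) b i i.
Proof. exact: minor_trig. Qed.

Let col_permMC s b g : col_perm s (b *m g) = b *m col_perm s g.
Proof. exact: col_permM_mul. Qed.

Let prod_prefixC (x : 'I_n -> C) q : (forall i, x i != 0) ->
  \prod_(j < n) (\prod_(i < n | (i <= j)%N) x i) ^ (q`_j - q`_j.+1) =
  \prod_(i < n) x i ^ q`_i.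
Proof. by move=> x0; apply: prod_prefix_pow; rewrite ?size_tuple. Qed.

Let prod_prefixR (x : 'I_n -> R) q : (forall i, x i != 0) ->
  \prod_(j < n) (\prod_(i < n | (i <= j)%N) x i) ^ (q`_j - q`_j.+1) =
  \prod_(i < n) x i ^ q`_i.
Proof. by move=> x0; apply: prod_prefix_pow; rewrite ?size_tuple. Qed.

Lemma minor_unitri i Z : minor i Z = 1.
Proof.
rewrite /minor -det_tr det_trig; first by apply: big1 => k _; rewrite !mxE unitriE// eqxx.
by apply/is_trig_mxP => a b ab; rewrite !mxE unitriE/= ?(ltnW ab)// -val_eqE/= gtn_eqF.
Qed.

Lemma minor_tperm_unitri i j Z : (i < j)%N -> minor i (col_perm (tperm i j) Z) = Z i j.
Proof.
move=> ij; rewrite /minor -det_tr det_trig; last first.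
  apply/is_trig_mxP => a b ab; rewrite !mxE.
  rewrite tpermD; first by rewrite unitriE/= ?(ltnW ab)// -val_eqE/= gtn_eqF.
    by rewrite -val_eqE/= gtn_eqF// (leq_trans ab)// -ltnS ltn_ord.
  by rewrite -val_eqE/= gtn_eqF// (leq_trans ab)// -ltnS (leq_trans (ltn_ord b))// ltnW.
rewrite big_ord_recr/= big1 ?mul1r => [|a _]; rewrite !mxE.
  have -> : widen_ord (ltn_ord i) ord_max = i by apply/val_inj.
  by rewrite tpermL.
have ai : (a < i)%N by exact: ltn_ord.
rewrite tpermD; first by rewrite unitriE ?eqxx.
  by rewrite -val_eqE/= gtn_eqF.
by rewrite -val_eqE/= gtn_eqF// (ltn_trans ai).
Qed.

(** The unitriangular factor of g by Cramer's rule. *)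
Definition gaussW g : N := mkU (fun i j => minor i (col_perm (tperm i j) g) / minor i g).

Lemma prefix_neq0 j b : is_trig_mx b -> b \in unitmx ->
  \prod_(i < n | (i <= j)%N) b i i != 0.
Proof. by move=> bt bu; apply/prodf_neq0 => i _; exact: trig_unit_neq0. Qed.

Lemma gaussWM b g : is_trig_mx b -> b \in unitmx -> gaussW (b *m g) = gaussW g.
Proof.
move=> bt bu; apply: unitriP => i j ij; rewrite [LHS]mkUE [RHS]mkUE ij.
rewrite (col_permMC (tperm i j) b g).
rewrite (minorMC i g bt).
rewrite (minorMC i (col_perm (tperm i j) g) bt).
by rewrite invfM mulrACA divff ?mul1r// prefix_neq0.
Qed.

Lemma gaussW_unitri Z : gaussW Z = Z.
Proof.
by apply: unitriP => i j ij; rewrite mkUE ij minor_unitri minor_tperm_unitri// divr1.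
Qed.

(** The character of the lower triangular group, extended to the matrices without
    vanishing leading minors; the exponents come from Abel summation. *)
Definition minor_char p g : C := \prod_(j < n) minor j g ^ (p`_j - p`_j.+1).

Lemma minor_charM p b g : is_trig_mx b -> b \in unitmx ->
  minor_char p (b *m g) = tri_char p b * minor_char p g.
Proof.
move=> bt bu.
have b0 i : b i i != 0 by exact: trig_unit_neq0.
transitivity (\prod_(j < n) ((\prod_(i < n | (i <= j)%N) b i i) ^ (p`_j - p`_j.+1) *
    minor j g ^ (p`_j - p`_j.+1))).
  by apply: eq_bigr => j _; rewrite -expfzMl -(minorMC j g bt).
rewrite big_split/=; congr (_ * _).
transitivity (\prod_(i < n) b i i ^ p`_i); first exact: prod_prefixC.
by apply: eq_bigr => i _; rewrite (tnth_nth 0).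
Qed.

Lemma minor_char_unitri p Z : minor_char p Z = 1.
Proof. by rewrite /minor_char big1// => j _; rewrite minor_unitri exp1rz. Qed.

Lemma tri_char_neq0 p b : is_trig_mx b -> b \in unitmx -> tri_char p b != 0.
Proof.
by move=> bt bu; apply/prodf_neq0 => i _; rewrite expfz_neq0// trig_unit_neq0.
Qed.

Definition gram j g : R := complex.Re (\det (corner j g *m (corner j g)^t*)).

Lemma cornerM j b g : is_trig_mx b -> corner j (b *m g) = lead_mx j b *m corner j g.
Proof. exact: trig_rowsubM. Qed.

Lemma det_conj m (A : 'M[C]_m) : \det (A^t*) = (\det A)^*.
Proof. by rewrite -map_trmx det_tr det_map_mx. Qed.

Lemma gramM j b g : is_trig_mx b ->
  gram j (b *m g) = (\prod_(i < n | (i <= j)%N) abs2 (b i i)) * gram j g.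
Proof.
move=> bt; rewrite /gram cornerM// trmx_mul map_mxM mulmxA.
rewrite det_mulmx -mulmxA det_mulmx det_conj -/(minor j b) (minor_trigC _ bt).
rewrite mulrAC mul_conjCE abs2_prod -complexr0.
by case: (\det _) => x y /=; rewrite mul0r subr0.
Qed.

Lemma gram_ge0 j g : 0 <= gram j g.
Proof. by have := gram_det_ge0 (corner j g); rewrite lecE => /andP[]. Qed.

Lemma gram_unitary j g u : u \is unitarymx -> gram j (g *m u) = gram j g.
Proof.
move=> /unitarymxP uu; rewrite /gram.
have -> : corner j (g *m u) = corner j g *m u.
  by apply/matrixP => a b; rewrite !mxE; apply: eq_bigr => k _; rewrite !mxE.
by rewrite trmx_mul map_mxM mulmxA -(mulmxA _ u) uu mulmx1.
Qed.

Definition gram_weight q g : R := \prod_(j < n) gram j g ^ (q`_j - q`_j.+1).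

Lemma gram_weight_ge0 q g : 0 <= gram_weight q g.
Proof. by apply: prodr_ge0 => j _; rewrite exprz_ge0// gram_ge0. Qed.

Lemma gram_weightM q b g : is_trig_mx b -> b \in unitmx ->
  gram_weight q (b *m g) = (\prod_i abs2 (b i i) ^ q`_i) * gram_weight q g.
Proof.
move=> bt bu.
have b0 i : abs2 (b i i) != 0 by rewrite abs2_eq0 trig_unit_neq0.
transitivity (\prod_(j < n) ((\prod_(i < n | (i <= j)%N) abs2 (b i i)) ^ (q`_j - q`_j.+1) *
    gram j g ^ (q`_j - q`_j.+1))).
  by apply: eq_bigr => j _; rewrite -expfzMl -(gramM j g bt).
rewrite big_split/=; congr (_ * _); exact: prod_prefixR.
Qed.

Lemma gram_weight_unitary q g u : u \is unitarymx ->
  gram_weight q (g *m u) = gram_weight q g.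
Proof.
by move=> uu; rewrite /gram_weight; apply: eq_bigr => j _; rewrite gram_unitary.
Qed.

(** The exponents making gram_weight, on unitriangular matrices, the density of
    the measure; the value at the last index compensates the determinant. *)
Definition dual_exponents p : n.-tuple int :=
  [tuple - p`_i - 2 * (n.-1 - i)%N%:Z + n.-1%:Z | i < n].

Lemma dual_exponentsE p i :
  (dual_exponents p)`_i = - p`_i - 2 * (n.-1 - i)%N%:Z + n.-1%:Z.
Proof. by rewrite -tnth_nth tnth_mktuple. Qed.

Lemma gram_last j Z : j.+1 = n -> gram j Z = 1.
Proof.
move=> jn; have := minor_unitri j Z; rewrite /minor /gram.
have -> : corner j Z *m (corner j Z)^t* =
   (lead_mx j Z) *m (lead_mx j Z)^t*.
  apply/matrixP => a b; rewrite !mxE.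
  rewrite (eq_bigl (fun k : 'I_n => (k < j.+1)%N)); last by move=> k; rewrite jn ltn_ord.
  by rewrite (big_ord_narrow (ltn_ord j)); apply: eq_bigr => k _; rewrite !mxE.
by rewrite det_mulmx det_conj => ->; rewrite rmorph1 mulr1.
Qed.

Lemma gram_weight_unitri p Z : gram_weight (dual_exponents p) Z = weight p Z.
Proof.
rewrite /gram_weight /weight (bigID (fun j : 'I_n => (j.+1 < n)%N)) /=.
rewrite [X in _ * X]big1 ?mulr1; last first.
  move=> j; rewrite -leqNgt => nj; rewrite gram_last ?exp1rz//.
  by apply/eqP; rewrite eqn_leq nj ltn_ord.
apply: eq_bigr => j j1; congr (_ ^ _).
rewrite (dual_exponentsE p (Ordinal j1)) dual_exponentsE/=.
move: (p`_j) (p`_j.+1) => x y; lia.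
Qed.

(** The modulus of the lower triangular group in complex dimension. *)
Definition modulus b : R := \prod_i abs2 (b i i) ^ (2 * (i : nat)%:Z - n.-1%:Z).

Lemma modulusE p b : is_trig_mx b -> b \in unitmx ->
  modulus b = abs2 (tri_char p b) * \prod_i abs2 (b i i) ^ (dual_exponents p)`_i.
Proof.
move=> bt bu; rewrite /tri_char abs2_prod -big_split/=; apply: eq_bigr => i _.
rewrite abs2Xz (tnth_nth 0) -expfzDr ?abs2_eq0 ?trig_unit_neq0//; congr (_ ^ _).
rewrite dual_exponentsE; have := ltn_ord i => ni.
move: (p`_i) => x; lia.
Qed.

End equivariant_functions.

(** * The Gauss decomposition of an adjacent transposition *)

Section swap_decomposition.
Variables (R : realType) (n : nat) (k k1 : 'I_n).
Hypothesis k1E : k1 = k.+1 :> nat.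
Local Notation C := R[i].
Local Notation N := (unitri R n).
Implicit Types (i j a b : 'I_n) (Z W : N) (z : C).

Definition swap_low z : 'M[C]_n := \matrix_(i, j)
  if i == j then (if i == k then z else if i == k1 then - z^-1 else 1)
  else ((i == k1) && (j == k))%:R.

Let neqk : (k == k1) = false. Proof. by rewrite -val_eqE/= k1E; lia. Qed.
Let neqk' : (k1 == k) = false. Proof. by rewrite eq_sym. Qed.

Lemma swap_low_trig z : is_trig_mx (swap_low z).
Proof.
apply/is_trig_mxP => i j ij; rewrite mxE -val_eqE/= ltn_eqF//.
case: eqP => // ik1; case: eqP => // jk; move: ij; rewrite ik1 jk k1E; lia.
Qed.

Lemma swap_low_diag z i :
  swap_low z i i = if i == k then z else if i == k1 then - z^-1 else 1.
Proof. by rewrite mxE eqxx. Qed.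

Lemma swap_low_unit z : z != 0 -> swap_low z \in unitmx.
Proof.
move=> z0; rewrite trig_unitmx ?swap_low_trig//; apply/forallP => i.
by rewrite swap_low_diag; case: (i == k) => //; case: (i == k1); rewrite ?oppr_eq0 ?invr_eq0 ?oner_eq0.
Qed.

Lemma swap_low_mul z (A : 'M[C]_n) i j : (swap_low z *m A) i j =
  if i == k then z * A k j else if i == k1 then A k j - z^-1 * A k1 j else A i j.
Proof.
rewrite mxE (bigD1 i)//= swap_low_diag.
have [->|ik] := eqVneq i k.
  rewrite big1 ?addr0// => l lk; rewrite mxE eq_sym (negbTE lk) neqk mul0r//.
have [->|ik1] := eqVneq i k1.
  rewrite (bigD1 k) ?neqk//= mxE neqk' !eqxx/= mul1r big1 ?addr0; last first.
    by move=> l /andP[lk1 lk]; rewrite mxE eq_sym (negbTE lk1) (negbTE lk) andbF mul0r.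
  by rewrite mulNr addrC.
rewrite mul1r big1 ?addr0// => l li.
by rewrite mxE eq_sym (negbTE li) (negbTE ik1) mul0r.
Qed.

Lemma swap_decomposition Z : Z k k1 != 0 ->
  col_perm (tperm k k1) Z = swap_low (Z k k1) *m swapT k k1 Z.
Proof.
move=> z0; apply/matrixP => i j; rewrite swap_low_mul [LHS]mxE.
have kk1 : (k < k1)%N by rewrite k1E.
have ltE (a b : 'I_n) : a != b -> (a < b)%N = ~~ (b < a)%N.
  by rewrite -val_eqE /= => ?; lia.
have [->|ik] := eqVneq i k.
  rewrite (mkUE _ k j) eqxx.
  case: (tpermP k k1 j) => [->|->|/eqP jk /eqP jk1].
  - by rewrite ltnn eqxx mulr1.
  - by rewrite kk1 eqxx divff// unitriE ?eqxx.
  case: ltnP => kj; last by rewrite unitriE// mulr_natr eq_sym (negbTE jk) mulr0n.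
  by rewrite (negbTE jk1) mulrCA divff// mulr1.
have [->|ik1] := eqVneq i k1.
  rewrite (mkUE _ k j) (mkUE _ k1 j) neqk' !eqxx.
  case: (tpermP k k1 j) => [->|->|/eqP jk /eqP jk1].
  - by rewrite ltnn [(k1 < k)%N]ltnNge ltnW//= neqk' mulr0n mulr0 subr0 unitriE// !eqxx.
  - rewrite kk1 ltnn !eqxx [LHS]unitriE ?(ltnW kk1)//.
    by rewrite neqk' mulr1 subrr.
  rewrite (negbTE jk1).
  have [jk'|kj] := ltnP j k.
    rewrite !ltnNge (ltnW jk') (ltnW (ltn_trans jk' kk1))/= unitriE ?(ltnW (ltn_trans jk' kk1))//.
    by rewrite ![_ == j]eq_sym (negbTE jk) (negbTE jk1) mulr0 subr0.
  have k1j : (k1 < j)%N by move: jk jk1 kj; rewrite -!val_eqE/= k1E; lia.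
  by rewrite k1j (ltn_trans kk1 k1j) mulrBr mulrA mulVf// mul1r mulrC; ring.
rewrite mkUE (negbTE ik) (negbTE ik1).
case: (tpermP k k1 j) => [->|->|/eqP jk /eqP jk1].
- rewrite eqxx (negbTE ik); case: ltnP => // ki; rewrite unitriE ?(negbTE ik1)//.
  by move: ik ik1 ki; rewrite -!val_eqE/= k1E; lia.
- rewrite eqxx neqk' (negbTE ik1).
  have [ik1'|k1i] := ltnP i k1; first by [].
  by rewrite unitriE ?(negbTE ik)// (leq_trans (ltnW kk1)).
rewrite (negbTE jk) (negbTE jk1); case: ltnP => // ji.
by rewrite unitriE.
Qed.

Lemma swap_low_prod (V : fieldType) (f : C -> V) (e : 'I_n -> int) z : f 1 = 1 ->
  \prod_i f (swap_low z i i) ^ e i = f z ^ e k * f (- z^-1) ^ e k1.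
Proof.
move=> f1; rewrite (bigD1 k)//= (bigD1 k1) ?neqk'//= !swap_low_diag eqxx neqk' eqxx.
rewrite big1 ?mulr1// => i /andP[ik ik1].
by rewrite swap_low_diag (negbTE ik) (negbTE ik1) f1 exp1rz.
Qed.

(** The modulus is exactly the Jacobian |z|^-4 of the change of variables. *)
Lemma modulus_swap_low z : z != 0 -> modulus (swap_low z) = abs2 z ^- 2.
Proof.
move=> z0; rewrite /modulus (swap_low_prod _ _ (abs21 R)) abs2N abs2V.
rewrite exprz_inv -expfzDr ?abs2_eq0// k1E.
by transitivity (abs2 z ^ (- 2%:Z)); [congr (_ ^ _); lia|rewrite exprnN].
Qed.

End swap_decomposition.

(** * Invariance of the integral under right translations *)

Section right_invariance.
Variables (R : realType) (n : nat).
Local Notation C := R[i].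
Local Notation N := (unitri R n).
Implicit Types (g b u : 'M[C]_n) (i j k l : 'I_n) (s : {perm 'I_n}) (Z W U : N).
Implicit Types (H : 'M[C]_n -> R) (d : 'I_n -> C).

(** Densities on the flag manifold, the quotient of GL(n, C) by its lower
    triangular subgroup, lifted to the group. *)
Definition modular_density H := (forall g, g \in unitmx -> density (fun Z : N => H (Z *m g))) /\
  (forall b g, is_trig_mx b -> b \in unitmx -> g \in unitmx -> H (b *m g) = modulus b * H g).

Definition preserving g := g \in unitmx /\ forall H, modular_density H ->
  uint (fun Z => H (Z *m g)) = uint (fun Z : N => H Z).

Lemma modular_density_shift H g : g \in unitmx -> modular_density H ->
  modular_density (fun x => H (x *m g)).
Proof.
move=> gu [dH mH]; split => [x xu|b x bt bu xu].
  under eq_fun do rewrite -mulmxA; apply: dH.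
  by rewrite unitmx_mul xu.
by rewrite -mulmxA mH// unitmx_mul xu.
Qed.

Lemma preservingM g1 g2 : preserving g1 -> preserving g2 -> preserving (g1 *m g2).
Proof.
move=> [u1 p1] [u2 p2]; split => [|H mH]; first by rewrite unitmx_mul u1.
rewrite -(p2 _ mH) -(p1 _ (modular_density_shift u2 mH)).
by apply: eq_uint => Z; rewrite mulmxA.
Qed.

Lemma preserving1 : preserving 1%:M.
Proof. by split => [|H mH]; [exact: unitmx1|apply: eq_uint => Z; rewrite mulmx1]. Qed.

Lemma modular_density_unitri H : modular_density H -> density (fun Z : N => H Z).
Proof.
by move=> [dH _]; have := dH _ (unitmx1 _ _); under eq_fun do rewrite mulmx1.
Qed.

Lemma tperm_mxE i j g : g *m perm_mx (tperm i j) = col_perm (tperm i j) g.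
Proof. by rewrite col_permE tpermV. Qed.

Lemma preserving_swap k k1 : k1 = k.+1 :> nat -> preserving (perm_mx (tperm k k1)).
Proof.
move=> k1E; split => [|H mH]; first exact: unitmx_perm.
have dH := modular_density_unitri mH.
rewrite -(uint_swap k1E dH); apply: (@uint_neq0 _ _ k k1).
- by rewrite k1E.
- exact: (mH.1 _ (unitmx_perm _ _)).
- apply: densityM; first exact: (density_comp dH (measurable_swapT _ _)).
  by apply/density_inv/densityX/density_abs2/cmeasurable_entry.
move=> Z z0; rewrite tperm_mxE swap_decomposition// mH.2 ?unitri_unitmx//.
- by rewrite modulus_swap_low// mulrC.
- exact: swap_low_trig.
- exact: swap_low_unit.
Qed.

Lemma preserving_perm s : preserving (perm_mx s).
Proof.
elim/perm_adjacent_ind: s => [|s1 s2 p1 p2|k k1 k1E].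
- by rewrite perm_mx1; exact: preserving1.
- by rewrite perm_mxM; exact: preservingM.
- exact: preserving_swap.
Qed.

Definition upper_pairs : seq ('I_n * 'I_n) :=
  [seq ij : 'I_n * 'I_n <- enum {: 'I_n * 'I_n} | (ij.1 < ij.2)%N].

Lemma mem_upper_pairs i j : ((i, j) \in upper_pairs) = (i < j)%N.
Proof. by rewrite mem_filter mem_enum andbT. Qed.

Lemma prod_upper_ratio (x : 'I_n -> R) : (forall i, x i != 0) ->
  \prod_(ij <- upper_pairs) (x ij.2 / x ij.1) =
  \prod_i x i ^ (2 * (i : nat)%:Z - n.-1%:Z).
Proof.
move=> x0; rewrite /upper_pairs big_filter big_enum_cond/=.
rewrite -(pair_big_dep predT (fun i j : 'I_n => (i < j)%N) (fun i j => x j / x i))/=.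
under eq_bigr do rewrite big_split/=.
rewrite big_split/= (exchange_big_dep predT)//= -big_split/=; apply: eq_bigr => i _.
rewrite !prodr_const.
have -> : #|[pred a : 'I_n | (a < i)%N]| = i.
  by rewrite -sum1_card (big_ord_narrow (ltnW (ltn_ord i))) sum1_card card_ord.
have -> : #|[pred a : 'I_n | (i < a)%N]| = (n - i.+1)%N.
  have := cardC [pred a : 'I_n | (a <= i)%N]; rewrite card_ord.
  have -> : #|[pred a : 'I_n | (a <= i)%N]| = i.+1.
    by rewrite -sum1_card (big_ord_narrow (ltn_ord i)) sum1_card card_ord.
  have -> : #|[predC [pred a : 'I_n | (a <= i)%N]]| = #|[pred a : 'I_n | (i < a)%N]|.
    by apply: eq_card => a; rewrite !inE -ltnNge.
  by move=> /(congr1 (subn^~ i.+1)); rewrite /= addKn.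
rewrite exprVn exprnN exprnP -expfzDr//; congr (_ ^ _).
have := ltn_ord i; lia.
Qed.

(** The diagonal matrix moves to the left as a conjugation, which scales z_ij by
    d_j / d_i; the Jacobian is the modulus. *)
Lemma preserving_diag d : (forall i, d i != 0) -> preserving (diag_mx (\row_i d i)).
Proof.
move=> d0; set D := diag_mx _.
have Dd i : D i i = d i by rewrite !mxE eqxx mulr1n.
have Dt : is_trig_mx D by exact: diag_mx_is_trig.
have Du : D \in unitmx by rewrite trig_unitmx//; apply/forallP => i; rewrite Dd.
split => // H mH; have dH := modular_density_unitri mH.
pose c (ij : 'I_n * 'I_n) Z : C := d ij.2 / d ij.1.
pose e (ij : 'I_n * 'I_n) Z : C := 0.
rewrite -(@uint_affine _ _ upper_pairs c e (fun Z : N => H Z))//.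
- apply: eq_uint => Z.
  transitivity (H (D *m (upd_affine upper_pairs c e Z : N))).
    congr H; rewrite mul_mx_diag mul_diag_mx; apply/matrixP => i j.
    rewrite [LHS]mxE [RHS]mxE mkUE mem_upper_pairs !mxE; case: ltnP => [ij|ji].
      by rewrite addr0 /c/= [RHS]mulrA (mulrC (d i)) divfK// mulrC.
    by rewrite unitriE//; case: eqP => [->|]; rewrite ?mulr1 ?mul1r ?mulr0 ?mul0r.
  rewrite mH.2 ?unitri_unitmx// mulrC; congr (_ * _).
  rewrite /modulus /c -(prod_upper_ratio (x := fun i => abs2 (D i i))).
    by apply: eq_bigr => ij _; rewrite abs2M abs2V !Dd.
  by move=> i; rewrite abs2_eq0 Dd.
- by rewrite filter_uniq ?enum_uniq.
- by move=> [i j]; rewrite mem_upper_pairs.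
- by move=> ij Z; rewrite mulf_neq0// invr_eq0.
Qed.

Lemma unitri_mul_subproof Z W : is_unitriangular (Z *m W).
Proof.
have t : is_trig_mx (Z *m W)^T by rewrite trmx_mul trigM// unitri_trig_tr.
rewrite /is_unitriangular t; apply/forallP => i.
have := trigM_diag i (unitri_trig_tr W) (unitri_trig_tr Z).
by rewrite -trmx_mul !mxE => ->; rewrite !unitriE// eqxx mulr1.
Qed.

Definition unitri_mul Z W : N := Unitri (unitri_mul_subproof Z W).

(** Right multiplication by a matrix supported in one column translates the
    entries of that column by a combination of the preceding ones. *)
Lemma preserving_column U l :
  preserving (mkU (fun i j => if j == l then U i j else 0) : N).
Proof.
split => [|H mH]; first exact: unitri_unitmx.
have dH := modular_density_unitri mH.
set V : N := mkU _.
pose s := [seq (i, l) | i <- [seq i : 'I_n <- enum 'I_n | (i < l)%N]].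
have ms (a b : 'I_n) : ((a, b) \in s) = (b == l) && (a < l)%N.
  apply/mapP/andP => [[i0]|[/eqP -> al]].
    by rewrite mem_filter => /andP[il _] [-> ->].
  by exists a => //; rewrite mem_filter al mem_enum.
pose c (ij : 'I_n * 'I_n) Z : C := 1.
pose e (ij : 'I_n * 'I_n) Z : C := \sum_(m < n | (m < l)%N) Z ij.1 m * U m l.
rewrite -(@uint_affine _ _ s c e (fun Z : N => H Z))//.
- apply: eq_uint => Z; rewrite [X in _ = _ * X]big1 ?mulr1; last by move=> ij _; rewrite abs21.
  congr H; rewrite -[LHS]/(val (unitri_mul Z V)); congr val; apply: unitriP => i j ij.
  rewrite [RHS]mkUE ij ms [LHS]mxE; case: (eqVneq j l) ij => [->|jl] ij.
    rewrite ij/= mul1r (bigD1 l)//= [V l l]unitriE// eqxx mulr1; congr (_ + _).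
    rewrite (bigID (fun m : 'I_n => (m < l)%N))/= [X in _ + X]big1 ?addr0; last first.
      move=> m /andP[ml]; rewrite -leqNgt => lm; rewrite [V m l]unitriE//.
      by rewrite (negbTE ml) mulr0.
    apply: eq_big => [m|m ml].
      by case: (ltnP m l) => ml; rewrite ?andbF ?andbT// -val_eqE/= ltn_eqF.
    by rewrite [V m l]mkUE; move: ml => /andP[_ ->]; rewrite eqxx.
  rewrite /= (bigD1 j)//= [V j j]unitriE// eqxx mulr1 big1 ?addr0// => m mj.
  by rewrite [V m j]mkUE (negbTE jl) (negbTE mj); case: ifP => _; rewrite mulr0.
- by rewrite map_inj_uniq ?filter_uniq -?enumT ?enum_uniq// => x y [].
- by move=> [a b]; rewrite ms => /andP[/eqP -> ].
- move=> ij; apply: cmeasurable_sum => m; apply: cmeasurableM.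
    exact: cmeasurable_entry.
  exact: cmeasurable_cst.
- by move=> ij Z; rewrite oner_eq0.
- move=> ij Z W ZW; apply: eq_bigr => m ml; congr (_ * _).
  have [im|mi] := ltnP ij.1 m; last by rewrite !unitriE.
  by apply: ZW => //; rewrite ms -val_eqE/= ltn_eqF.
Qed.

(** Columns are split off from left to right. *)
Lemma preserving_unitri U : preserving U.
Proof.
pose T (l : nat) : N := mkU (fun i j => if (l <= j)%N then U i j else 0).
have step (l : nat) (ln : (l < n)%N) : (T l : 'M[C]_n) = T l.+1 *m
    (mkU (fun i j => if j == Ordinal ln then U i j else 0) : N).
  set V : N := mkU _; rewrite -[RHS]/(val (unitri_mul (T l.+1) V)); congr val.
  apply: unitriP => i j ij; rewrite [LHS]mkUE ij [RHS]mxE.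
  have [jl|jl] := eqVneq (j : nat) l.
    have {}jl : j = Ordinal ln by apply/val_inj.
    have iE (m : 'I_n) : (m <= j)%N -> T l.+1 i m = (i == m)%:R.
      move=> mj; rewrite mkUE; case: ltnP => // im; rewrite ltnNge.
      by move: mj; rewrite jl /= => ->/=; rewrite -val_eqE ltn_eqF.
    rewrite (bigD1 i)//= iE ?(ltnW ij)// eqxx mul1r [V i j]mkUE ij jl/= leqnn eqxx.
    rewrite big1 ?addr0// => m mi; have [mj|jm] := leqP m j.
      by rewrite iE// eq_sym (negbTE mi) mul0r.
    by rewrite [V m _]unitriE -?jl ?(ltnW jm)// -val_eqE gtn_eqF ?mulr0.
  rewrite (bigD1 j)//= [V j j]unitriE// eqxx mulr1 big1 ?addr0 => [|m mj].
    rewrite [T l.+1 i j]mkUE ij; congr (if _ then _ else _).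
    by rewrite leq_eqVlt eq_sym (negbTE jl).
  rewrite [V m j]mkUE (negbTE mj) -val_eqE/= (negbTE jl).
  by case: ifP => _; rewrite mulr0.
have Tn : (T n : 'M[C]_n) = 1%:M.
  apply/matrixP => i j; rewrite [LHS]mkUE mxE; case: ltnP => // ij.
  by rewrite leqNgt ltn_ord -val_eqE/= ltn_eqF.
have T0 : T 0%N = U by apply: unitriP => i j ij; rewrite [LHS]mkUE ij.
rewrite -T0; have : (0 <= n)%N by []; move: 0%N => l.
elim: (n - l)%N {-2}l (erefl (n - l)%N) => [|m IH] {}l nl ln.
  have -> : l = n by lia.
  by rewrite Tn; exact: preserving1.
have ln' : (l < n)%N by lia.
rewrite (step _ ln'); apply: preservingM; last exact: preserving_column.
by apply: IH; lia.
Qed.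

Lemma preserving_upper g : is_trig_mx g^T -> g \in unitmx -> preserving g.
Proof.
move=> gt gu; have g0 i : g i i != 0.
  by have := trig_unit_neq0 i gt; rewrite mxE; apply; rewrite unitmx_tr.
pose U : N := mkU (fun i j => (g i i)^-1 * g i j).
have -> : g = diag_mx (\row_i g i i) *m U.
  rewrite mul_diag_mx; apply/matrixP => i j; rewrite [RHS]mxE mkUE !mxE.
  case: ltnP => [_|]; first by rewrite mulrA divff// mul1r.
  rewrite leq_eqVlt => /predU1P[/val_inj ->|ji]; first by rewrite eqxx mulr1.
  rewrite -val_eqE gtn_eqF// mulr0; move/is_trig_mxP : gt => /(_ _ _ ji).
  by rewrite mxE.
by apply: preservingM; [exact: preserving_diag|exact: preserving_unitri].
Qed.

(** The longest permutation conjugates lower triangular matrices to upper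
    triangular ones. *)
Lemma preserving_lower g : is_trig_mx g -> g \in unitmx -> preserving g.
Proof.
move=> gt gu; pose w : {perm 'I_n} := perm (@rev_ord_inj n).
have ww : (w * w = 1)%g by apply/permP => i; rewrite !permE/= !permE rev_ordK.
have wv : (w^-1 = w)%g by rewrite -[RHS]mul1g -(mulVg w) -mulgA ww mulg1.
pose h := perm_mx w *m g *m perm_mx w.
have -> : g = perm_mx w *m h *m perm_mx w.
  by rewrite /h !mulmxA -perm_mxM ww perm_mx1 mul1mx -mulmxA -perm_mxM ww perm_mx1 mulmx1.
apply: preservingM; last exact: preserving_perm.
apply: preservingM; first exact: preserving_perm.
apply: preserving_upper; last by rewrite !unitmx_mul !unitmx_perm gu.
apply/is_trig_mxP => i j ij; rewrite /h -row_permE -{2}wv -col_permE !mxE !permE.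
by move/is_trig_mxP : gt; apply; rewrite /=; have := ltn_ord j; lia.
Qed.

End right_invariance.

(** Functions transforming by the modulus are the densities on the flag manifold,
    and GL(n, C) acts on it by diffeomorphisms. The group is generated by adjacent
    transpositions, diagonal matrices and columns of unitriangular matrices, each
    of which acts on the big cell by explicit changes of variables; the LUP
    decomposition expresses every other element through them. *)
Lemma preserving_GL (R : realType) (n : nat) (g : 'M[R[i]]_n) :
  g \in unitmx -> preserving g.
Proof.
case: n g => [|m] g gu.
  have -> : g = 1%:M by apply/matrixP => -[].
  exact: preserving1.
have := cormen_lup_correct g^T; have := cormen_lup_perm g^T.
have := @cormen_lup_lower _ _ g^T; have := @cormen_lup_upper _ _ g^T.
have := cormen_lup_detL g^T.
case: cormen_lup => [[P L] U] /= detL uU lL /is_perm_mxP[s ->] e.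
have Lu : L \in unitmx by rewrite unitmxE detL unitr1.
have Uu : U \in unitmx.
  have : perm_mx s *m g^T \in unitmx by rewrite unitmx_mul unitmx_perm unitmx_tr.
  by rewrite -[_ *m _]/(perm_mx s * g^T) e unitmx_mul => /andP[].
have -> : g = U^T *m L^T *m perm_mx s.
  rewrite -trmx_mul -[L *m U]/(L * U) -e trmx_mul trmxK tr_perm_mx -mulmxA.
  by rewrite -perm_mxM mulVg perm_mx1 mulmx1.
apply: preservingM; last exact: preserving_perm.
apply: preservingM.
  apply: preserving_lower; last by rewrite unitmx_tr.
  by apply/is_trig_mxP => i j ij; rewrite mxE uU.
apply: preserving_upper; last by rewrite unitmx_tr.
apply/is_trig_mxP => i j ij; rewrite trmxK lL ?(ltnW ij)//.
by rewrite -val_eqE ltn_eqF.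
Qed.

(** * Polynomial functions *)

Section polynomial_functions.
Import -(notations) mpoly.

(** Measurability, local bounds and divisibility of polynomials are proved by
    this induction. *)
Lemma meval_closed (K : comNzRingType) (m : nat) (X : Type) (v : X -> 'I_m -> K)
    (Q : (X -> K) -> Prop) :
  (forall c, Q (fun=> c)) ->
  (forall f g, Q f -> Q g -> Q (fun x => f x + g x)) ->
  (forall f g, Q f -> Q g -> Q (fun x => f x * g x)) ->
  (forall k, Q (fun x => v x k)) ->
  forall P : mpoly.mpoly m K, Q (fun x => mpoly.meval (v x) P).
Proof.
move=> Qc QD QM Qv P.
have QX (f : X -> K) e : Q f -> Q (fun x => f x ^+ e).
  move=> Qf; elim: e => [|e IHe]; first by under eq_fun do rewrite expr0.
  by under eq_fun do rewrite exprS; exact: QM.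
under eq_fun do rewrite mpoly.mevalE.
elim: (mpoly.msupp P) => [|s r IH].
  by under eq_fun do rewrite big_nil.
under eq_fun do rewrite big_cons; apply: (QD _ _) => //; apply: (QM _ _) => //.
elim: (index_enum _) => [|i l IHl]; first by under eq_fun do rewrite big_nil.
by under eq_fun do rewrite big_cons; apply: (QM _ _) => //; exact: QX.
Qed.

Variables (K : comNzRingType) (m : nat) (X : Type) (v : X -> 'I_m -> K).

Definition is_mpoly (f : X -> K) :=
  exists P : mpoly.mpoly m K, forall x, f x = mpoly.meval (v x) P.

Lemma is_mpoly_cst c : is_mpoly (fun=> c).
Proof. by exists (mpoly.mpolyC _ c) => x; rewrite mpoly.mevalC. Qed.

Lemma is_mpoly_var k : is_mpoly (fun x => v x k).
Proof. by exists (mpoly.mpolyX _ (mpoly.mnm1 k)) => x; rewrite mpoly.mevalXU. Qed.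

Lemma is_mpolyD f g : is_mpoly f -> is_mpoly g -> is_mpoly (fun x => f x + g x).
Proof. by move=> [P PE] [Q QE]; exists (P + Q) => x; rewrite mpoly.mevalD PE QE. Qed.

Lemma is_mpolyM f g : is_mpoly f -> is_mpoly g -> is_mpoly (fun x => f x * g x).
Proof. by move=> [P PE] [Q QE]; exists (P * Q) => x; rewrite mpoly.mevalM PE QE. Qed.

Lemma is_mpolyX f k : is_mpoly f -> is_mpoly (fun x => f x ^+ k).
Proof.
move=> pf; elim: k => [|k IH]; first by under eq_fun do rewrite expr0; exact: is_mpoly_cst.
by under eq_fun do rewrite exprS; exact: is_mpolyM.
Qed.

Lemma is_mpoly_sum I (r : seq I) (P : pred I) (F : I -> X -> K) :
  (forall i, P i -> is_mpoly (F i)) -> is_mpoly (fun x => \sum_(i <- r | P i) F i x).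
Proof.
move=> pF; elim: r => [|i r IH].
  by under eq_fun do rewrite big_nil; exact: is_mpoly_cst.
under eq_fun do rewrite big_cons; case Pi : (P i) => //.
by apply: is_mpolyD => //; exact: pF.
Qed.

Lemma is_mpoly_prod I (r : seq I) (P : pred I) (F : I -> X -> K) :
  (forall i, P i -> is_mpoly (F i)) -> is_mpoly (fun x => \prod_(i <- r | P i) F i x).
Proof.
move=> pF; elim: r => [|i r IH].
  by under eq_fun do rewrite big_nil; exact: is_mpoly_cst.
under eq_fun do rewrite big_cons; case Pi : (P i) => //.
by apply: is_mpolyM => //; exact: pF.
Qed.

Lemma is_mpoly_det d (A : X -> 'M[K]_d) :
  (forall i j, is_mpoly (fun x => A x i j)) -> is_mpoly (fun x => \det (A x)).
Proof.
move=> pA; rewrite /determinant; apply: is_mpoly_sum => s _.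
by apply: is_mpolyM; [exact: is_mpoly_cst|exact: is_mpoly_prod].
Qed.

End polynomial_functions.

Section GL_polynomials.
Variables (R : realType) (n : nat).
Local Notation C := R[i].
Local Notation N := (unitri R n).
Implicit Types (g b u : 'M[C]_n) (i j : 'I_n) (s : {perm 'I_n}) (Z : N).
Implicit Types (p : n.-tuple int) (F : 'M[C]_n -> C) (f : N -> C).

Local Notation GL := {x : 'M[C]_n | x \in unitmx}.

Definition GLvar (g : GL) (k : 'I_(n * n + 1)) : C :=
  row_mx (mxvec (val g)) ((\det (val g))^-1)%:M ord0 k.

Lemma GL_polynomialP F :
  GL_polynomial F <-> is_mpoly GLvar (fun g : GL => F (val g)).
Proof.
split=> [[P PE]|[P PE]]; exists P => g; first exact: PE (valP g).
by move=> gu; rewrite (PE (exist _ g gu)).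
Qed.

Lemma GLvar_entry i j (g : GL) : GLvar g (lshift 1 (mxvec_index i j)) = val g i j.
Proof. by rewrite /GLvar row_mxEl mxvecE. Qed.

Lemma GLvar_det (g : GL) : GLvar g (rshift (n * n) ord0) = (\det (val g))^-1.
Proof. by rewrite /GLvar row_mxEr mxE. Qed.

Lemma GL_polynomial_cst c : GL_polynomial (fun _ : 'M[C]_n => c).
Proof. by apply/GL_polynomialP; exact: is_mpoly_cst. Qed.

Lemma GL_polynomialD F G : GL_polynomial F -> GL_polynomial G ->
  GL_polynomial (fun g : 'M[C]_n => F g + G g).
Proof. by move=> /GL_polynomialP pF /GL_polynomialP pG; apply/GL_polynomialP; exact: is_mpolyD. Qed.

Lemma GL_polynomialM F G : GL_polynomial F -> GL_polynomial G ->
  GL_polynomial (fun g : 'M[C]_n => F g * G g).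
Proof. by move=> /GL_polynomialP pF /GL_polynomialP pG; apply/GL_polynomialP; exact: is_mpolyM. Qed.

Lemma GL_polynomialX F k : GL_polynomial F -> GL_polynomial (fun g : 'M[C]_n => F g ^+ k).
Proof. by move=> /GL_polynomialP pF; apply/GL_polynomialP; exact: is_mpolyX. Qed.

Lemma GL_polynomial_entry i j : GL_polynomial (fun g : 'M[C]_n => g i j).
Proof.
apply/GL_polynomialP.
rewrite (_ : (fun g : GL => _) = fun x => GLvar x (lshift 1 (mxvec_index i j))).
  exact: is_mpoly_var.
by apply/funext => g; rewrite GLvar_entry.
Qed.

Lemma GL_polynomial_Vdet : GL_polynomial (fun g : 'M[C]_n => (\det g)^-1).
Proof.
apply/GL_polynomialP.
rewrite (_ : (fun g : GL => _) = fun x => GLvar x (rshift (n * n) ord0)).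
  exact: is_mpoly_var.
by apply/funext => g; rewrite GLvar_det.
Qed.

Lemma GL_polynomial_prod I (r : seq I) (P : pred I) (G : I -> 'M[C]_n -> C) :
  (forall k, GL_polynomial (G k)) -> GL_polynomial (fun g : 'M[C]_n => \prod_(k <- r | P k) G k g).
Proof.
move=> pG; apply/GL_polynomialP; apply: is_mpoly_prod => k _.
by apply/GL_polynomialP; exact: pG.
Qed.

Lemma GL_polynomial_sum I (r : seq I) (P : pred I) (G : I -> 'M[C]_n -> C) :
  (forall k, GL_polynomial (G k)) -> GL_polynomial (fun g : 'M[C]_n => \sum_(k <- r | P k) G k g).
Proof.
move=> pG; apply/GL_polynomialP; apply: is_mpoly_sum => k _.
by apply/GL_polynomialP; exact: pG.
Qed.

Lemma GL_polynomial_det d (A : 'M[C]_n -> 'M[C]_d) :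
  (forall a c, GL_polynomial (fun g : 'M[C]_n => A g a c)) -> GL_polynomial (fun g : 'M[C]_n => \det (A g)).
Proof.
move=> pA; apply/GL_polynomialP; apply: is_mpoly_det => a c.
exact: (iffLR (GL_polynomialP (fun g => A g a c)) (pA a c)).
Qed.

Lemma GL_polynomial_ind (Q : (GL -> C) -> Prop) :
  (forall c, Q (fun=> c)) ->
  (forall v w, Q v -> Q w -> Q (fun x => v x + w x)) ->
  (forall v w, Q v -> Q w -> Q (fun x => v x * w x)) ->
  (forall i j, Q (fun x => val x i j)) -> Q (fun x => (\det (val x))^-1) ->
  forall F, GL_polynomial F -> Q (fun x => F (val x)).
Proof.
move=> Qc QD QM Qe Qd F /GL_polynomialP[P PE].
rewrite (_ : (fun x => _) = fun x => mpoly.meval (GLvar x) P); last exact/funext.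
apply: meval_closed => // k; case: (splitP k) => [a ka|a ka].
  have -> : k = lshift 1 a by exact/val_inj.
  case/mxvec_indexP: a {ka} => i j.
  by rewrite (_ : (fun x : GL => _) = fun x => val x i j)//; apply/funext => x; rewrite GLvar_entry.
have -> : k = rshift (n * n) ord0 by apply/val_inj; rewrite /= ka ord1.
by rewrite (_ : (fun x : GL => _) = fun x => (\det (val x))^-1)//; apply/funext => x; rewrite GLvar_det.
Qed.

Lemma Pol_ind (Q : (N -> C) -> Prop) :
  (forall c, Q (fun=> c)) ->
  (forall v w, Q v -> Q w -> Q (fun x => v x + w x)) ->
  (forall v w, Q v -> Q w -> Q (fun x => v x * w x)) ->
  (forall i j, (i < j)%N -> Q (fun Z => Z i j)) ->
  forall f, Pol R n f -> Q f.
Proof.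
move=> Qc QD QM Qe f [P PE].
rewrite (_ : f = fun Z => mpoly.meval (uentry Z) P); last exact/funext.
apply: meval_closed => // k; apply: Qe; exact: (valP (enum_val k)).
Qed.

Lemma PolE f : Pol R n f <-> is_mpoly (fun Z => uentry Z) f.
Proof. by []. Qed.

Lemma Pol_cst c : Pol R n (fun=> c). Proof. by apply/PolE/is_mpoly_cst. Qed.

Lemma PolD f f' : Pol R n f -> Pol R n f' -> Pol R n (fun Z => f Z + f' Z).
Proof. by move=> pf pg; apply/PolE/is_mpolyD. Qed.

Lemma PolM f f' : Pol R n f -> Pol R n f' -> Pol R n (fun Z => f Z * f' Z).
Proof. by move=> pf pg; apply/PolE/is_mpolyM. Qed.

Lemma PolX f k : Pol R n f -> Pol R n (fun Z => f Z ^+ k).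
Proof. by move=> pf; apply/PolE/is_mpolyX. Qed.

Lemma Pol_entry i j : Pol R n (fun Z => Z i j).
Proof.
have [ij|ji] := ltnP i j; last first.
  by rewrite (_ : (fun Z => _) = fun=> (i == j)%:R);
     [exact: Pol_cst|apply/funext => Z; rewrite unitriE].
rewrite (_ : (fun Z : N => _) =
    fun Z => uentry Z (enum_rank (Sub (i, j) ij : upair n))).
  by apply/PolE; exact: is_mpoly_var.
by apply/funext => Z; rewrite /uentry enum_rankK.
Qed.

Lemma cmeasurable_Pol f : Pol R n f -> cmeasurable f.
Proof.
move: f; apply: Pol_ind => [c|v w|v w|i j _].
- exact: cmeasurable_cst.
- exact: cmeasurableD.
- exact: cmeasurableM.
- exact: cmeasurable_entry.
Qed.

Lemma cmeasurable_GL_polynomial F g : GL_polynomial F -> g \in unitmx ->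
  cmeasurable (fun Z => F (Z *m g)).
Proof.
move=> pF gu; pose h Z : GL := exist _ (Z *m g)
  (eq_ind_r is_true (introT andP (conj (unitri_unitmx Z) gu)) (unitmx_mul _ _)).
suff : cmeasurable ((fun x : GL => F (val x)) \o h) by [].
have mentry i j : cmeasurable (fun Z => (Z *m g) i j).
  rewrite (_ : (fun Z : N => _) = fun Z => \sum_k Z i k * g k j); last first.
    by apply/funext => Z; rewrite mxE.
  apply: cmeasurable_sum => k; apply: cmeasurableM; last exact: cmeasurable_cst.
  exact: cmeasurable_entry.
apply: (@GL_polynomial_ind (fun v => cmeasurable (v \o h)) _ _ _ _ _ F pF).
- by move=> c; exact: cmeasurable_cst.
- by move=> v w mv mw; exact: cmeasurableD.
- by move=> v w mv mw; exact: cmeasurableM.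
- exact: mentry.
- by apply: cmeasurable_inv; exact: cmeasurable_det.
Qed.

End GL_polynomials.

(** * Unitary invariance of the inner product *)

Section unitary_invariance.
Variables (R : realType) (n : nat) (p : n.-tuple int).
Local Notation C := R[i].
Local Notation N := (unitri R n).
Implicit Types (g b u : 'M[C]_n) (Z : N) (h : N -> R).
Implicit Types (f : N -> C) (phi : 'M[C]_n -> R) (F : 'M[C]_n -> C).

Lemma integral_mu_p h : density h ->
  (\int[mu_p R p]_Z (h Z)%:E)%E = uint (fun Z => h Z * weight p Z).
Proof.
move=> [mh h0].
have mw := @measurable_weight R n p.
have w0 := @weight_ge0 R n p.
transitivity (\int[wpush (@unitri_lebesgue R n) (@measurable_id _ _ setT) w0 mw]_Z (h Z)%:E)%E.
  by apply: eq_measure_integral => A mA _.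
by rewrite ge0_integral_wpush//; exact/measurable_EFinP.
Qed.

Lemma density_weight h : density h -> density (fun Z => h Z * weight p Z).
Proof.
move=> dh; apply: densityM => //; split; first exact: measurable_weight.
exact: weight_ge0.
Qed.

(** Functions transforming like the squared modulus of an element of the
    space; integrated against the weight, they become densities. *)
Definition norm_equivariant phi :=
  (forall g, g \in unitmx -> measurable_fun setT (fun Z : N => phi (Z *m g))) /\
  (forall b g, is_trig_mx b -> b \in unitmx -> g \in unitmx ->
    phi (b *m g) = abs2 (tri_char p b) * phi g).

Lemma modular_gram_weight phi : norm_equivariant phi -> (forall g, 0 <= phi g) ->
  modular_density (fun g => phi g * gram_weight (dual_exponents p) g).
Proof.
move=> [mphi phiM] phi0; split=> [g gu|b g bt bu gu].
  apply: densityM; first by split => //; exact: mphi.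
  split; last by move=> Z; exact: gram_weight_ge0.
  apply: measurable_prod => j _; apply: measurable_exprz.
    by move=> Z; exact: gram_ge0.
  apply: (proj1 (cmeasurable_det _)) => k l.
  have mentry a c : cmeasurable (fun Z : N => (Z *m g) a c).
    apply: (@cmeasurable_GL_polynomial _ _ (fun x => x a c)) => //.
    exact: GL_polynomial_entry.
  rewrite (_ : (fun Z : N => _) =
      (fun Z : N => \sum_m corner j (Z *m g) k m * (corner j (Z *m g) l m)^*)).
    apply: cmeasurable_sum => m; apply: cmeasurableM.
      by under eq_fun do rewrite mxE; exact: mentry.
    by apply: cmeasurable_conj; under eq_fun do rewrite mxE; exact: mentry.
  by apply/funext => Z; rewrite mxE; apply: eq_bigr => m _; rewrite !mxE.
by rewrite phiM// gram_weightM// (modulusE p bt bu); ring.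
Qed.

Lemma uint_norm_equivariant phi g : norm_equivariant phi -> (forall x, 0 <= phi x) ->
  g \in unitmx ->
  uint (fun Z => phi (Z *m g) * gram_weight (dual_exponents p) (Z *m g)) =
  uint (fun Z : N => phi Z * weight p Z).
Proof.
move=> ephi phi0 gu; rewrite ((preserving_GL gu).2 _ (modular_gram_weight ephi phi0)).
by apply: eq_uint => Z; rewrite gram_weight_unitri.
Qed.

Lemma unitary_unitmx u : u \is unitarymx -> u \in unitmx.
Proof. by move=> /unitarymxP /mulmx1_unit[]. Qed.

(** The Gram determinants are invariant under right multiplication by a unitary
    matrix, hence so is the weight. *)
Lemma uint_unitary phi u : norm_equivariant phi -> (forall x, 0 <= phi x) ->
  u \is unitarymx ->
  uint (fun Z => phi (Z *m u) * weight p Z) = uint (fun Z : N => phi Z * weight p Z).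
Proof.
move=> ephi phi0 uu; rewrite -(uint_norm_equivariant ephi phi0 (unitary_unitmx uu)).
by apply: eq_uint => Z; rewrite gram_weight_unitary// gram_weight_unitri.
Qed.

(** The real-valued integral splits into positive and negative parts, which
    transform in the same way. *)
Lemma Rintegral_unitary phi u : norm_equivariant phi -> u \is unitarymx ->
  \int[mu_p R p]_Z phi (Z *m u) = \int[mu_p R p]_Z phi Z.
Proof.
move=> [mphi phiM] uu; have u1 := unitary_unitmx uu.
have pos (psi : 'M[C]_n -> R) : norm_equivariant psi ->
    (\int[mu_p R p]_Z (Num.max (psi (Z *m u)) 0)%:E =
     \int[mu_p R p]_Z (Num.max (psi Z) 0)%:E)%E.
  move=> [mpsi psiM].
  have e : norm_equivariant (fun x => Num.max (psi x) 0).
    split => [g gu|b g bt bu gu]; first by apply: measurable_maxr => //; exact: mpsi.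
    by rewrite psiM// -[X in Num.max _ X](mulr0 (abs2 (tri_char p b))) maxr_pMr ?abs2_ge0.
  have max0 x : 0 <= Num.max (psi x) 0 by rewrite le_max lexx orbT.
  rewrite !integral_mu_p ?(uint_unitary e)//.
    split => [|Z]//; have := e.1 _ (unitmx1 _ _).
    by under eq_fun do rewrite mulmx1.
  by split => [|Z]//; exact: e.1.
have ephi' : norm_equivariant (fun x => - phi x).
  split => [g gu|b g bt bu gu]; first by apply: measurableT_comp => //; exact: mphi.
  by rewrite phiM// mulrN.
rewrite /Rintegral; congr fine; rewrite [LHS]integralE [RHS]integralE; congr (_ - _)%E.
  transitivity (\int[mu_p R p]_Z (Num.max (phi (Z *m u)) 0)%:E)%E.
    by apply: eq_integral => Z _; rewrite funeposE EFin_max.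
  rewrite pos//; by apply: eq_integral => Z _; rewrite funeposE EFin_max.
transitivity (\int[mu_p R p]_Z (Num.max (- phi (Z *m u)) 0)%:E)%E.
  by apply: eq_integral => Z _; rewrite funenegE EFin_max.
by rewrite (pos _ ephi'); apply: eq_integral => Z _; rewrite funenegE EFin_max.
Qed.

Lemma rho_extension f : Vspace R p f ->
  exists F, [/\ GL_equivariant p F, forall Z, F Z = f Z &
    forall g, rho p g f = fun Z => F (Z *m g)].
Proof.
move=> [_ Vf]; rewrite /rho /GL_ext; case: pselect => // h.
by case: cid2 => F eF Ff /=; exists F.
Qed.

Lemma Re_realM (a : R) (z : C) : complex.Re (a%:C%C * z) = a * complex.Re z.
Proof. by case: z => x y /=; rewrite mul0r subr0. Qed.

Lemma Im_realM (a : R) (z : C) : complex.Im (a%:C%C * z) = a * complex.Im z.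
Proof. by case: z => x y /=; rewrite mul0r addr0. Qed.

Lemma L2_inner_unitary u f1 f2 : u \is unitarymx -> Vspace R p f1 -> Vspace R p f2 ->
  L2_inner (mu_p R p) (rho p u f1) (rho p u f2) = L2_inner (mu_p R p) f1 f2.
Proof.
move=> uu /rho_extension[F1 [[pF1 eF1] Ff1 ->]] /rho_extension[F2 [[pF2 eF2] Ff2 ->]].
have m12 g : g \in unitmx -> cmeasurable (fun Z => F1 (Z *m g) * (F2 (Z *m g))^*).
  move=> gu; apply: cmeasurableM; last apply: cmeasurable_conj;
  exact: cmeasurable_GL_polynomial.
have e12 b g : is_trig_mx b -> b \in unitmx -> g \in unitmx ->
    F1 (b *m g) * (F2 (b *m g))^* =
    (abs2 (tri_char p b))%:C%C * (F1 g * (F2 g)^*).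
  by move=> bt bu gu; rewrite eF1// eF2// rmorphM/= -mul_conjCE; ring.
rewrite /L2_inner; congr Complex.
  rewrite (Rintegral_unitary (phi := fun x => complex.Re (F1 x * (F2 x)^*)))//.
    by apply: eq_Rintegral => Z _; rewrite Ff1 Ff2.
  split=> [g gu|b g bt bu gu]; first exact: (m12 g gu).1.
  by rewrite e12// Re_realM.
rewrite (Rintegral_unitary (phi := fun x => complex.Im (F1 x * (F2 x)^*)))//.
  by apply: eq_Rintegral => Z _; rewrite Ff1 Ff2.
split=> [g gu|b g bt bu gu]; first exact: (m12 g gu).2.
by rewrite e12// Im_realM.
Qed.

End unitary_invariance.

(** * Bounds on the weight and boxes *)

Section weight_bounds.
Variables (R : realType) (n : nat) (p : n.-tuple int).
Hypothesis p_signature : sorted >=%R p.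
Local Notation C := R[i].
Local Notation N := (unitri R n).
Implicit Types (i j : 'I_n) (Z : N).

(** X X^* is diagonalized by a unitary matrix with eigenvalues e_a >= 0, and the
    determinant is the product of the 1 + e_a. *)
Lemma det_1_gram_ge1 m k (X : 'M[C]_(m, k)) : 1 <= \det (1%:M + X *m X^t*).
Proof.
set G := X *m X^t*.
have G_herm : G^t* = G by rewrite /G trmx_mul map_mxM trmxCK.
have /orthomx_spectralP GE : G \is normalmx by apply/normalmxP; rewrite G_herm.
have Pu := spectral_unitarymx G.
set P := spectralmx G in GE Pu.
set e := spectral_diag G in GE.
have De : diag_mx e = (P *m X) *m (P *m X)^t*.
  rewrite trmx_mul map_mxM mulmxA -(mulmxA P) -/G GE !mulmxA.
  rewrite mulmxV ?spectral_unit// mul1mx -mulmxA.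
  by move/unitarymxP : Pu => ->; rewrite mulmx1.
have e_ge0 a : 0 <= e 0 a.
  have -> : e 0 a = diag_mx e a a by rewrite mxE eqxx.
  rewrite De mxE sumr_ge0// => l _; rewrite [X in _ * X]mxE [X in _ * X^*]mxE.
  by rewrite mul_conjC_ge0.
have -> : 1%:M + G = invmx P *m (1%:M + diag_mx e) *m P.
  by rewrite mulmxDr mulmxDl mulmx1 mulVmx ?spectral_unit// -GE.
rewrite !det_mulmx mulrAC -det_mulmx mulVmx ?spectral_unit// det1 mul1r.
rewrite -diag_const_mx -raddfD/= det_diag.
elim/big_rec: _ => // a x _ x1; apply: (le_trans x1).
by rewrite ler_peMl ?(le_trans ler01 x1)// !mxE lerDl.
Qed.

(** Splitting the first j + 1 rows of Z into their leading block L, of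
    determinant one, and the remaining columns B, the Gram matrix is
    L L^* + B B^*, and its determinant is that of 1 + X X^* with X = L^-1 B. *)
Lemma gram_ge1 j Z : 1 <= gram j Z.
Proof.
pose L := lead_mx j Z.
pose B : 'M[C]_(j.+1, n) := \matrix_(a, c) if (c <= j)%N then 0 else corner j Z a c.
have dL : \det L = 1 by exact: minor_unitri.
have Lu : L \in unitmx by rewrite unitmxE dL unitr1.
have GE : corner j Z *m (corner j Z)^t* = L *m L^t* + B *m B^t*.
  apply/matrixP => a c; rewrite [LHS]mxE (bigID (fun k : 'I_n => (k < j.+1)%N))/=.
  rewrite [RHS]mxE; congr (_ + _).
    by rewrite (big_ord_narrow (ltn_ord j)) mxE; apply: eq_bigr => k _; rewrite !mxE.
  rewrite mxE [RHS](bigID (fun k : 'I_n => (k < j.+1)%N))/= [X in _ = X + _]big1.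
    by rewrite add0r; apply: eq_bigr => k; rewrite ltnS => /negbTE kj; rewrite !mxE kj.
  by move=> k; rewrite ltnS => kj; rewrite mxE kj mul0r.
pose X := invmx L *m B.
have : 1 <= \det (1%:M + X *m X^t*) by exact: det_1_gram_ge1.
have -> : \det (1%:M + X *m X^t*) = \det (corner j Z *m (corner j Z)^t*).
  have -> : corner j Z *m (corner j Z)^t* = L *m (1%:M + X *m X^t*) *m L^t*.
    rewrite GE mulmxDr mulmx1 mulmxDl; congr (_ + _).
    rewrite mulmxA /X mulmxA mulmxV// mul1mx trmx_mul map_mxM -!mulmxA.
    by rewrite -[X in _ *m (_ *m X)]map_mxM -trmx_mul mulmxV// trmx1 map_mx1 mulmx1.
  rewrite (det_mulmx (L *m _)) (det_mulmx L) det_conj dL.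
  by rewrite conjC1 mulr1 mul1r.
by rewrite lecE => /andP[].
Qed.

Lemma signature_ge j : (j.+1 < n)%N -> p`_j.+1 <= p`_j.
Proof. by move=> jn; move/(sortedP 0) : p_signature; apply; rewrite size_tuple. Qed.

Lemma weightE Z : weight p Z =
  \prod_(j < n | (j.+1 < n)%N) (gram j Z ^+ (absz (p`_j - p`_j.+1)%R + 2))^-1.
Proof.
apply: eq_bigr => j jn; rewrite exprnN; congr (_ ^ _).
by rewrite PoszD gez0_abs ?subr_ge0 ?signature_ge//; move: (p`_j) (p`_j.+1) => x y; lia.
Qed.

Lemma weight_gt0 Z : 0 < weight p Z.
Proof.
rewrite weightE prodr_gt0// => j _; rewrite invr_gt0 exprn_gt0//.
by rewrite (lt_le_trans _ (gram_ge1 _ _)).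
Qed.

Lemma weight_le1 Z : weight p Z <= 1.
Proof.
rewrite weightE; apply: prodr_ile1 => j _; rewrite invr_ge0 exprn_ge0 ?gram_ge0//=.
have g1 := gram_ge1 j Z.
by rewrite invf_le1 ?exprn_ege1// exprn_gt0// (lt_le_trans _ g1).
Qed.

End weight_bounds.

Section boxes.
Variables (R : realType) (n : nat).
Local Notation C := R[i].
Local Notation N := (unitri R n).
Implicit Types (i j : 'I_n) (Z : N) (c : C) (e : R).

Definition square c e : set C := [set z |
  `|complex.Re z - complex.Re c| <= e /\ `|complex.Im z - complex.Im c| <= e].

Lemma squareE c e : @cplx R @^-1` square c e =
  [set` `[(complex.Re c - e)%R, (complex.Re c + e)%R]] `*`
  [set` `[(complex.Im c - e)%R, (complex.Im c + e)%R]].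
Proof.
by apply/seteqP; split => -[x y] /=; rewrite /square/= !ler_distl !in_itv/=.
Qed.

Lemma measurable_square c e : measurable (@cplx R @^-1` square c e : set (plane R)).
Proof. by rewrite squareE; exact: measurableX. Qed.

Lemma plane_lebesgue_square c e : 0 < e ->
  @plane_lebesgue R (@cplx R @^-1` square c e) = (2 * e * (2 * e))%:E.
Proof.
move=> e0; rewrite squareE /plane_lebesgue product_measure1E//.
have lebE (x : R) : @lebesgue_measure R [set` `[(x - e)%R, (x + e)%R]] = (2 * e)%:E.
  rewrite lebesgue_measure_itv/= lte_fin ltrD2l gtrN//.
  by rewrite -EFinB; congr EFin; ring.
by rewrite EFinM; congr (_ * _)%E; exact: lebE.
Qed.

Definition ubox (A : 'I_n * 'I_n -> set C) : set N :=
  [set Z : N | forall i j, (i < j)%N -> A (i, j) (Z i j)].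

Lemma uboxE (A : 'I_n * 'I_n -> set C) : @uparam R n @^-1` ubox A =
  tbox (fun k : 'I_#|{: upair n}| => @cplx R @^-1` A (val (enum_val k)) : set (plane R)).
Proof.
apply/seteqP; split => t /= At.
  move=> k; have := At _ _ (valP (enum_val k)).
  by rewrite -surjective_pairing /= -/(uentry _ k) -[X in _ X]plnK -[pln _]/((fun Z => pln (uentry Z k)) (uparam t)); have := congr1 (fun x => tnth x k) (uparamK t); rewrite tnth_mktuple /pln => ->.
move=> i j ij; have := At (enum_rank (Sub (i, j) ij : upair n)).
rewrite /= enum_rankK /=; congr (A _ _).
rewrite mxE insubT/=; congr (cplx (tnth t (enum_rank _))); exact/val_inj.
Qed.

Lemma measurable_ubox (A : 'I_n * 'I_n -> set C) :
  (forall ij, measurable (@cplx R @^-1` A ij : set (plane R))) -> measurable (ubox A).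
Proof.
move=> mA; rewrite -[X in measurable X](_ : @ucoord R n @^-1` (@uparam R n @^-1` ubox A) = _).
  rewrite -[X in measurable X]setTI; apply: measurable_ucoord => //.
  by rewrite uboxE; exact: measurable_tbox.
by apply/seteqP; split => Z /=; rewrite ucoordK.
Qed.

Lemma unitri_lebesgue_ubox_gt0 (c : 'I_n * 'I_n -> C) e : 0 < e ->
  (0 < @unitri_lebesgue R n (ubox (fun ij => square (c ij) e)))%E.
Proof.
move=> e0; rewrite /unitri_lebesgue /pushforward uboxE.
apply: measure_pow_tbox_gt0 => k; first exact: measurable_square.
by rewrite [X in (_ < X)%E](plane_lebesgue_square _ e0) lte_fin !mulr_gt0.
Qed.

Lemma unitri_lebesgue_ubox_lty (c : 'I_n * 'I_n -> C) e : 0 < e ->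
  (@unitri_lebesgue R n (ubox (fun ij => square (c ij) e)) < +oo)%E.
Proof.
move=> e0; rewrite /unitri_lebesgue /pushforward uboxE.
apply: measure_pow_tbox_lty => k; first exact: measurable_square.
by rewrite [X in (X < _)%E](plane_lebesgue_square _ e0) ltry.
Qed.

End boxes.

(** * Elements of the representation space are square integrable *)

Section pivoting.
Variables (R : realType) (n : nat).
Local Notation C := R[i].
Local Notation N := (unitri R n).
Implicit Types (g b : 'M[C]_n) (i j k l : 'I_n) (s : {perm 'I_n}) (Z : N).

Definition pivoted_at i g := forall j, (i < j)%N ->
  abs2 (minor i (col_perm (tperm i j) g)) <= abs2 (minor i g).

Definition pivoted g := forall i, pivoted_at i g.

Lemma eq_minor_cols i g s1 s2 :
  (forall k, (k <= i)%N -> s1 k = s2 k) ->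
  minor i (col_perm s1 g) = minor i (col_perm s2 g).
Proof.
move=> e; congr (\det _); apply/matrixP => a c; rewrite !mxE e//=.
exact: (ltn_ord c).
Qed.

(** Partial pivoting: at step i, a column maximizing the leading minor of
    size i + 1 is moved to position i; the minors treated before are
    affected by the later swaps only through the competing columns. *)
Lemma exists_pivot g : exists s, pivoted (col_perm s g).
Proof.
suff H (m : nat) : exists s, forall i, (i < m)%N -> pivoted_at i (col_perm s g).
  by have [s Hs] := H n; exists s => i; exact: Hs.
elim: m => [|m [s IH]]; first by exists 1%g.
have [mn|nm] := ltnP m n; last first.
  by exists s => i _; apply: IH; rewrite (leq_trans (ltn_ord i)).
pose k := Ordinal mn; pose h := col_perm s g.
pose size j := abs2 (minor k (col_perm (tperm k j) h)).
have [l lk lmax] := @arg_maxP _ R _ k (fun j => (k <= j)%N) size (leqnn k).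
exists (tperm k l * s)%g => i; rewrite ltnS leq_eqVlt => /predU1P[ik|im] j ij.
  have {}ik : i = k by apply/val_inj.
  subst i; rewrite -col_permM mulgA (_ : abs2 (minor k (col_perm (tperm k l * s) g)) = size l).
    rewrite (@eq_minor_cols k g _ (tperm k (tperm k l j) * s)).
      rewrite col_permM; apply: lmax.
      by case: tpermP => // _ _; exact: ltnW.
    move=> a; rewrite !permM leq_eqVlt => /predU1P[/val_inj ->|ak].
      by rewrite !tpermL.
    have neq (c : 'I_n) : (k <= c)%N -> c != a.
      by move=> kc; rewrite -val_eqE gtn_eqF// (leq_trans ak).
    have kl : (k <= tperm k l j)%N by case: tpermP => // _ _; exact: ltnW.
    have [nk nl nj nt] := And4 (neq k (leqnn k)) (neq l lk) (neq j (ltnW ij)) (neq _ kl).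
    by rewrite (tpermD nk nj) (tpermD nk nl) (tpermD nk nt).
  by rewrite /size /h -col_permM.
have kj : exists2 j' : 'I_n, (i < j')%N &
    forall a : 'I_n, (a <= i)%N -> (tperm i j * (tperm k l * s))%g a = (tperm i j' * s)%g a.
  have ik : (i < k)%N by [].
  have il : (i < l)%N by exact: leq_trans lk.
  exists (tperm k l j); first by case: tpermP.
  move=> a; rewrite !permM leq_eqVlt => /predU1P[/val_inj ->|ai].
    by rewrite !tpermL.
  have neq (c : 'I_n) : (i <= c)%N -> c != a.
    by move=> kc; rewrite -val_eqE gtn_eqF// (leq_trans ai).
  have kl : (i < tperm k l j)%N by case: tpermP.
  have [ni nk nl] := And3 (neq i (leqnn i)) (neq k (ltnW ik)) (neq l (ltnW il)).
  have [nj nt] := conj (neq j (ltnW ij)) (neq _ (ltnW kl)).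
  by rewrite (tpermD ni nj) (tpermD nk nl) (tpermD ni nt).
case: kj => j' ij' e; have := IH i im j' ij'.
rewrite -!col_permM (eq_minor_cols _ e).
rewrite (@eq_minor_cols i g (tperm k l * s) s)// => a ai.
rewrite permM tpermD// -val_eqE/= gtn_eqF//; apply: (leq_ltn_trans ai) => //.
exact: leq_trans lk.
Qed.

Lemma pivotedM b g : is_trig_mx b -> b \in unitmx -> pivoted (b *m g) <-> pivoted g.
Proof.
move=> bt bu.
have e i s : abs2 (minor i (col_perm s (b *m g))) =
    abs2 (\prod_(k < n | (k <= i)%N) b k k) * abs2 (minor i (col_perm s g)).
  by rewrite -abs2M col_permM_mul; congr abs2; exact: minorM.
have pos i : 0 < abs2 (\prod_(k < n | (k <= i)%N) b k k).
  by rewrite lt_def abs2_ge0 abs2_eq0 prefix_neq0.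
have e0 i : abs2 (minor i (b *m g)) =
    abs2 (\prod_(k < n | (k <= i)%N) b k k) * abs2 (minor i g).
  by have := e i 1%g; rewrite !col_perm1.
have E i j : (abs2 (minor i (col_perm (tperm i j) (b *m g))) <= abs2 (minor i (b *m g))) =
    (abs2 (minor i (col_perm (tperm i j) g)) <= abs2 (minor i g)).
  by rewrite [X in X <= _]e [X in _ <= X]e0 ler_pM2l.
split => pg i j ij; first exact: (etrans (esym (E i j)) (pg i j ij)).
exact: (etrans (E i j) (pg i j ij)).
Qed.

(** On unitriangular matrices the competing minors are the entries. *)
Lemma pivoted_ubox Z : pivoted Z -> ubox (fun=> square 0 1) Z.
Proof.
move=> pZ i j ij; have := pZ i j ij.
rewrite minor_tperm_unitri// minor_unitri abs21 /square/= !subr0 /abs2 => le1.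
have sq_le1 (x : R) : x ^+ 2 <= 1 -> `|x| <= 1.
  by move=> x1; rewrite -(@ler_pXn2r _ 2)// ?nnegrE// expr1n real_normK// num_real.
by split; apply: sq_le1; apply: le_trans le1; rewrite ?lerDl ?lerDr sqr_ge0.
Qed.

Definition bounded_on_box (f : N -> C) :=
  exists M : R, forall Z, ubox (fun=> square 0 1) Z -> abs2 (f Z) <= M.

Lemma bounded_cst c : bounded_on_box (fun=> c).
Proof. by exists (abs2 c). Qed.

Lemma abs2D_le (x y : C) : abs2 (x + y) <= 2 * abs2 x + 2 * abs2 y.
Proof.
case: x y => [a b] [c d]; rewrite /abs2/=.
by have := sqr_ge0 (a - c); have := sqr_ge0 (b - d); rewrite !sqrrB; nra.
Qed.

Lemma boundedD f f' : bounded_on_box f -> bounded_on_box f' ->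
  bounded_on_box (fun Z => f Z + f' Z).
Proof.
move=> [M bM] [M' bM']; exists (2 * M + 2 * M') => Z bZ.
by rewrite (le_trans (abs2D_le _ _))// lerD// ler_pM2l ?bM ?bM'.
Qed.

Lemma boundedM f f' : bounded_on_box f -> bounded_on_box f' ->
  bounded_on_box (fun Z => f Z * f' Z).
Proof.
move=> [M bM] [M' bM']; exists (M * M') => Z bZ.
by rewrite abs2M ler_pM ?abs2_ge0 ?bM ?bM'.
Qed.

Lemma bounded_entry i j : bounded_on_box (fun Z => Z i j).
Proof.
exists 2 => Z bZ; have [ij|ji] := ltnP i j; last first.
  by rewrite unitriE//; case: (i == j); rewrite /abs2/=; rewrite ?expr1n ?expr0n/= ?addr0; lra.
have := bZ i j ij; rewrite /square/= !subr0 => -[re im].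
have sq_le1 (x : R) : `|x| <= 1 -> x ^+ 2 <= 1.
  by move=> x1; rewrite -real_normK ?num_real// exprn_ile1.
by rewrite /abs2 (le_trans (lerD (sq_le1 _ re) (sq_le1 _ im))).
Qed.

Lemma bounded_GL_polynomial (F : 'M[C]_n -> C) s : GL_polynomial F ->
  bounded_on_box (fun Z => F (Z *m perm_mx s)).
Proof.
move=> pF; pose h Z : {x : 'M[C]_n | x \in unitmx} := exist _ (Z *m perm_mx s)
  (eq_ind_r is_true (introT andP (conj (unitri_unitmx Z) (unitmx_perm _ s))) (unitmx_mul _ _)).
apply: (@GL_polynomial_ind _ _ (fun v => bounded_on_box (v \o h)) _ _ _ _ _ F pF).
- by move=> c; exact: bounded_cst.
- by move=> v w bv bw; exact: boundedD.
- by move=> v w bv bw; exact: boundedM.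
- move=> i j; have [M bM] := bounded_entry i ((s^-1)%g j); exists M => Z bZ.
  by rewrite /=  -[s]invgK -col_permE mxE; exact: bM.
exists 1 => Z _ /=; rewrite det_mulmx det_perm.
have -> : \det (Z : 'M[C]_n) = 1.
  rewrite -det_tr det_trig; first by apply: big1 => i _; rewrite mxE unitriE ?eqxx.
  exact: unitri_trig_tr.
rewrite mul1r abs2V abs2X.
have -> : abs2 (-1 : C) = 1 by rewrite abs2N abs21.
by rewrite expr1n invr1.
Qed.

End pivoting.

Section square_integrability.
Variables (R : realType) (n : nat) (p : n.-tuple int).
Hypothesis p_signature : sorted >=%R p.
Local Notation C := R[i].
Local Notation N := (unitri R n).
Implicit Types (g b u : 'M[C]_n) (Z : N) (s : {perm 'I_n}) (f : N -> C).

Lemma sqr_normc (c : C) : Normc.normc c ^+ 2 = abs2 c.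
Proof. by case: c => a b; rewrite /= sqr_sqrtr ?addr_ge0 ?sqr_ge0. Qed.

Lemma L2P f : Pol R n f ->
  L2 (mu_p R p) f <-> (uint (fun Z => (abs2 (f Z) * weight p Z)%R) < +oo)%E.
Proof.
move=> pf; have mf := cmeasurable_Pol pf.
rewrite -(integral_mu_p p (density_abs2 mf)) /L2/=.
have -> : (\int[mu_p R p]_Z (abs2 (f Z))%:E =
    \int[mu_p R p]_x (Normc.normc (f x) ^+ 2)%:E)%E.
  by apply: eq_integral => Z _; rewrite sqr_normc.
by split=> [[]|].
Qed.

(** The indicator function of the pivoted matrices, as a product of finitely many
    comparisons of minors, which makes it measurable and left invariant. *)
Definition pivot_ind g : R := \prod_(i < n) \prod_(j < n | (i < j)%N)
  (abs2 (minor i (col_perm (tperm i j) g)) <= abs2 (minor i g))%R%:R.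

Lemma pivot_ind_ge0 g : 0 <= pivot_ind g.
Proof. by apply: prodr_ge0 => i _; apply: prodr_ge0 => j _; exact: ler0n. Qed.

Lemma pivot_ind1 g : pivoted g -> pivot_ind g = 1.
Proof.
move=> pg; apply: big1 => i _; apply: big1 => j ij.
by rewrite (pg i j ij).
Qed.

Lemma pivot_ind0 g : ~ pivoted g -> pivot_ind g = 0.
Proof.
move=> npg; apply/eqP; apply: contra_notT npg => pg i j ij.
have /prodf_neq0 : \prod_(i < n) \prod_(j < n | (i < j)%N)
  ((abs2 (minor i (col_perm (tperm i j) g)) <= abs2 (minor i g))%R%:R : R) != 0 by [].
move=> /(_ i isT) /prodf_neq0 /(_ j ij); by case: (_ <= _) => //; rewrite eqxx.
Qed.

Lemma measurable_pivot_ind g : g \in unitmx ->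
  measurable_fun setT (fun Z : N => pivot_ind (Z *m g)).
Proof.
move=> gu; have mminor i s : measurable_fun setT (fun Z : N => abs2 (minor i (col_perm s (Z *m g)))).
  apply: measurable_abs2; apply: cmeasurable_det => a c.
  rewrite (_ : (fun Z : N => _) = fun Z : N =>
     (Z *m g) (widen_ord (ltn_ord i) a) (s (widen_ord (ltn_ord i) c))); last first.
    by apply/funext => Z; rewrite !mxE.
  apply: (@cmeasurable_GL_polynomial _ _ (fun x => x _ _)) => //.
  exact: GL_polynomial_entry.
have prodE (I : Type) (r : seq I) (P : pred I) (F : I -> N -> R) :
    (forall i, measurable_fun setT (F i)) ->
    measurable_fun setT (fun Z => \prod_(i <- r | P i) F i Z).
  move=> mF; elim: r => [|i r IH].
    by under eq_fun do rewrite big_nil; exact: measurable_cst.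
  by under eq_fun do rewrite big_cons; case: (P i) => //; exact: measurable_funM.
apply: (prodE _ _ _ _) => i; apply: (prodE _ _ _ _) => j.
have mle : measurable_fun setT (fun Z : N =>
    abs2 (minor i (col_perm (tperm i j) (Z *m g))) <= abs2 (minor i (Z *m g))).
  have e1 : (fun Z : N => abs2 (minor i (Z *m g))) =
      fun Z => abs2 (minor i (col_perm 1%g (Z *m g))).
    by apply/funext => Z; rewrite col_perm1.
  apply: measurable_fun_ler; first exact: mminor.
  by rewrite e1; exact: mminor.
rewrite (_ : (fun Z => _) = fun Z : N => if
    abs2 (minor i (col_perm (tperm i j) (Z *m g))) <= abs2 (minor i (Z *m g)) then 1 else 0).
  exact: measurable_fun_ifT.
by apply/funext => Z; case: (_ <= _).
Qed.

Lemma pivot_indM b g : is_trig_mx b -> b \in unitmx -> pivot_ind (b *m g) = pivot_ind g.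
Proof.
move=> bt bu; have [pg|npg] := pselect (pivoted g).
  by rewrite (pivot_ind1 pg) (pivot_ind1 (iffRL (pivotedM g bt bu) pg)).
have npbg : ~ pivoted (b *m g) by move=> /(pivotedM g bt bu).
by rewrite (pivot_ind0 npg) (pivot_ind0 npbg).
Qed.

Lemma perm_mx_unitary s : (perm_mx s : 'M[C]_n) \is unitarymx.
Proof.
by apply/unitarymxP; rewrite tr_perm_mx map_perm_mx -perm_mxM mulgV perm_mx1.
Qed.

Lemma ge0_uintD_sum (I : Type) (r : seq I) (h : I -> N -> R) :
  (forall i, density (h i)) ->
  uint (fun Z => \sum_(i <- r) h i Z) = (\sum_(i <- r) uint (h i))%E.
Proof.
move=> dh; rewrite /uint -ge0_integral_sum//.
- by apply: eq_integral => Z _; rewrite sumEFin.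
- by move=> i; apply/measurable_EFinP; apply: (dh i).1.
- by move=> i Z _; rewrite lee_fin (dh i).2.
Qed.

Lemma le_uint h1 h2 : density h1 -> density h2 -> (forall Z, h1 Z <= h2 Z) ->
  (uint h1 <= uint h2)%E.
Proof.
move=> [m1 p1] [m2 p2] le; apply: ge0_le_integral => //.
- by move=> Z _; rewrite lee_fin.
- exact/measurable_EFinP.
- exact/measurable_EFinP.
- by move=> Z _; rewrite lee_fin.
Qed.

Lemma uint_ubox_lty (M : R) : 0 <= M ->
  (uint (fun Z : N => (M * \1_(ubox (fun=> square 0 1)) Z)%R) < +oo)%E.
Proof.
move=> M0; have mB : measurable (ubox (fun=> square 0 1) : set N).
  by apply: measurable_ubox => ij; exact: measurable_square.
rewrite /uint; under eq_integral do rewrite EFinM.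
rewrite ge0_integralZl//; last first.
  by apply/measurable_EFinP; exact: measurable_indic.
rewrite integral_indic// setIT; apply: lte_mul_pinfty => //.
exact: unitri_lebesgue_ubox_lty.
Qed.

(** On the part of the big cell where a given column permutation is pivoted,
    that permutation moves the integral to the unit polydisc, by invariance. *)
Lemma uint_pivoted_lty (F : 'M[C]_n -> C) s : GL_equivariant p F ->
  (uint (fun Z : N => (abs2 (F Z) * pivot_ind (col_perm s Z) * weight p Z)%R) < +oo)%E.
Proof.
move=> [pF eF].
have ephi : norm_equivariant p (fun g => abs2 (F g) * pivot_ind (col_perm s g)).
  split=> [g gu|b g bt bu gu].
    apply: measurable_funM; first exact/measurable_abs2/cmeasurable_GL_polynomial.
    under eq_fun do rewrite col_permM_mul; apply: measurable_pivot_ind.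
    by rewrite col_perm_unit.
  by rewrite eF// abs2M col_permM_mul pivot_indM// mulrA.
have phi0 g : 0 <= abs2 (F g) * pivot_ind (col_perm s g).
  by rewrite mulr_ge0 ?abs2_ge0 ?pivot_ind_ge0.
rewrite -(uint_unitary ephi phi0 (perm_mx_unitary s)).
have [M bM] := @bounded_GL_polynomial _ _ F s pF.
have mB : measurable (ubox (fun=> square 0 1) : set N).
  by apply: measurable_ubox => ij; exact: measurable_square.
have M0 : 0 <= M.
  have /bM : ubox (fun=> square 0 1) (mkU (fun _ _ => 0) : N).
    by move=> i j ij; rewrite mkUE ij /square/= subrr normr0 ler01.
  by apply: le_trans; exact: abs2_ge0.
apply: le_lt_trans (uint_ubox_lty M0); apply: le_uint.
- apply: density_weight; split; last by move=> Z; exact: phi0.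
  exact: (ephi.1 _ (unitmx_perm _ s)).
- split => [|Z]; last by rewrite mulr_ge0.
  by apply: measurable_funM => //; exact: measurable_indic.
move=> Z; have -> : col_perm s (Z *m perm_mx s) = Z.
  by rewrite col_permE -mulmxA -perm_mxM mulgV perm_mx1 mulmx1.
have [pZ|npZ] := pselect (pivoted Z); last first.
  by rewrite pivot_ind0// mulr0 mul0r mulr_ge0.
rewrite pivot_ind1// mulr1 indicE mem_set; last exact: pivoted_ubox.
rewrite -[M]mulr1 ler_pM ?abs2_ge0 ?weight_ge0 ?weight_le1 ?mulr1//.
by apply: bM; exact: pivoted_ubox.
Qed.

(** Every matrix is pivoted after some column permutation, so the integral is at
    most a finite sum of the preceding ones. *)
Lemma Vspace_L2 f : Vspace R p f -> L2 (mu_p R p) f.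
Proof.
move=> Vf; have pf := Vf.1; have [F [eF Ff _]] := rho_extension Vf.
apply/(L2P pf).
have dF s : density (fun Z : N => abs2 (F Z) * pivot_ind (col_perm s Z) * weight p Z).
  apply: density_weight; split => [|Z]; last by rewrite mulr_ge0 ?abs2_ge0 ?pivot_ind_ge0.
  apply: measurable_funM.
    under eq_fun do rewrite Ff; exact/measurable_abs2/cmeasurable_Pol.
  have := @measurable_pivot_ind (perm_mx s^-1) (unitmx_perm _ _).
  by under eq_fun do rewrite -col_permE.
apply: (@le_lt_trans _ _ (uint (fun Z : N => \sum_(s : {perm 'I_n})
    abs2 (F Z) * pivot_ind (col_perm s Z) * weight p Z))); last first.
  rewrite ge0_uintD_sum//; apply: lte_sum_pinfty => s _.
  exact: uint_pivoted_lty.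
apply: le_uint.
- exact/density_weight/density_abs2/cmeasurable_Pol.
- split => [|Z]; first by apply: measurable_sum => s; exact: (dF s).1.
  by apply: sumr_ge0 => s _; exact: (dF s).2.
move=> Z; have [s ps] := exists_pivot Z.
rewrite (bigD1 s)//= pivot_ind1// mulr1 Ff lerDl.
by apply: sumr_ge0 => s' _; have := (dF s').2 Z; rewrite Ff.
Qed.

End square_integrability.

(** * Local bounds on polynomials *)

Section local_continuity.
Variables (R : realType) (n : nat).
Local Notation C := R[i].
Local Notation N := (unitri R n).
Implicit Types (i j : 'I_n) (Z : N) (f : N -> C) (e : R).

Definition nbox Z e : set N := ubox (fun ij => square (Z ij.1 ij.2) e).

Lemma nbox_le Z e e' : e <= e' -> nbox Z e `<=` nbox Z e'.
Proof.
move=> ee W bW i j ij; have [re im] := bW i j ij.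
by split; apply: le_trans ee.
Qed.

Let min_le e e' : (Num.min e e' <= e) * (Num.min e e' <= e').
Proof. by split; rewrite ge_min lexx ?orbT. Qed.

Definition near_cont Z0 f := forall eta, 0 < eta -> exists2 e, 0 < e &
  forall Z, nbox Z0 e Z -> abs2 (f Z - f Z0) <= eta.

Lemma near_cont_cst Z0 c : near_cont Z0 (fun=> c).
Proof. by move=> eta eta0; exists 1 => // Z _; rewrite subrr abs20 ltW. Qed.

Lemma near_contD Z0 f f' : near_cont Z0 f -> near_cont Z0 f' ->
  near_cont Z0 (fun Z => f Z + f' Z).
Proof.
move=> cf cf' eta eta0.
have [e e0 ef] := cf (eta / 4) ltac:(by rewrite divr_gt0).
have [e' e'0 ef'] := cf' (eta / 4) ltac:(by rewrite divr_gt0).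
exists (Num.min e e') => [|Z bZ]; first by rewrite lt_min e0.
have b1 := ef Z (nbox_le (min_le e e').1 bZ).
have b2 := ef' Z (nbox_le (min_le e e').2 bZ).
have -> : f Z + f' Z - (f Z0 + f' Z0) = (f Z - f Z0) + (f' Z - f' Z0) by ring.
by apply: le_trans (abs2D_le _ _) _; lra.
Qed.

Lemma near_contM Z0 f f' : near_cont Z0 f -> near_cont Z0 f' ->
  near_cont Z0 (fun Z => f Z * f' Z).
Proof.
move=> cf cf' eta eta0.
set F := abs2 (f Z0); set G := abs2 (f' Z0).
have F0 : 0 <= F by exact: abs2_ge0.
have G0 : 0 <= G by exact: abs2_ge0.
pose u := eta / (4 * (2 * G + 2)); pose v := Num.min 1 (eta / (4 * (F + 1))).
have u0 : 0 < u by rewrite divr_gt0// mulr_gt0//; lra.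
have v0 : 0 < v by rewrite lt_min ltr01 divr_gt0// mulr_gt0//; lra.
have [e e0 ef] := cf u u0.
have [e' e'0 ef'] := cf' v v0.
exists (Num.min e e') => [|Z bZ]; first by rewrite lt_min e0.
have b1 := ef Z (nbox_le (min_le e e').1 bZ).
have b2 := ef' Z (nbox_le (min_le e e').2 bZ).
have -> : f Z * f' Z - f Z0 * f' Z0 =
  (f Z - f Z0) * f' Z + f Z0 * (f' Z - f' Z0) by ring.
apply: le_trans (abs2D_le _ _) _; rewrite !abs2M -/F.
have g1 : abs2 (f' Z) <= 2 * G + 2.
  have -> : f' Z = f' Z0 + (f' Z - f' Z0) by ring.
  apply: le_trans (abs2D_le _ _) _; rewrite -/G.
  have : v <= 1 by rewrite ge_min lexx.
  lra.
have h1 : abs2 (f Z - f Z0) * abs2 (f' Z) <= eta / 4.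
  have -> : eta / 4 = u * (2 * G + 2) by rewrite /u; field; lra.
  by apply: ler_pM; rewrite ?abs2_ge0.
have h2 : F * abs2 (f' Z - f' Z0) <= eta / 4.
  have -> : eta / 4 = (F + 1) * (eta / (4 * (F + 1))) by field; lra.
  apply: ler_pM; rewrite ?abs2_ge0 ?lerDl//.
  by apply: le_trans b2 _; rewrite ge_min lexx orbT.
lra.
Qed.

Lemma near_cont_entry Z0 i j : near_cont Z0 (fun Z => Z i j).
Proof.
move=> eta eta0; have [ij|ji] := ltnP i j; last first.
  by exists 1 => // Z _; rewrite !unitriE// subrr abs20 ltW.
pose e := Num.min 1 (eta / 2).
have e0 : 0 < e by rewrite lt_min ltr01 divr_gt0.
exists e => // Z /(_ i j ij)[/= re im].
have e1 : e <= 1 by rewrite ge_min lexx.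
have e2 : e <= eta / 2 by rewrite ge_min lexx orbT.
have sq (x : R) : `|x| <= e -> x ^+ 2 <= eta / 2.
  move=> xe; rewrite -real_normK ?num_real// expr2.
  have := normr_ge0 x; nra.
have := sq _ im; have := sq _ re.
by case: (Z i j) (Z0 i j) => [a b] [c d]; rewrite /abs2/=; lra.
Qed.

Lemma near_cont_conj Z0 f : near_cont Z0 f -> near_cont Z0 (fun Z => (f Z)^*).
Proof.
move=> cf eta eta0; have [e e0 ef] := cf eta eta0; exists e => // Z bZ.
have abs2_conj (c : C) : abs2 c^* = abs2 c by case: c => a b; rewrite /abs2/= sqrrN.
by rewrite -rmorphB abs2_conj; exact: ef.
Qed.

Lemma near_cont_sum Z0 (I : Type) (r : seq I) (P : pred I) (F : I -> N -> C) :
  (forall k, near_cont Z0 (F k)) -> near_cont Z0 (fun Z => \sum_(k <- r | P k) F k Z).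
Proof.
move=> cF; elim: r => [|k r IH].
  by under eq_fun do rewrite big_nil; exact: near_cont_cst.
by under eq_fun do rewrite big_cons; case: (P k) => //; exact: near_contD.
Qed.

Lemma near_cont_prod Z0 (I : Type) (r : seq I) (P : pred I) (F : I -> N -> C) :
  (forall k, near_cont Z0 (F k)) -> near_cont Z0 (fun Z => \prod_(k <- r | P k) F k Z).
Proof.
move=> cF; elim: r => [|k r IH].
  by under eq_fun do rewrite big_nil; exact: near_cont_cst.
by under eq_fun do rewrite big_cons; case: (P k) => //; exact: near_contM.
Qed.

Lemma near_contX Z0 f k : near_cont Z0 f -> near_cont Z0 (fun Z => f Z ^+ k).
Proof.
move=> cf; elim: k => [|k IH]; first by under eq_fun do rewrite expr0; exact: near_cont_cst.
by under eq_fun do rewrite exprS; exact: near_contM.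
Qed.

Lemma near_cont_det Z0 m (A : N -> 'M[C]_m) :
  (forall a c, near_cont Z0 (fun Z => A Z a c)) -> near_cont Z0 (fun Z => \det (A Z)).
Proof.
move=> cA; rewrite /determinant; apply: near_cont_sum => s.
by apply: near_contM; [exact: near_cont_cst|exact: near_cont_prod].
Qed.

Lemma near_cont_Pol Z0 f : Pol R n f -> near_cont Z0 f.
Proof.
move: f; apply: Pol_ind => [c|v w|v w|i j _].
- exact: near_cont_cst.
- exact: near_contD.
- exact: near_contM.
- exact: near_cont_entry.
Qed.

Lemma near_neq0 Z0 f : near_cont Z0 f -> f Z0 != 0 ->
  exists e c : R, [/\ 0 < e, 0 < c & forall Z, nbox Z0 e Z -> c <= abs2 (f Z)].
Proof.
move=> cf f0; have a0 : 0 < abs2 (f Z0) by rewrite lt_def abs2_eq0 f0 abs2_ge0.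
have [e e0 ef] := cf (abs2 (f Z0) / 4) ltac:(by rewrite divr_gt0).
exists e, (abs2 (f Z0) / 4); split => [//||Z bZ]; first by rewrite divr_gt0.
have := ef Z bZ; have := abs2D_le (f Z) (f Z0 - f Z).
rewrite -[X in _ -> X <= _ -> _]abs2N opprB addrC subrK; lra.
Qed.

Lemma near_bounded Z0 f : near_cont Z0 f ->
  exists e M : R, [/\ 0 < e, 0 < M & forall Z, nbox Z0 e Z -> abs2 (f Z) <= M].
Proof.
move=> cf; have [e e0 ef] := cf 1 ltr01.
exists e, (2 * abs2 (f Z0) + 2); split => [//||Z bZ].
  by have := abs2_ge0 (f Z0); lra.
have := ef Z bZ; have := abs2D_le (f Z0) (f Z - f Z0).
by rewrite addrC subrK; lra.
Qed.

(** The inverse of the weight is a product of powers of Gram determinants, which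
    are polynomials in the entries and their conjugates, hence locally bounded. *)
Lemma near_weight_ge (p : n.-tuple int) Z0 : sorted >=%R p ->
  exists e c : R, [/\ 0 < e, 0 < c & forall Z, nbox Z0 e Z -> c <= weight p Z].
Proof.
move=> sp.
pose D Z : C := \prod_(j < n | (j.+1 < n)%N)
  (\det (corner j Z *m (corner j Z)^t*)) ^+ (absz (p`_j - p`_j.+1)%R + 2).
have DE Z : D Z = ((weight p Z)^-1)%:C%C.
  rewrite weightE// rmorphV ?unitfE; last first.
    by rewrite gt_eqF// prodr_gt0// => j _; rewrite invr_gt0 exprn_gt0// (lt_le_trans _ (gram_ge1 _ _)).
  rewrite rmorph_prod -prodfV; apply: eq_bigr => j _; rewrite rmorphV ?invrK.
    rewrite rmorphXn/=; congr (_ ^+ _).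
    have := gram_det_ge0 (corner j Z); rewrite /gram.
    by case: (\det _) => x y; rewrite lecE /= => /andP[/eqP -> _].
  by rewrite unitfE gt_eqF// exprn_gt0// (lt_le_trans _ (gram_ge1 _ _)).
have cD : near_cont Z0 D.
  apply: near_cont_prod => j; apply: near_contX; apply: near_cont_det => a c.
  rewrite (_ : (fun Z : N => _) =
      (fun Z : N => \sum_m corner j Z a m * (corner j Z c m)^*)).
    apply: near_cont_sum => m; apply: near_contM; last apply: near_cont_conj.
      by under eq_fun do rewrite mxE; exact: near_cont_entry.
    by under eq_fun do rewrite mxE; exact: near_cont_entry.
  by apply/funext => Z; rewrite mxE; apply: eq_bigr => m _; rewrite !mxE.
have [e [M [e0 M0 DM]]] := near_bounded cD.
exists e, (1 + M)^-1; split => [//||Z bZ]; first by rewrite invr_gt0; lra.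
have w0 := weight_gt0 sp Z.
have := DM Z bZ; rewrite DE /abs2/= expr0n addr0 => wM.
rewrite -[X in _ <= X]invrK lef_pV2 ?posrE ?invr_gt0//; last lra.
have := sqr_ge0 ((weight p Z)^-1 - 1); rewrite sqrrB1; lra.
Qed.

End local_continuity.

(** * Square integrable polynomials and adjacent transpositions *)

Section poles.
Variables (R : realType) (n : nat) (k k1 : 'I_n).
Hypothesis k1E : k1 = k.+1 :> nat.
Local Notation C := R[i].
Local Notation N := (unitri R n).
Implicit Types (i j : 'I_n) (Z : N) (f Q : N -> C) (e : R).

Let kk1 : (k < k1)%N. Proof. by rewrite k1E. Qed.

Let density_indic (B : set N) : measurable B ->
  density (fun Z => \1_B Z * (abs2 (Z k k1))^-1 : R).
Proof.
move=> mB; apply: densityM; last exact/density_inv/density_abs2/cmeasurable_entry.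
by split => [|Z]; [exact: measurable_indic|exact: ler0n].
Qed.

(** The function |z|^-2 is not locally integrable at 0: its integral is
    invariant under scaling of the domain, while the annulus between two
    homothetic squares contributes a positive amount. *)
Lemma uint_pole_infty Z0 e : Z0 k k1 = 0 -> 0 < e ->
  ~ (uint (fun Z : N => (\1_(nbox Z0 e) Z * (abs2 (Z k k1))^-1)%R) < +oo)%E.
Proof.
move=> z0 e0 fin.
pose r d (ij : 'I_n * 'I_n) := if ij == (k, k1) then d else e.
pose B d : set N := ubox (fun ij => square (Z0 ij.1 ij.2) (r d ij)).
have mB d : measurable (B d).
  by apply: measurable_ubox => ij; exact: measurable_square.
have BE : nbox Z0 e = B e.
  by apply/seteqP; split => Z bZ i j ij; have := bZ i j ij; rewrite /r; case: ifP.
rewrite BE in fin.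
pose h Z := \1_(B e) Z * (abs2 (Z k k1))^-1 : R.
have two0 : (2 : C) != 0 by rewrite pnatr_eq0.
have abs2_2 : abs2 (2 : C) = 4.
  by rewrite /abs2 mulr2n /=; ring.
have scale : uint (fun Z => \1_(B (e / 2)) Z * (abs2 (Z k k1))^-1) = uint h.
  rewrite -(@uint_affine1 _ _ (k, k1) (fun=> 2) (fun=> 0) h)//; last exact: density_indic.
  apply: eq_uint => Z; rewrite /h addr0/=.
  have -> : \1_(B e) (uupd Z (k, k1) (2 * Z k k1)) = \1_(B (e / 2)) Z :> R.
    rewrite !indicE; congr (_%:R); congr nat_of_bool.
    have sqE (c : C) d : square 0 d (2 * c) <-> square 0 (d / 2) c.
      case: c => a b; rewrite mulr_natl mulr2n /square/= !subr0.
      have dbl (x : R) : (`|x + x| <= d) = (`|x| <= d / 2).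
        by rewrite -mulr2n normrMn ler_pdivlMr// mulr_natr.
      by rewrite !dbl.
    apply/idP/idP => /set_mem bZ; apply/mem_set => i j ij; have := bZ i j ij; rewrite /r mkUE ij.
      by case: eqP => [[-> ->]|//]; rewrite /= z0 => /sqE.
    by case: eqP => [[-> ->]|//]; rewrite /= z0 => /sqE.
  rewrite uupdE// abs2M abs2_2 invfM -!mulrA; congr (_ * _).
  by rewrite [RHS]mulrC -mulrA mulfV ?mulr1// pnatr_eq0.
(* A cube of half-side e / 8 inside the annulus between the two boxes. *)
pose c (ij : 'I_n * 'I_n) : C :=
  if ij == (k, k1) then (3 / 4 * e)%:C%C else Z0 ij.1 ij.2.
pose A : set N := ubox (fun ij => square (c ij) (e / 8)).
have e8 : 0 < e / 8 by rewrite divr_gt0.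
have mA : measurable A by apply: measurable_ubox => ij; exact: measurable_square.
have lA := unitri_lebesgue_ubox_gt0 c e8; rewrite -/A in lA.
have lAfin := unitri_lebesgue_ubox_lty c e8; rewrite -/A in lAfin.
pose kappa := (2 * e ^+ 2)^-1.
have kappa0 : 0 < kappa by rewrite invr_gt0 mulr_gt0// exprn_gt0.
have dA : density (fun Z => kappa * \1_A Z).
  split => [|Z]; first by apply: measurable_funM => //; exact: measurable_indic.
  by rewrite mulr_ge0// ltW.
have uA : uint (fun Z => kappa * \1_A Z) = (kappa%:E * @unitri_lebesgue R n A)%E.
  rewrite /uint; under eq_integral do rewrite EFinM.
  rewrite ge0_integralZl// ?integral_indic ?setIT// ?lee_fin ?ltW//.
  by apply/measurable_EFinP; exact: measurable_indic.
have dB2 := density_indic (mB (e / 2)).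
have : (uint (fun Z => \1_(B (e / 2)%R) Z * (abs2 (Z k k1))^-1)%R +
        uint (fun Z => kappa * \1_A Z)%R <= uint h)%E.
  rewrite /uint -ge0_integralD//; last 4 first.
  - by move=> Z _; rewrite lee_fin; apply: dB2.2.
  - exact/measurable_EFinP/dB2.1.
  - by move=> Z _; rewrite lee_fin; apply: dA.2.
  - exact/measurable_EFinP/dA.1.
  apply: ge0_le_integral => //.
  - by move=> Z _; rewrite adde_ge0// lee_fin; [apply: dB2.2|apply: dA.2].
  - by apply: emeasurable_funD; apply/measurable_EFinP; [exact: dB2.1|exact: dA.1].
  - exact/measurable_EFinP/(density_indic (mB e)).1.
  move=> Z _; rewrite -EFinD lee_fin /h !indicE.
  have BB : B (e / 2) Z -> B e Z.
    move=> bZ i j ij; have := bZ i j ij; rewrite /r; case: eqP => // _ [re im].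
    by split; [apply: le_trans re _|apply: le_trans im _]; lra.
  have AB : A Z -> B e Z /\ ~ B (e / 2) Z /\ kappa <= (abs2 (Z k k1))^-1.
    move=> aZ; have := aZ k k1 kk1; rewrite /c eqxx /square/= subr0 => -[re im].
    have re2 : 5 / 8 * e <= complex.Re (Z k k1) <= 7 / 8 * e.
      by move: re; rewrite ler_distl => /andP[]; lra.
    have im2 : - (e / 8) <= complex.Im (Z k k1) <= e / 8.
      by rewrite -ler_norml.
    split=> [i j ij|].
      have := aZ i j ij; rewrite /r /c; case: eqP => [[-> ->] _|_ [re' im']]/=.
        rewrite z0 /square/= !subr0 !ler_norml.
        by case/andP: re2; case/andP: im2; move=> *; split; apply/andP; split; lra.
      by split; [apply: le_trans re' _|apply: le_trans im' _]; lra.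
    split.
      move=> /(_ k k1 kk1); rewrite /r eqxx /= z0 /square/= subr0 => -[+ _].
      by rewrite ler_norml; case/andP: re2; lra.
    rewrite /kappa lef_pV2 ?posrE ?mulr_gt0 ?exprn_gt0//.
      by rewrite /abs2; case/andP: re2; case/andP: im2; nra.
    by rewrite lt_def abs2_ge0 andbT abs2_eq0; apply/eqP => zz; move: re2; rewrite zz /=; lra.
  have [aZ|naZ] := pselect (A Z); last first.
    rewrite (memNset naZ) mulr0 addr0; have [bZ|nbZ] := pselect (B (e / 2) Z).
      by rewrite !mem_set//; exact: BB.
    by rewrite (memNset nbZ) mul0r mulr_ge0// invr_ge0 abs2_ge0.
  have [bZ [nbZ kz]] := AB aZ.
  by rewrite (mem_set aZ) (mem_set bZ) (memNset nbZ) mul0r add0r mulr1 mul1r.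
rewrite scale uA -leeBrDl; last by rewrite ge0_fin_numE// integral_ge0// => Z _; rewrite lee_fin; apply: (density_indic (mB e)).2.
rewrite subee; last by rewrite ge0_fin_numE// integral_ge0// => Z _; rewrite lee_fin; apply: (density_indic (mB e)).2.
by rewrite leNgt mule_gt0.
Qed.

Lemma Pol_uupd0 f : Pol R n f -> Pol R n (fun Z => f (uupd Z (k, k1) 0)).
Proof.
move: f; apply: Pol_ind => [c|v w|v w|i j ij].
- exact: Pol_cst.
- exact: PolD.
- exact: PolM.
under eq_fun do rewrite mkUE ij; case: eqP => _; first exact: Pol_cst.
exact: Pol_entry.
Qed.

Lemma Pol_divide f : Pol R n f -> exists2 f', Pol R n f' &
  forall Z, f Z = f (uupd Z (k, k1) 0) + Z k k1 * f' Z.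
Proof.
move=> pf; suff [] : Pol R n f /\ exists2 f', Pol R n f' &
  forall Z, f Z = f (uupd Z (k, k1) 0) + Z k k1 * f' Z by [].
move: f pf; apply: Pol_ind => [c|v w [pv [v' pv' vE]] [pw [w' pw' wE]]
  |v w [pv [v' pv' vE]] [pw [w' pw' wE]]|i j ij].
- split; first exact: Pol_cst.
  by exists (fun=> 0) => [|Z]; [exact: Pol_cst|rewrite mulr0 addr0].
- split; first exact: PolD.
  by exists (fun Z => v' Z + w' Z) => [|Z]; [exact: PolD|rewrite {1}vE {1}wE; ring].
- split; first exact: PolM.
  exists (fun Z => v' Z * w Z + v (uupd Z (k, k1) 0) * w' Z) => [|Z].
    by apply: PolD; apply: PolM => //; exact: Pol_uupd0.
  by rewrite {1}vE {1 2}wE; ring.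
split; first exact: Pol_entry.
have [[-> ->]|/eqP ijk] := eqVneq (i, j) (k, k1).
  exists (fun=> 1) => [|Z]; first exact: Pol_cst.
  by rewrite uupdE// mulr1 add0r.
exists (fun=> 0) => [|Z]; first exact: Pol_cst.
by rewrite mkUE ij; case: eqP => // _; rewrite mulr0 addr0.
Qed.

Lemma Pol_swapT f : Pol R n f -> exists m Q, Pol R n Q /\
  forall Z, Z k k1 != 0 -> f (swapT k k1 Z) = Q Z / Z k k1 ^+ m.
Proof.
move: f; apply: Pol_ind => [c|v w [m [v' [pv vE]]] [l [w' [pw wE]]]
  |v w [m [v' [pv vE]]] [l [w' [pw wE]]]|i j ij].
- exists 0%N, (fun=> c); split=> [|Z _]; first exact: Pol_cst.
  by rewrite expr0 divr1.
- exists (m + l)%N, (fun Z => v' Z * Z k k1 ^+ l + w' Z * Z k k1 ^+ m); split.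
    by apply: PolD; apply: PolM => //; apply: PolX; exact: Pol_entry.
  move=> Z z0; rewrite vE// wE// exprD.
  by field; rewrite !expf_neq0.
- exists (m + l)%N, (fun Z => v' Z * w' Z); split; first exact: PolM.
  move=> Z z0; rewrite vE// wE// exprD.
  by field; rewrite !expf_neq0.
have pe := @Pol_entry R n.
have P0 Q' : Pol R n Q' -> (forall Z, Z k k1 != 0 -> swapT k k1 Z i j = Q' Z) ->
    exists m Q, Pol R n Q /\
      forall Z, Z k k1 != 0 -> swapT k k1 Z i j = Q Z / Z k k1 ^+ m.
  move=> pQ QE; exists 0%N, Q'; split => // Z z0.
  by rewrite QE// expr0 divr1.
have [ik|ik] := eqVneq i k.
  have [jk1|jk1] := eqVneq j k1.
    exists 1%N, (fun=> 1); split => [|Z _]; first exact: Pol_cst.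
    by rewrite mkUE ij ik jk1 !eqxx expr1 mul1r.
  exists 1%N, (fun Z => Z k j); split => [|Z _]; first exact: pe.
  by rewrite mkUE ij ik (negbTE jk1) !eqxx expr1.
have [ik1|ik1] := eqVneq i k1.
  apply: (P0 (fun Z => Z k j + (-1) * (Z k k1 * Z k1 j))) => [|Z _].
    by apply: PolD => //; apply: PolM; [exact: Pol_cst|exact: PolM].
  by rewrite mkUE ij (negbTE ik) ik1 eqxx mulN1r.
have [jk|jk] := eqVneq j k.
  apply: (P0 (fun Z => Z i k1)) => // Z _.
  by rewrite mkUE ij (negbTE ik) (negbTE ik1) jk eqxx.
have [jk1|jk1] := eqVneq j k1.
  apply: (P0 (fun Z => Z i k)) => // Z _.
  by rewrite mkUE ij (negbTE ik) (negbTE ik1) (negbTE jk) jk1 eqxx.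
apply: (P0 (fun Z => Z i j)) => // Z _.
by rewrite mkUE ij (negbTE ik) (negbTE ik1) (negbTE jk) (negbTE jk1).
Qed.

Variable p : n.-tuple int.
Hypothesis p_signature : sorted >=%R p.

Let density_ratio Q m : Pol R n Q ->
  density (fun Z => abs2 (Q Z / Z k k1 ^+ m) * weight p Z).
Proof.
move=> pQ; apply/density_weight/density_abs2/cmeasurableM.
  exact: cmeasurable_Pol.
by apply: cmeasurable_inv; apply: cmeasurable_Pol; apply: PolX; exact: Pol_entry.
Qed.

(** By induction on the order of the pole: a numerator vanishing on z = 0 is
    divisible by z, and any other one contradicts the divergence of the integral
    of |z|^-2. *)
Lemma no_pole Q m : Pol R n Q ->
  (uint (fun Z => (abs2 (Q Z / Z k k1 ^+ m) * weight p Z)%R) < +oo)%E ->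
  exists2 f, Pol R n f & forall Z, Z k k1 != 0 -> f Z = Q Z / Z k k1 ^+ m.
Proof.
elim: m Q => [|m IH] Q pQ fin; first by exists Q => // Z _; rewrite expr0 divr1.
have [Q' pQ' QE] := Pol_divide pQ.
have [Q0|] := pselect (forall Z, Q (uupd Z (k, k1) 0) = 0).
  have QE' Z : Z k k1 != 0 -> Q Z / Z k k1 ^+ m.+1 = Q' Z / Z k k1 ^+ m.
    move=> z0; rewrite QE Q0 add0r exprS invfM mulrACA divff// mul1r//.
  have [|f pf fE] := IH Q' pQ'; last by exists f => // Z z0; rewrite fE// QE'.
  rewrite (_ : uint _ = uint (fun Z => abs2 (Q Z / Z k k1 ^+ m.+1) * weight p Z))//.
  apply: (uint_neq0 kk1); [exact: density_ratio|exact: density_ratio|].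
  by move=> Z z0; rewrite QE'.
move=> /existsNP[Z1 /eqP Q1]; exfalso; pose Z0 := uupd Z1 (k, k1) 0.
have z0 : Z0 k k1 = 0 by rewrite uupdE.
(* At a point with z = 0 and Q nonzero, |Q|^2 and the weight are bounded below,
   so that the integrand dominates a multiple of |z|^-2. *)
have [e1 [c1 [e10 c10 Qc]]] := near_neq0 (near_cont_Pol Z0 pQ) Q1.
have [e2 [c2 [e20 c20 wc]]] := near_weight_ge Z0 p_signature.
pose e := Num.min (1 / 2) (Num.min e1 e2).
have e0 : 0 < e by rewrite !lt_min e10 e20 divr_gt0.
have ee1 : e <= e1 by rewrite !ge_min lexx !orbT.
have ee2 : e <= e2 by rewrite !ge_min lexx !orbT.
have eh : e <= 1 / 2 by rewrite ge_min lexx.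
apply: (uint_pole_infty z0 e0).
have mB : measurable (nbox Z0 e).
  by apply: measurable_ubox => ij; exact: measurable_square.
have c12 : 0 < c1 * c2 by rewrite mulr_gt0.
have le : (uint (fun Z => (c1 * c2 * (\1_(nbox Z0 e) Z * (abs2 (Z k k1))^-1))%R) <=
  uint (fun Z => (abs2 (Q Z / Z k k1 ^+ m.+1) * weight p Z)%R))%E.
  apply: le_uint; last 1 first.
  - move=> Z; rewrite indicE; have [bZ|nbZ] := pselect (nbox Z0 e Z); last first.
      by rewrite (memNset nbZ) mul0r mulr0 mulr_ge0 ?abs2_ge0 ?weight_ge0.
    rewrite (mem_set bZ) mul1r.
    have := Qc Z (nbox_le ee1 bZ); have := wc Z (nbox_le ee2 bZ) => wZ QZ.
    rewrite abs2M abs2V abs2X [X in _ <= X]mulrAC; apply: ler_pM; [exact: ltW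
      |by rewrite invr_ge0 abs2_ge0|by apply: ler_pM => //; exact: ltW|].
    have a0 := abs2_ge0 (Z k k1); have [->|az] := eqVneq (abs2 (Z k k1)) 0.
      by rewrite expr0n/= invr0.
    have a1 : abs2 (Z k k1) <= 1.
      have := bZ k k1 kk1; rewrite /= z0 /square/= !subr0 => -[re im].
      have sq (x : R) : `|x| <= e -> x ^+ 2 <= 1 / 4.
        by move=> xe; rewrite -real_normK ?num_real// expr2; have := normr_ge0 x; nra.
      by have := sq _ re; have := sq _ im; rewrite /abs2; lra.
    have ap : 0 < abs2 (Z k k1) by rewrite lt_def az.
    rewrite lef_pV2 ?posrE ?exprn_gt0// exprS ler_piMr// exprn_ile1//.
  - split => [|Z].
      by apply: measurable_funM => //; exact: (density_indic mB).1.
    by apply: mulr_ge0; [exact: ltW|apply: (density_indic mB).2].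
  exact: density_ratio.
have := le_lt_trans le fin; rewrite /uint.
under eq_integral do rewrite EFinM.
rewrite ge0_integralZl//; last 3 first.
- exact/measurable_EFinP/(density_indic mB).1.
- by move=> Z _; rewrite lee_fin; apply: (density_indic mB).2.
- by rewrite lee_fin ltW.
rewrite !ltey; apply: contra => /eqP ->.
by rewrite gt0_muley// lte_fin.
Qed.

Lemma tri_char_swap_low z : z != 0 ->
  tri_char p (swap_low k k1 z) = (-1) ^ p`_k1 * z ^ (p`_k - p`_k1) :> C.
Proof.
move=> z0; rewrite /tri_char.
under eq_bigr do rewrite (tnth_nth 0).
rewrite (swap_low_prod k1E (f := id))//=.
have -> : - z^-1 = (-1) * z^-1 by rewrite mulN1r.
by rewrite expfzMl exprz_inv mulrCA -expfzDr.
Qed.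

(** The permutation matrix is unitary, so the weight of Z is that of the permuted
    matrix, where it transforms by the lower triangular factor. *)
Lemma weight_swapT Z : Z k k1 != 0 ->
  abs2 (tri_char p (swap_low k k1 (Z k k1))) * weight p Z =
  weight p (swapT k k1 Z) * abs2 (Z k k1) ^- 2.
Proof.
move=> z0; set b := swap_low k k1 (Z k k1).
have bt : is_trig_mx b by exact: swap_low_trig.
have bu : b \in unitmx by exact: swap_low_unit.
rewrite -(modulus_swap_low k1E z0) (modulusE p bt bu) -!gram_weight_unitri.
rewrite -(gram_weight_unitary _ Z (perm_mx_unitary R (tperm k k1))).
by rewrite tperm_mxE swap_decomposition// gram_weightM//; ring.
Qed.

(** The space of square integrable polynomials is stable under the Weyl group:
    a simple reflection produces at worst a pole along z = 0, which square
    integrability rules out. *)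
Lemma swap_stable f : Pol R n f -> L2 (mu_p R p) f ->
  exists f', [/\ Pol R n f', L2 (mu_p R p) f' & forall Z, Z k k1 != 0 ->
    f' Z = tri_char p (swap_low k k1 (Z k k1)) * f (swapT k k1 Z)].
Proof.
move=> pf /(L2P _ pf) ff.
have [m [Q [pQ QE]]] := Pol_swapT pf.
have [a [c zE]] : exists a c : nat, forall z : C, z != 0 -> z ^ (p`_k - p`_k1) = z ^+ a / z ^+ c.
  case: (p`_k - p`_k1) => [a|c]; first by exists a, 0%N => z _; rewrite expr0 divr1.
  by exists 0%N, c.+1 => z _; rewrite expr0 mul1r NegzE exprnN.
pose Q' Z : C := (-1) ^ p`_k1 * (Z k k1 ^+ a * Q Z).
have pQ' : Pol R n Q'.
  by apply: PolM; [exact: Pol_cst|apply: PolM => //; apply: PolX; exact: Pol_entry].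
have Q'E Z : Z k k1 != 0 -> Q' Z / Z k k1 ^+ (m + c) =
    tri_char p (swap_low k k1 (Z k k1)) * f (swapT k k1 Z).
  move=> z0; rewrite tri_char_swap_low// QE// zE// exprD /Q'.
  by field; rewrite !expf_neq0.
have fin : uint (fun Z => abs2 (Q' Z / Z k k1 ^+ (m + c)) * weight p Z) =
    uint (fun Z => abs2 (f Z) * weight p Z).
  have df := density_weight p (density_abs2 (cmeasurable_Pol pf)).
  rewrite -(uint_swap k1E df); apply: (uint_neq0 kk1); first exact: density_ratio.
    apply: densityM; first exact: (density_comp df (measurable_swapT _ _)).
    by apply/density_inv/densityX/density_abs2/cmeasurable_entry.
  by move=> Z z0; rewrite Q'E// abs2M mulrAC weight_swapT// mulrC mulrA.
have [|f' pf' f'E] := no_pole (m := m + c) pQ'; first by rewrite fin.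
exists f'; split => //; last by move=> Z z0; rewrite f'E// Q'E.
apply/(L2P _ pf').
rewrite (_ : uint _ = uint (fun Z => abs2 (Q' Z / Z k k1 ^+ (m + c)) * weight p Z)); first by rewrite fin.
apply: (uint_neq0 kk1); [exact/density_weight/density_abs2/cmeasurable_Pol|exact: density_ratio|].
by move=> Z z0; rewrite f'E.
Qed.

End poles.

(** * Generic identities on matrices *)

Section generic.
Variables (R : realType) (n : nat).
Local Notation C := R[i].
Local Notation N := (unitri R n).
Implicit Types (x y g h u : 'M[C]_n) (q : 'M[C]_n -> C) (t : C).

(** Polynomiality along every complex line, which suffices for the nonvanishing
    loci to be dense. *)
Definition line_poly q := forall x y, exists P : {poly C},
  forall t, q (x + t *: (y - x)) = P.[t].

Lemma line_poly_cst c : line_poly (fun=> c).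
Proof. by move=> x y; exists c%:P => t; rewrite hornerC. Qed.

Lemma line_polyD q1 q2 : line_poly q1 -> line_poly q2 -> line_poly (fun x => q1 x + q2 x).
Proof.
move=> l1 l2 x y; have [P1 e1] := l1 x y; have [P2 e2] := l2 x y.
by exists (P1 + P2) => t; rewrite hornerD e1 e2.
Qed.

Lemma line_polyM q1 q2 : line_poly q1 -> line_poly q2 -> line_poly (fun x => q1 x * q2 x).
Proof.
move=> l1 l2 x y; have [P1 e1] := l1 x y; have [P2 e2] := l2 x y.
by exists (P1 * P2) => t; rewrite hornerM e1 e2.
Qed.

Lemma line_polyX q k : line_poly q -> line_poly (fun x => q x ^+ k).
Proof.
move=> lq; elim: k => [|k IH]; first by under eq_fun do rewrite expr0; exact: line_poly_cst.
by under eq_fun do rewrite exprS; exact: line_polyM lq IH.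
Qed.

Lemma line_poly_entry i j : line_poly (fun x => x i j).
Proof.
move=> x y; exists ((x i j)%:P + 'X * (y i j - x i j)%:P) => t.
by rewrite !mxE hornerD hornerM hornerX !hornerC.
Qed.

Lemma line_poly_sum (I : Type) (r : seq I) (P : pred I) (F : I -> 'M[C]_n -> C) :
  (forall k, line_poly (F k)) -> line_poly (fun x => \sum_(k <- r | P k) F k x).
Proof.
move=> lF; elim: r => [|k r IH].
  by under eq_fun do rewrite big_nil; exact: line_poly_cst.
by under eq_fun do rewrite big_cons; case: (P k) => //; exact: line_polyD (lF k) IH.
Qed.

Lemma line_poly_prod (I : Type) (r : seq I) (P : pred I) (F : I -> 'M[C]_n -> C) :
  (forall k, line_poly (F k)) -> line_poly (fun x => \prod_(k <- r | P k) F k x).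
Proof.
move=> lF; elim: r => [|k r IH].
  by under eq_fun do rewrite big_nil; exact: line_poly_cst.
by under eq_fun do rewrite big_cons; case: (P k) => //; exact: line_polyM (lF k) IH.
Qed.

Lemma line_poly_det m (A : 'M[C]_n -> 'M[C]_m) :
  (forall a c, line_poly (fun x => A x a c)) -> line_poly (fun x => \det (A x)).
Proof.
move=> lA; rewrite /determinant; apply: line_poly_sum => s.
by apply: line_polyM; [exact: line_poly_cst|apply: line_poly_prod => k; exact: lA].
Qed.

Lemma line_poly_mul q h u : line_poly q -> line_poly (fun x => q (h *m x *m u)).
Proof.
move=> lq x y; have [P e] := lq (h *m x *m u) (h *m y *m u); exists P => t.
by rewrite -e mulmxDr mulmxDl -scalemxAr -scalemxAl mulmxBr mulmxBl.
Qed.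

(** Restricting to the line joining two points where they do not vanish reduces
    the integrality of the ring of polynomial functions to one variable. *)
Lemma line_poly_neq0 q1 q2 x y : line_poly q1 -> line_poly q2 ->
  q1 x != 0 -> q2 y != 0 -> exists z, q1 z * q2 z != 0.
Proof.
move=> l1 l2 x0 y0; have [P1 e1] := l1 x y; have [P2 e2] := l2 x y.
have P10 : P1 != 0.
  by apply: contraNneq x0 => P0; have := e1 0; rewrite scale0r addr0 P0 horner0 => ->.
have P20 : P2 != 0.
  apply: contraNneq y0 => P0; have := e2 1.
  by rewrite scale1r addrCA subrr addr0 P0 horner0 => ->.
have P0 : P1 * P2 != 0 by rewrite mulf_neq0.
have [t tP] : exists t, ~~ root (P1 * P2) t.
  apply/not_existsP => H.
  have := @max_poly_roots _ (P1 * P2) [seq (k%:R : C) | k <- iota 0 (size (P1 * P2))] P0.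
  rewrite size_map size_iota ltnn => abs.
  suff : false by [].
  apply: abs; first by apply/allP => z _; apply/negPn/negP; exact: H.
  rewrite map_inj_uniq ?iota_uniq// => a b /eqP.
  by rewrite eqr_nat => /eqP.
exists (x + t *: (y - x)); rewrite e1 e2 -hornerM; exact: tP.
Qed.

(** Validity on a nonempty Zariski open set. *)
Definition generically (P : 'M[C]_n -> Prop) := exists q,
  [/\ line_poly q, exists x, q x != 0 & forall g, q g != 0 -> P g].

Lemma generically_and P Q : generically P -> generically Q ->
  generically (fun g => P g /\ Q g).
Proof.
move=> [q1 [l1 [x x0] H1]] [q2 [l2 [y y0] H2]]; exists (fun g => q1 g * q2 g); split.
- exact: line_polyM l1 l2.
- exact: (line_poly_neq0 l1 l2 x0 y0).
- by move=> g; rewrite mulf_eq0 negb_or => /andP[g1 g2]; split; [exact: H1|exact: H2].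
Qed.

Lemma generically_sub (P Q : 'M[C]_n -> Prop) : (forall g, P g -> Q g) ->
  generically P -> generically Q.
Proof. by move=> PQ [q [l e H]]; exists q; split => // g /H /PQ. Qed.

Lemma generically_unit : generically (fun g => g \in unitmx).
Proof.
exists (fun g => \det g); split.
- by apply: line_poly_det => a c; exact: line_poly_entry.
- by exists 1%:M; rewrite det1 oner_eq0.
- by move=> g g0; rewrite unitmxE unitfE.
Qed.

Lemma generically_mul (P : 'M[C]_n -> Prop) h u : h \in unitmx -> u \in unitmx ->
  generically P -> generically (fun g => P (h *m g *m u)).
Proof.
move=> hu uu [q [lq [x x0] H]]; exists (fun g => q (h *m g *m u)); split.
- exact: line_poly_mul.
- by exists (invmx h *m x *m invmx u); rewrite mulmxA mulmxKV// mulKVmx.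
- by move=> g; exact: H.
Qed.

Lemma GL_polynomial_line (F : 'M[C]_n -> C) : GL_polynomial F ->
  exists m q, line_poly q /\ forall g, g \in unitmx -> F g * \det g ^+ m = q g.
Proof.
have ld : line_poly (fun g => \det g).
  by apply: line_poly_det => a c; exact: line_poly_entry.
move=> pF; suff [m [q [lq H]]] : exists m q, line_poly q /\
    forall x : {x : 'M[C]_n | x \in unitmx}, F (val x) * \det (val x) ^+ m = q (val x).
  by exists m, q; split => // g gu; exact: (H (exist _ g gu)).
apply: (@GL_polynomial_ind _ _ (fun v => exists m q, line_poly q /\
    forall x : {x : 'M[C]_n | x \in unitmx}, v x * \det (val x) ^+ m = q (val x)) _ _ _ _ _ F pF).
- move=> c; exists 0%N, (fun=> c); split; first exact: line_poly_cst.
  by move=> x; rewrite expr0 mulr1.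
- move=> v w [m1 [q1 [l1 e1]]] [m2 [q2 [l2 e2]]].
  exists (m1 + m2)%N, (fun g => q1 g * \det g ^+ m2 + q2 g * \det g ^+ m1); split.
    by apply: line_polyD; apply: line_polyM => //; exact: line_polyX.
  by move=> x; rewrite -e1 -e2 exprD; ring.
- move=> v w [m1 [q1 [l1 e1]]] [m2 [q2 [l2 e2]]].
  exists (m1 + m2)%N, (fun g => q1 g * q2 g); split; first exact: line_polyM l1 l2.
  by move=> x; rewrite -e1 -e2 exprD; ring.
- move=> i j; exists 0%N, (fun g => g i j); split; first exact: line_poly_entry.
  by move=> x; rewrite expr0 mulr1.
exists 1%N, (fun=> 1); split; first exact: line_poly_cst.
by move=> [x xu] /=; rewrite expr1 mulVf// -unitfE -unitmxE.
Qed.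

(** Zariski density: an identity between regular functions on GL(n, C) that
    holds generically holds everywhere. *)
Lemma GL_polynomial_eq (F G : 'M[C]_n -> C) : GL_polynomial F -> GL_polynomial G ->
  generically (fun g => F g = G g) -> forall g, g \in unitmx -> F g = G g.
Proof.
move=> pF pG FG g gu.
have ld : line_poly (fun g => \det g).
  by apply: line_poly_det => a c; exact: line_poly_entry.
have [m1 [q1 [l1 e1]]] := GL_polynomial_line pF.
have [m2 [q2 [l2 e2]]] := GL_polynomial_line pG.
pose q x := q1 x * \det x ^+ m2 + (-1) * (q2 x * \det x ^+ m1).
have lq : line_poly q.
  apply: line_polyD; first by apply: line_polyM => //; exact: line_polyX.
  apply: line_polyM; first exact: line_poly_cst.
  by apply: line_polyM => //; exact: line_polyX.
have [r [lr [y y0] H]] := generically_and FG generically_unit.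
have d0 : \det g != 0 by rewrite -unitfE -unitmxE.
have : q g = 0.
  apply/eqP; apply/negPn/negP => qg.
  have [z] := line_poly_neq0 lq lr qg y0.
  rewrite mulf_eq0 negb_or => /andP[qz rz]; have [Fz zu] := H z rz.
  by move: qz; rewrite /q -e1// -e2// Fz; apply/negP/negPn/eqP; ring.
rewrite /q -e1// -e2// => /eqP.
have -> : F g * \det g ^+ m1 * \det g ^+ m2 + -1 * (G g * \det g ^+ m2 * \det g ^+ m1) =
  (F g - G g) * (\det g ^+ m1 * \det g ^+ m2) by ring.
by rewrite mulf_eq0 mulf_eq0 !expf_eq0 (negbTE d0) !andbF !orbF subr_eq0 => /eqP.
Qed.

End generic.

(** * Equivariant extensions with minors as denominators *)

Section cleared_denominators.
Variables (R : realType) (n : nat).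
Local Notation C := R[i].
Local Notation N := (unitri R n).
Implicit Types (g h b : 'M[C]_n) (i j : 'I_n) (s : {perm 'I_n}) (Z : N).
Implicit Types (f : N -> C) (F G : 'M[C]_n -> C) (p : n.-tuple int).

Lemma GL_polynomial_mul F h b : h \in unitmx -> b \in unitmx ->
  GL_polynomial F -> GL_polynomial (fun g => F (h *m g *m b)).
Proof.
move=> hu bu pF.
pose T := {x : 'M[C]_n | x \in unitmx}.
have mu (x : T) : h *m val x *m b \in unitmx by rewrite !unitmx_mul hu bu (valP x).
pose m (x : T) : T := exist (fun x => x \in unitmx) _ (mu x).
apply/GL_polynomialP.
suff : is_mpoly (@GLvar R n) ((fun x : T => F (val x)) \o m) by [].
apply: (@GL_polynomial_ind R n (fun v => is_mpoly (@GLvar R n) (v \o m)) _ _ _ _ _ F pF).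
- by move=> c; exact: is_mpoly_cst.
- by move=> v w pv pw; exact: is_mpolyD.
- by move=> v w pv pw; exact: is_mpolyM.
- move=> i j; apply: (iffLR (GL_polynomialP (fun g => (h *m g *m b) i j))).
  under eq_fun do rewrite mxE; apply: GL_polynomial_sum => k.
  apply: GL_polynomialM; last exact: GL_polynomial_cst.
  under eq_fun do rewrite mxE; apply: GL_polynomial_sum => l.
  by apply: GL_polynomialM; [exact: GL_polynomial_cst|exact: GL_polynomial_entry].
apply: (iffLR (GL_polynomialP (fun g => (\det (h *m g *m b))^-1))).
rewrite (_ : (fun g => _) = fun g => (\det h)^-1 * (\det b)^-1 * (\det g)^-1).
  by apply: GL_polynomialM; [exact: GL_polynomial_cst|exact: GL_polynomial_Vdet].
by apply/funext => g; rewrite !det_mulmx !invfM mulrAC.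
Qed.

Lemma col_perm_mul s g : col_perm s g = 1%:M *m g *m perm_mx s^-1.
Proof. by rewrite mul1mx col_permE. Qed.

Lemma GL_polynomial_col_perm s F :
  GL_polynomial F -> GL_polynomial (fun g => F (col_perm s g)).
Proof.
move=> pF; under eq_fun do rewrite col_perm_mul.
by apply: GL_polynomial_mul => //; [exact: unitmx1|exact: unitmx_perm].
Qed.

Lemma generically_col_perm s (P : 'M[C]_n -> Prop) :
  generically P -> generically (fun g => P (col_perm s g)).
Proof.
move=> gP; have := generically_mul (unitmx1 _ n) (unitmx_perm C s^-1) gP.
by apply: generically_sub => g; rewrite -col_perm_mul.
Qed.

Lemma GL_polynomial_minor s i : GL_polynomial (fun g : 'M[C]_n => minor i (col_perm s g)).
Proof.
apply: GL_polynomial_det => a c; under eq_fun do rewrite !mxE.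
exact: GL_polynomial_entry.
Qed.

Lemma line_poly_minor s i : line_poly (fun g : 'M[C]_n => minor i (col_perm s g)).
Proof.
apply: line_poly_det => a c.
rewrite (_ : (fun g => _) = fun g : 'M[C]_n =>
  g (widen_ord (ltn_ord i) a) (s (widen_ord (ltn_ord i) c))); first exact: line_poly_entry.
by apply/funext => g; rewrite !mxE.
Qed.

Definition minors_prod g : C := \prod_j minor j g.

Lemma minors_prod_unitri Z : minors_prod Z = 1.
Proof. by rewrite /minors_prod big1// => j _; rewrite minor_unitri. Qed.

Lemma minor_neq0 i g : minors_prod g != 0 -> minor i g != 0.
Proof. by move=> /prodf_neq0 ->. Qed.

Lemma line_poly_minors_prod : line_poly minors_prod.
Proof.
apply: line_poly_prod => j.
rewrite (_ : minor j = fun g => minor j (col_perm 1%g g)); first exact: line_poly_minor.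
by apply/funext => g; rewrite col_perm1.
Qed.

Lemma GL_polynomial_minors_prod : GL_polynomial minors_prod.
Proof.
apply: GL_polynomial_prod => j.
rewrite (_ : minor j = fun g => minor j (col_perm 1%g g)); first exact: GL_polynomial_minor.
by apply/funext => g; rewrite col_perm1.
Qed.

Lemma generically_minors : generically (fun g => minors_prod g != 0).
Proof.
exists minors_prod; split => //; first exact: line_poly_minors_prod.
by exists (mkU (fun _ _ => 0)); rewrite minors_prod_unitri oner_eq0.
Qed.

(** Membership in the localisation of the coordinate ring at the leading
    minors. *)
Definition cleared F := exists m E, GL_polynomial E /\
  forall g, minors_prod g != 0 -> minors_prod g ^+ m * F g = E g.

Lemma cleared_GL F : GL_polynomial F -> cleared F.
Proof. by move=> pF; exists 0%N, F; split => // g _; rewrite expr0 mul1r. Qed.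

Lemma clearedD F G : cleared F -> cleared G -> cleared (fun g => F g + G g).
Proof.
move=> [m [E [pE EE]]] [l [E' [pE' EE']]]; exists (m + l)%N,
  (fun g => minors_prod g ^+ l * E g + minors_prod g ^+ m * E' g); split.
  by apply: GL_polynomialD; apply: GL_polynomialM => //; apply: GL_polynomialX;
     exact: GL_polynomial_minors_prod.
by move=> g g0; rewrite -EE// -EE'// exprD; ring.
Qed.

Lemma clearedM F G : cleared F -> cleared G -> cleared (fun g => F g * G g).
Proof.
move=> [m [E [pE EE]]] [l [E' [pE' EE']]]; exists (m + l)%N, (fun g => E g * E' g); split.
  exact: GL_polynomialM.
by move=> g g0; rewrite -EE// -EE'// exprD; ring.
Qed.

Lemma clearedX F k : cleared F -> cleared (fun g => F g ^+ k).
Proof.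
move=> cF; elim: k => [|k IH].
  by under eq_fun do rewrite expr0; apply: cleared_GL; exact: GL_polynomial_cst.
by under eq_fun do rewrite exprS; exact: clearedM cF IH.
Qed.

Lemma cleared_prod (I : Type) (r : seq I) (F : I -> 'M[C]_n -> C) :
  (forall k, cleared (F k)) -> cleared (fun g => \prod_(k <- r) F k g).
Proof.
move=> cF; elim: r => [|k r IH].
  by under eq_fun do rewrite big_nil; apply: cleared_GL; exact: GL_polynomial_cst.
by under eq_fun do rewrite big_cons; exact: clearedM (cF k) IH.
Qed.

Lemma cleared_minor s i : cleared (fun g => minor i (col_perm s g)).
Proof. by apply: cleared_GL; exact: GL_polynomial_minor. Qed.

Lemma cleared_minorV i : cleared (fun g => (minor i g)^-1).
Proof.
exists 1%N, (fun g => \prod_(j < n | j != i) minor j (col_perm 1%g g)); split.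
  by apply: GL_polynomial_prod => j; exact: GL_polynomial_minor.
move=> g g0; rewrite expr1 /minors_prod (bigD1 i)//= mulrAC divff ?minor_neq0// mul1r.
by apply: eq_bigr => j _; rewrite col_perm1.
Qed.

Variable p : n.-tuple int.

(** The equivariant extension of f as a rational function on GL(n, C), meaningful
    where no leading minor vanishes. *)
Definition Fext f g : C := minor_char p g * f (gaussW g).

Lemma FextM f b g : is_trig_mx b -> b \in unitmx ->
  Fext f (b *m g) = tri_char p b * Fext f g.
Proof. by move=> bt bu; rewrite /Fext minor_charM// gaussWM// mulrA. Qed.

Lemma Fext_unitri f Z : Fext f Z = f Z.
Proof. by rewrite /Fext minor_char_unitri gaussW_unitri mul1r. Qed.

Lemma cleared_Fext f : Pol R n f -> cleared (Fext f).
Proof.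
move=> pf; apply: clearedM; last first.
  move: f pf; apply: Pol_ind => [c|v w|v w|i j ij].
  - by apply: cleared_GL; exact: GL_polynomial_cst.
  - exact: clearedD.
  - exact: clearedM.
  under eq_fun do rewrite mkUE ij.
  by apply: clearedM; [exact: cleared_minor|exact: cleared_minorV].
apply: cleared_prod => j; case: (p`_j - p`_j.+1) => e.
  apply: clearedX; rewrite (_ : minor j = fun g => minor j (col_perm 1%g g)).
    exact: cleared_minor.
  by apply/funext => g; rewrite col_perm1.
rewrite (_ : (fun g => _) = fun g => (minor j g)^-1 ^+ e.+1).
  by apply: clearedX; exact: cleared_minorV.
by apply/funext => g; rewrite NegzE -exprnN exprVn.
Qed.

Hypothesis p_signature : sorted >=%R p.

Local Notation L2Pol := [set f | Pol R n f /\ L2 (mu_p R p) f].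

(** The local form of swap_stable becomes an identity of equivariant functions
    on the open set where both Gauss decompositions exist. *)
Lemma Fext_swap (k k1 : 'I_n) f : k1 = k.+1 :> nat -> L2Pol f ->
  exists2 f', L2Pol f' &
    generically (fun g => Fext f' g = Fext f (col_perm (tperm k k1) g)).
Proof.
move=> k1E [pf Lf]; have [f' [pf' Lf' f'E]] := swap_stable k1E p_signature pf Lf.
have kk1 : (k < k1)%N by rewrite k1E.
exists f' => //; exists (fun g => minors_prod g * minor k (col_perm (tperm k k1) g)); split.
- exact: line_polyM line_poly_minors_prod (line_poly_minor _ _).
- exists (mkU (fun i j => ((i == k) && (j == k1))%:R)).
  rewrite minors_prod_unitri mul1r minor_tperm_unitri// mkUE kk1 !eqxx/=.
  by rewrite oner_eq0.
move=> g; rewrite mulf_eq0 negb_or => /andP[g0 gk].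
have [b [bt bu] [tr1 d1]] := gauss_decomposition (fun j => minor_neq0 j g0).
have uZ : is_unitriangular (b *m g).
  by rewrite /is_unitriangular tr1; apply/forallP => i; rewrite d1.
pose Z : N := Unitri uZ.
have ZE : b *m g = Z by [].
have z0 : Z k k1 != 0.
  rewrite -(minor_tperm_unitri Z kk1) -ZE col_permM_mul minorM//.
  by rewrite mulf_neq0// prefix_neq0.
apply: (mulfI (tri_char_neq0 p bt bu)); rewrite -!FextM//.
rewrite -col_permM_mul ZE Fext_unitri f'E// (swap_decomposition k1E z0).
by rewrite FextM ?Fext_unitri//; [exact: swap_low_trig|exact: swap_low_unit].
Qed.

(** Column permutations act on the extensions of square integrable polynomials,
    so that such an extension is defined wherever some column permutation has
    nonzero leading minors. *)
Lemma Fext_perm s f : L2Pol f -> exists2 f', L2Pol f' &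
  generically (fun g => Fext f' g = Fext f (col_perm s g)).
Proof.
move: s f; apply: perm_adjacent_ind => [f Lf|s1 s2 IH1 IH2 f Lf|k k1 k1E f Lf].
- exists f => //; apply: generically_sub (generically_unit _ _) => g _.
  by rewrite col_perm1.
- have [f1 L1 e1] := IH1 _ Lf; have [f2 L2' e2] := IH2 _ L1.
  exists f2; first exact: L2'.
  apply: generically_sub (generically_and e2 (generically_col_perm s2 e1)) => g [E2 E1].
  by rewrite E2 E1 col_permM.
exact: Fext_swap.
Qed.

End cleared_denominators.

(** * Regularity of the extension *)

Section perm_extension.

(** Lets a permutation of an initial segment act on every larger one, with the
    same values. *)
Lemma perm_extend m m' (t : {perm 'I_m}) : (m <= m')%N ->
  exists s : {perm 'I_m'}, forall x : 'I_m',
    s x = (if insub (x : nat) is Some y then t y : nat else x) :> nat.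
Proof.
move=> mm; pose f (x : 'I_m') : 'I_m' :=
  if insub (x : nat) is Some y then widen_ord mm (t y) else x.
have f_inj : injective f.
  move=> x y; rewrite /f.
  case: insubP => [x' _ xE|xm]; case: insubP => [y' _ yE|ym].
  - move=> /(congr1 (@nat_of_ord _))/= /val_inj/perm_inj e.
    by apply/val_inj; rewrite /= -xE -yE e.
  - by move=> e; move: ym; rewrite -e /= ltn_ord.
  - by move=> e; move: xm; rewrite e /= ltn_ord.
  - by [].
by exists (perm f_inj) => x; rewrite permE /f; case: insubP.
Qed.

Lemma minor_last (K : fieldType) m (k : 'I_m) (g : 'M[K]_m) :
  k.+1 = m -> minor k g = \det g.
Proof.
case: m k g => [[]//|m] k g [km].
have -> : k = ord_max by exact/val_inj.
by congr (\det _); apply/matrixP => i j; rewrite mxE; congr (g _ _); exact/val_inj.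
Qed.

Variables (K : fieldType) (n : nat) (k k1 : 'I_n).
Hypothesis k1E : k1 = k.+1 :> nat.

Lemma widen_insub (l : 'I_n) m (t : {perm 'I_m}) (s : {perm 'I_n}) (s' : {perm 'I_l.+1}) :
  (forall x : 'I_n, s x = (if insub (x : nat) is Some y then t y : nat else x) :> nat) ->
  (forall x : 'I_l.+1, s' x = (if insub (x : nat) is Some y then t y : nat else x) :> nat) ->
  forall c, s (widen_ord (ltn_ord l) c) = widen_ord (ltn_ord l) (s' c).
Proof. by move=> sE s'E c; apply/val_inj; rewrite /= sE s'E. Qed.

(** Laplace expansion of a leading minor along its last row. The complementary
    minor of the entry in column j is the previous leading minor after a cycle
    of the first k + 2 columns, which changes the later leading minors only by
    a sign. *)
Lemma minor_expand : exists (t : 'I_k1.+1 -> {perm 'I_n}) (e : 'I_k1.+1 -> K)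
    (d : 'I_k1.+1 -> 'I_n -> K),
  (forall g : 'M[K]_n, minor k1 g = \sum_j g k1 (widen_ord (ltn_ord k1) j) * (e j * minor k (col_perm (t j) g))) /\
  (forall j (l : 'I_n) (g : 'M[K]_n), (k < l)%N -> minor l g = d j l * minor l (col_perm (t j) g)).
Proof.
have kn : (k.+2 <= n)%N by rewrite -k1E.
have [t tE] := choice (fun j : 'I_k.+2 => perm_extend (lift_perm ord_max j 1%g) kn).
have [d dE] : exists d : 'I_k.+2 -> 'I_n -> K, forall j (l : 'I_n), (k < l)%N ->
    forall g : 'M[K]_n, minor l g = d j l * minor l (col_perm (t j) g).
  suff /choice[d dE] : forall jl : 'I_k.+2 * 'I_n, exists d : K, (k < jl.2)%N ->
      forall g : 'M[K]_n, minor jl.2 g = d * minor jl.2 (col_perm (t jl.1) g).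
    by exists (fun j l => d (j, l)) => j l; exact: (dE (j, l)).
  move=> [j l] /=; have [kl|lk] := ltnP k l; last by exists 0.
  have [s sE] := @perm_extend k.+2 l.+1 (lift_perm ord_max j 1%g) kl.
  exists ((-1) ^+ s) => _ g; rewrite /minor.
  have -> : lead_mx l (col_perm (t j) g) = col_perm s (lead_mx l g).
    by apply/matrixP => a c; rewrite !mxE (widen_insub (tE j) sE).
  by rewrite col_permE det_mulmx det_perm odd_permV mulrCA -signr_addb addbb mulr1.
have k1k : k1.+1 = k.+2 by rewrite k1E.
exists (fun j => t (cast_ord k1k j)), (fun j => (-1) ^+ (k.+1 + j)), (fun j => d (cast_ord k1k j)).
split => [g|j l g kl]; last exact: dE.
pose A : 'M[K]_k.+2 := mxsub (widen_ord kn) (widen_ord kn) g.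
have -> : minor k1 g = \det A.
  rewrite /minor /lead_mx /A; move: (ltn_ord k1); rewrite k1E => h.
  by congr (\det _); apply/matrixP => a c; rewrite !mxE; congr (g _ _); exact/val_inj.
rewrite (expand_det_row A ord_max).
rewrite (reindex (cast_ord k1k)); last by exists (cast_ord (esym k1k)) => x _; rewrite ?cast_ordK ?cast_ordKV.
apply: eq_bigr => j _; set j' := cast_ord k1k j.
have -> : A ord_max j' = g k1 (widen_ord (ltn_ord k1) j).
  by rewrite mxE; congr (g _ _); apply/val_inj; rewrite //= k1E.
congr (_ * _); rewrite /cofactor /=; congr (_ * \det _).
apply/matrixP => a c; rewrite !mxE; congr (g _ _); apply/val_inj.
  by rewrite /= /bump leqNgt ltn_ord.
rewrite /= tE insubT/=; first by rewrite ltnS ltnW.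
move=> ck; have -> : Sub (c : nat) ck = lift ord_max c :> 'I_k.+2.
  by apply/val_inj; rewrite /= /bump leqNgt ltn_ord.
by rewrite lift_perm_lift perm1.
Qed.

End perm_extension.

Section extension.
Variables (R : realType) (n : nat).
Local Notation C := R[i].
Local Notation N := (unitri R n).
Implicit Types (g b : 'M[C]_n) (i j l : 'I_n) (s : {perm 'I_n}) (Z : N).

Section radical.
Variable F : 'M[C]_n -> C.
Implicit Types (q c : 'M[C]_n -> C).

(** The ideal of denominators of F in the coordinate ring of GL(n, C). *)
Definition denominator q := exists2 G, GL_polynomial G &
  generically (fun g => q g * F g = G g).

Lemma denominator0 : denominator (fun=> 0).
Proof.
exists (fun=> 0); first exact: GL_polynomial_cst.
by apply: generically_sub (generically_unit _ _) => g _; rewrite mul0r.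
Qed.

Lemma denominatorD q1 q2 : denominator q1 -> denominator q2 ->
  denominator (fun g => q1 g + q2 g).
Proof.
move=> [G1 p1 e1] [G2 p2 e2]; exists (fun g => G1 g + G2 g); first exact: GL_polynomialD.
by apply: generically_sub (generically_and e1 e2) => g [E1 E2]; rewrite mulrDl E1 E2.
Qed.

Lemma denominatorM c q : GL_polynomial c -> denominator q ->
  denominator (fun g => c g * q g).
Proof.
move=> pc [G pG e]; exists (fun g => c g * G g); first exact: GL_polynomialM.
by apply: generically_sub e => g E; rewrite -mulrA E.
Qed.

Definition rad_denominator q := exists m, denominator (fun g => q g ^+ m).

Lemma rad_denominatorM c q : GL_polynomial c -> rad_denominator q ->
  rad_denominator (fun g => c g * q g).
Proof.
move=> pc [m Im]; exists m; under eq_fun do rewrite exprMn.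
by apply: denominatorM => //; exact: GL_polynomialX.
Qed.

Lemma rad_denominatorD q1 q2 : GL_polynomial q1 -> GL_polynomial q2 ->
  rad_denominator q1 -> rad_denominator q2 -> rad_denominator (fun g => q1 g + q2 g).
Proof.
move=> p1 p2 [m1 I1] [m2 I2]; exists (m1 + m2)%N.
under eq_fun do rewrite exprDn.
elim: (index_enum _) => [|a r IH].
  by under eq_fun do rewrite big_nil; exact: denominator0.
under eq_fun do rewrite big_cons; apply: (denominatorD _ IH).
have [am|ma] := leqP m2 a.
  rewrite (_ : (fun g => _) = fun g =>
      q1 g ^+ (m1 + m2 - a) * q2 g ^+ (a - m2) * 'C(m1 + m2, a)%:R * q2 g ^+ m2).
    apply: denominatorM => //; apply: GL_polynomialM; last exact: GL_polynomial_cst.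
    by apply: GL_polynomialM; exact: GL_polynomialX.
  apply/funext => g; rewrite -[in LHS](subnK am) exprD -mulr_natr subnK//.
  by rewrite -!mulrA; congr (_ * (_ * _)); rewrite mulrC.
rewrite (_ : (fun g => _) = fun g =>
    q1 g ^+ (m2 - a) * q2 g ^+ a * 'C(m1 + m2, a)%:R * q1 g ^+ m1).
  apply: denominatorM => //; apply: GL_polynomialM; last exact: GL_polynomial_cst.
  by apply: GL_polynomialM; exact: GL_polynomialX.
apply/funext => g; rewrite -addnBA ?(ltnW ma)// exprD -mulr_natr.
by rewrite -!mulrA mulrC -!mulrA.
Qed.

Lemma rad_denominator_sum (I : Type) (r : seq I) (q : I -> 'M[C]_n -> C) :
  (forall a, GL_polynomial (q a)) -> (forall a, rad_denominator (q a)) ->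
  rad_denominator (fun g => \sum_(a <- r) q a g).
Proof.
move=> pq Iq; elim: r => [|a r IH].
  exists 1%N; under eq_fun do rewrite big_nil expr1; exact: denominator0.
under eq_fun do rewrite big_cons; apply: rad_denominatorD => //.
exact: GL_polynomial_sum.
Qed.

Lemma rad_denominator_root q m : rad_denominator (fun g => q g ^+ m) -> rad_denominator q.
Proof. by move=> [l Il]; exists (m * l)%N; under eq_fun do rewrite exprM. Qed.

(** The minors of all sizes after all column permutations generate the unit
    ideal: if the products of all leading minors of the permuted matrices are in
    the radical, the Laplace expansions remove the smallest minor from these
    products one size at a time, down to the determinant. *)
Lemma rad_denominator_minors :
  (forall s, rad_denominator (fun g => minors_prod (col_perm s g))) ->
  forall k : 'I_n, forall s,
  rad_denominator (fun g => \prod_(l < n | (k <= l)%N) minor l (col_perm s g)).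
Proof.
move=> I0 [k kn] /=; elim: k kn => [|k IH] kn s.
  by under eq_fun do rewrite (eq_bigl xpredT)//; exact: I0.
have {}IH := IH (ltnW kn).
pose k0 : 'I_n := Ordinal (ltnW kn); pose k1 : 'I_n := Ordinal kn.
have [t [e [d [expand sign]]]] := @minor_expand C n k0 k1 erefl.
pose P m s g : C := \prod_(l < n | (m <= l)%N) minor l (col_perm s g).
have pm s' l : GL_polynomial (fun g : 'M[C]_n => minor l (col_perm s' g)).
  exact: GL_polynomial_minor.
have pP m s' : GL_polynomial (P m s') by apply: GL_polynomial_prod => l; exact: pm.
have PS m (mn : (m < n)%N) s' g :
    P m s' g = minor (Ordinal mn) (col_perm s' g) * P m.+1 s' g.
  rewrite /P (bigD1 (Ordinal mn))//=; congr (_ * _); apply: eq_bigl => l.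
  by rewrite -val_eqE /= ltn_neqAle eq_sym andbC.
apply: (@rad_denominator_root _ 2).
rewrite (_ : (fun g => _) = fun g => P k.+2 s g * \sum_j
    (col_perm s g k1 (widen_ord (ltn_ord k1) j) * e j *
     (\prod_(l < n | (k < l)%N) d j l)) * P k (t j * s)%g g).
  apply: rad_denominatorM => //.
  apply: rad_denominator_sum => j.
    apply: GL_polynomialM => //; apply: GL_polynomialM; last exact: GL_polynomial_cst.
    apply: GL_polynomialM; last exact: GL_polynomial_cst.
    by under eq_fun do rewrite mxE; exact: GL_polynomial_entry.
  apply: rad_denominatorM; last exact: IH.
  apply: GL_polynomialM; last exact: GL_polynomial_cst.
  apply: GL_polynomialM; last exact: GL_polynomial_cst.
  by under eq_fun do rewrite mxE; exact: GL_polynomial_entry.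
apply/funext => g; rewrite -/(P k.+1 s g) expr2 {1}(PS k.+1 kn) -mulrA [LHS]mulrCA.
congr (_ * _); rewrite -/k1 expand mulr_suml; apply: eq_bigr => j _.
rewrite (PS k (ltnW kn)) -/k0 col_permM /=.
have -> : P k.+1 s g = (\prod_(l < n | (k < l)%N) d j l) * P k.+1 (t j * s)%g g.
  rewrite /P -big_split /=; apply: eq_bigr => l kl.
  by rewrite col_permM; exact: sign.
by ring.
Qed.

End radical.

Variable p : n.-tuple int.
Hypotheses (n_gt0 : (0 < n)%N) (p_signature : sorted >=%R p).

Lemma rad_denominator_det f : Pol R n f -> L2 (mu_p R p) f ->
  rad_denominator (Fext p f) (fun g => \det g).
Proof.
move=> pf Lf.
have I0 s : rad_denominator (Fext p f) (fun g => minors_prod (col_perm s g)).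
  have [f' [pf' _] e] := Fext_perm p_signature (s^-1)%g (conj pf Lf).
  have [m [E [pE EE]]] := cleared_Fext p pf'.
  exists m, (fun g => E (col_perm s g)); first exact: GL_polynomial_col_perm.
  apply: generically_sub (generically_col_perm s
    (generically_and e (generically_minors R n))) => g [e1 g0].
  by rewrite -EE// e1 -[in RHS]col_permM mulVg col_perm1.
have nE : n.-1.+1 = n by rewrite prednK.
pose k : 'I_n := Ordinal (eq_leq nE).
have := rad_denominator_minors I0 k 1%g.
rewrite (_ : (fun g => _) = fun g => \det g)//.
apply/funext => g; rewrite (big_pred1 k) ?col_perm1 ?minor_last// => l.
by rewrite /= -val_eqE eqn_leq /= [RHS]andbC -[X in _ && X]ltnS nE ltn_ord andbT.
Qed.

(** The equivariant extension of a square integrable polynomial has a power of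
    the determinant as its denominator, hence is regular on GL(n, C). *)
Lemma L2_Vspace f : Pol R n f -> L2 (mu_p R p) f -> Vspace R p f.
Proof.
move=> pf Lf; split => //.
have [m [G pG e]] := rad_denominator_det pf Lf.
pose F g : C := (\det g)^-1 ^+ m * G g.
have pF : GL_polynomial F.
  by apply: GL_polynomialM => //; apply: GL_polynomialX; exact: GL_polynomial_Vdet.
have FE : generically (fun g => Fext p f g = F g).
  apply: generically_sub (generically_and e (generically_unit R n)) => g [eg gu].
  by rewrite /F -eg mulrA -exprMn mulVr ?expr1n ?mul1r// -unitmxE.
exists F.
  split => // b g bt bu gu.
  apply: (@GL_polynomial_eq _ _ (fun x => F (b *m x)) (fun x => tri_char p b * F x)) => //.
  - have := GL_polynomial_mul bu (unitmx1 _ n) pF.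
    by under eq_fun do rewrite mulmx1.
  - by apply: GL_polynomialM => //; exact: GL_polynomial_cst.
  apply: generically_sub (generically_and FE (generically_mul bu (unitmx1 _ n) FE)) => x [E1 E2].
  by rewrite -E1 -FextM// -[in LHS](mulmx1 (b *m x)) -E2 mulmx1.
move=> Z; have [l [E [pE EE]]] := cleared_Fext p pf.
have Z0 : minors_prod Z != 0 by rewrite minors_prod_unitri oner_eq0.
have := EE Z Z0; rewrite Fext_unitri minors_prod_unitri expr1n mul1r => ->.
rewrite -[LHS]mul1r -[in LHS](expr1n _ l) -(minors_prod_unitri Z).
apply: (@GL_polynomial_eq _ _ (fun g => minors_prod g ^+ l * F g) E) => //.
- by apply: GL_polynomialM => //; apply: GL_polynomialX; exact: GL_polynomial_minors_prod.
- by apply: generically_sub (generically_and FE (generically_minors R n)) => g [<- /EE].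
exact: unitri_unitmx.
Qed.

End extension.

Theorem proposition1p1 (R : realType) (n : nat) (p : n.-tuple int)
    (n_gt0 : (0 < n)%N) (p_signature : sorted >=%R p) :
  Vspace R p = L2 (mu_p R p) `&` Pol R n
  /\
  (forall (g : 'M[R[i]]_n) (f1 f2 : unitri R n -> R[i]),
     g \is unitarymx -> Vspace R p f1 -> Vspace R p f2 ->
     L2_inner (mu_p R p) (rho p g f1) (rho p g f2) =
     L2_inner (mu_p R p) f1 f2).
Proof.
split; last by move=> g f1 f2; exact: L2_inner_unitary.
apply/seteqP; split => f [].
  by move=> pf vf; split => //; exact: (Vspace_L2 p_signature (conj pf vf)).
by move=> Lf pf; exact: L2_Vspace.
Qed.
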